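(* Let $\beta\in\mathbb R^{2d}$ and $\sigma\ge 0$ be constant, $f\in L^2(J\times\Omega)$, $g\in L^2(J\times\widehat\Gamma^-)$, $u_0\in L^2(\Omega)$. If $\delta>0$, and in addition $\delta<1/\sigma$ in the case $\sigma>0$, then the weak form of the streamline diffusion equation with constant coefficients, i.e. the problem of finding $U\in V_{L,\mathcal I}$ such that $$A_{\mathcal I}^{(\delta)}(U,w)=B_{\mathcal I}^{(\delta)}(u_0,f,g;w)\quad\text{for all } w\in V_{L,\mathcal I},$$ has a unique solution $U$. If $\sigma>0$ the system is stable in the sense that the solution satisfies $$|||U|||_\delta^2\;\lesssim\;\sum_{j=1}^N\int_{I_j}\big(\|f\|^2+|g|^2_{\widehat\Gamma^-}\big)\,\mathrm dt+\|u_0\|^2 .$$ For the case $\sigma=0$ a similar bound can be derived where, however, the constant depends exponentially on the final time $T$.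
   Context: Convention. $C\lesssim D$ means that $C$ is bounded by a multiple of $D$ independently of the level $L$ of the sparse grid; $C\sim D$ means $C\lesssim D$ and $D\lesssim C$. Domains. $d\in\{1,2,3\}$; $\Omega^{(1)},\Omega^{(2)}\subset\mathbb R^d$ are open polyhedral Lipschitz domains, $\Omega=\Omega^{(1)}\times\Omega^{(2)}\subset\mathbb R^{2d}$, with outward unit normal $n$ on $\partial\Omega$; $J=(0,T)$. $(\cdot,\cdot)$ and $\|\cdot\|$ are the inner product and norm of $L^2(\Omega)$. Discrete spaces. For $i=1,2$, $V^{(i)}_1\subset V^{(i)}_2\subset\dots\subset H^1(\Omega^{(i)})$ are nested conforming finite element spaces of piecewise polynomials obtained from $V_1^{(i)}$ by uniform refinement, with $\dim V^{(i)}_\ell\sim 2^{d\ell}$. The sparse grid space of level $L=1,2,\dots$ is $V_L=\sum_{\ell_1+\ell_2=L+1}V^{(1)}_{\ell_1}\otimes V^{(2)}_{\ell_2}$ (with $\ell_1,\ell_2\ge1$). Let $0=t_0<t_1<\dots<t_N=T$, $I_j=(t_{j-1},t_j)$, $\mathcal I=\{I_j\}_{j=1}^N$. For the fixed polynomial degree $r$, $V_{L,\mathcal I}=\{v\in L^2(J;V_L): v|_{I}\in\mathbb P^r(I;V_L)\ \text{for all } I\in\mathcal I\}$, where $\mathbb P^r(I;V_L)$ denotes the polynomials in $t$ of degree $r$ (i.e. at most $r$) with coefficients in $V_L$ (functions may jump at the $t_j$). Notation. $\partial_\beta v=\beta\cdot\nabla v$ (gradient in the $\Omega$ variable). $v_j^\pm=\lim_{t\to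 t_j^\pm}v(t,\cdot)$, $[v]_j=v_j^+-v_j^-$. $\widehat\Gamma^\pm=\{x\in\partial\Omega:\ \beta\cdot n(x)\gtrless0\}$. For $\widehat\Gamma\subset\partial\Omega$: $\langle u,v\rangle_{\widehat\Gamma}=\int_{\widehat\Gamma}(\beta\cdot n)uv\,\mathrm ds$ and $|u|_{\widehat\Gamma}^2=\int_{\widehat\Gamma}|\beta\cdot n|u^2\,\mathrm ds$. Forms (discretization with streamline diffusion parameter $\delta$ of $\partial_tu+\beta\cdot\nabla u+\sigma u=f$ in $J\times\Omega$, $u(0)=u_0$, $u=g$ on the inflow boundary $J\times\widehat\Gamma^-$): $$A_{\mathcal I}^{(\delta)}(v,w)=\sum_{j=1}^N\int_{I_j}\Big[\big(\partial_tv+\partial_\beta v+\sigma v,\;w+\delta(\partial_tw+\partial_\beta w)\big)-\langle v,w\rangle_{\widehat\Gamma^-}\Big]\mathrm dt+\sum_{j=1}^{N-1}([v]_j,w_j^+)+(v_0^+,w_0^+),$$ $$B_{\mathcal I}^{(\delta)}(u_0,f,g;w)=\sum_{j=1}^N\int_{I_j}\Big[\big(f,\;w+\delta(\partial_tw+\partial_\beta w)\big)-\langle g,w\rangle_{\widehat\Gamma^-}\Big]\mathrm dt+(u_0,w_0^+).$$ Streamline diffusion norm: $$|||v|||_\delta^2=\sum_{j=1}^N\int_{I_j}\Big[\sigma\|v\|^2+\delta\|\partial_tv+\partial_\beta v\|^2+|v|_{\partial\Omega}^2\Big]\mathrm dt+\sum_{j=1}^{N-1}\|[v]_j\|^2+\|v_0^+\|^2+\|v_N^-\|^2.$$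 *)

(* Defs.v *)
From HB Require Import structures.
From mathcomp Require Import all_boot all_order all_algebra.
From mathcomp Require Import all_classical all_reals all_analysis measurable_realfun.
Set Implicit Arguments. Unset Strict Implicit. Unset Printing Implicit Defensive.
Import Order.TTheory GRing.Theory Num.Theory.
Import numFieldNormedType.Exports.
Local Open Scope classical_set_scope.
Local Open Scope ring_scope.

Definition measure_matrix_display : measure_display.
Proof. exact: default_measure_display. Qed.

Section matrix_measurable.
Context (R : realType) (m n : nat).

Definition matrix_cylinders : set (set 'M[R]_(m, n)) :=
  [set A | exists (i : 'I_m) (j : 'I_n), exists2 B : set R,
     measurable B & A = [set M : 'M[R]_(m, n) | B (M i j)]].

Let mx_set0 : <<s matrix_cylinders >> set0.
Proof. exact: sigma_algebra0. Qed.

Let mx_setC A : <<s matrix_cylinders >> A -> <<s matrix_cylinders >> (~` A).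
Proof. exact: sigma_algebraC. Qed.

Let mx_bigcup (F : (set 'M[R]_(m, n))^nat) :
  (forall i, <<s matrix_cylinders >> (F i)) ->
  <<s matrix_cylinders >> (\bigcup_i F i).
Proof. exact: sigma_algebra_bigcup. Qed.

HB.instance Definition _ := @isMeasurable.Build measure_matrix_display
  'M[R]_(m, n) <<s matrix_cylinders >> mx_set0 mx_setC mx_bigcup.

End matrix_measurable.

Section matrix_measurability.
Context (R : realType).

Lemma measurable_coord m n i j :
  measurable_fun [set: 'M[R]_(m, n)] (fun M => M i j).
Proof.
move=> _ B mB; rewrite setTI; apply: sub_sigma_algebra.
by exists i, j, B.
Qed.

Lemma measurable_fun_matrix d (T : measurableType d) m n
    (f : T -> 'M[R]_(m, n)) :
  (forall i j, measurable_fun setT (fun t => f t i j)) -> measurable_fun setT f.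
Proof.
move=> mf _ A mA; rewrite setTI.
suff H : <<s matrix_cylinders (R := R) (m := m) (n := n) >> `<=`
    [set A | measurable (f @^-1` A)] by exact: H.
apply: smallest_sub.
  split => /=.
  - by rewrite preimage_set0.
  - by move=> B mB; rewrite setTD preimage_setC; exact: measurableC.
  - by move=> F mF; rewrite preimage_bigcup; exact: bigcup_measurable.
by move=> _ [i [j [B mB ->]]]; have := mf i j measurableT B mB; rewrite setTI.
Qed.

Lemma open_measurable_matrix m n (U : set 'M[R]_(m, n)) :
  open U -> measurable U.
Proof.
move=> oU.
pose box (p : 'M[rat]_(m, n) * nat) : set 'M[R]_(m, n) :=
  [set x | forall i j, `|ratr (p.1 i j) - x i j| < p.2.+1%:R^-1].
have -> : U = \bigcup_p (if `[< box p `<=` U >] then box p else set0).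
  apply/seteqP; split => [x Ux|x [p _]]; last by case: asboolP => // pU /pU.
  have /nbhs_ballP[e /= e0 xe] := open_nbhs_nbhs (conj oU Ux).
  have [k /= ke] : exists k : nat, (k.+1%:R^-1 : R) < e / 2.
    exists (Num.truncn (e / 2)^-1).
    rewrite invf_plt ?posrE ?divr_gt0//.
    by rewrite truncnS_gt.
  have Q i j : {q : rat | `|ratr q - x i j| < k.+1%:R^-1}.
    apply: cid; have h : (0 : R) < k.+1%:R^-1 by rewrite invr_gt0.
    have /rat_in_itvoo[q] : x i j - k.+1%:R^-1 < x i j + k.+1%:R^-1.
      by rewrite ltrBlDr -addrA ltrDl addr_gt0.
    by rewrite in_itv /= => qx; exists q; rewrite ltr_distl.
  exists (\matrix_(i, j) sval (Q i j), k) => //.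
  have bx : box (\matrix_(i, j) sval (Q i j), k) x.
    by move=> i j; rewrite mxE; case: (Q i j).
  case: asboolP => // -[] y yb; apply: xe; split=> // i j; rewrite /ball/=.
  rewrite -[X in `|X|](subrKA (ratr (sval (Q i j)))).
  rewrite (le_lt_trans (ler_normD _ _))//.
  rewrite (splitr e) ltrD// (lt_trans _ ke)//; first by rewrite distrC; case: (Q i j).
  by have := yb i j; rewrite mxE.
apply: countable_bigcupT_measurable; first exact: countableP.
move=> p; case: asboolP => // _.
have -> : box p = \bigcap_(i in [set: 'I_m]) \bigcap_(j in [set: 'I_n])
    [set x | `|ratr (p.1 i j) - x i j| < p.2.+1%:R^-1].
  by apply/seteqP; split => x /= h; [move=> i _ j _; exact: h|move=> i j; exact: h].
apply: fin_bigcap_measurable => // i _; apply: fin_bigcap_measurable => // j _.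
rewrite [X in measurable X](_ : _ = setT `&` (fun x : 'M[R]_(m, n) => x i j) @^-1`
   [set r | `|ratr (p.1 i j) - r| < p.2.+1%:R^-1]); last by rewrite setTI.
apply: measurable_coord => //.
exact: (measurable_ball (ratr (p.1 i j)) (p.2.+1%:R^-1)).
Qed.

End matrix_measurability.

Section lebesgue_measure_rV.
Context (R : realType).
Local Open Scope ereal_scope.

Definition cons_rV n (p : R * 'rV[R]_n) : 'rV[R]_n.+1 :=
  \row_j (if unlift ord0 j is Some k then p.2 ord0 k else p.1)%R.

Lemma measurable_cons_rV n : measurable_fun setT (@cons_rV n).
Proof.
apply: measurable_fun_matrix => i j; case: (unliftP ord0 j) => [k ->|->].
- rewrite (_ : (fun _ => _) = (fun M : 'rV[R]_n => M ord0 k) \o snd).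
    by apply: measurableT_comp => //; exact: measurable_coord.
  by apply/funext => p; rewrite mxE liftK.
- rewrite (_ : (fun _ => _) = fst) ?measurable_fst//.
  by apply/funext => p; rewrite mxE unlift_none.
Qed.

Fixpoint lebesgue_rV n : set 'rV[R]_n -> \bar R :=
  if n is n'.+1 then
    pushforward (lebesgue_measure \x @lebesgue_rV n') (@cons_rV n')
  else dirac (0%R : 'rV[R]_0).

Definition rV_box n (k : nat) : set 'rV[R]_n :=
  [set x | forall j, `|x ord0 j|%R <= k%:R]%R.

Arguments rV_box : clear implicits.

Lemma measurable_rV_box n k : measurable (rV_box n k).
Proof.
have -> : rV_box n k = \bigcap_(j in [set: 'I_n])
    [set x : 'rV[R]_n | `|x ord0 j|%R <= k%:R]%R.
  by apply/seteqP; split => x /= h; [move=> j _; exact: h|move=> j; exact: h].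
apply: fin_bigcap_measurable => // j _.
rewrite [X in measurable X](_ : _ = setT `&` (fun x : 'rV[R]_n => x ord0 j) @^-1`
   `[- k%:R, k%:R]%classic%R).
  by apply: measurable_coord => //; exact: measurable_itv.
by rewrite setTI; apply/seteqP; split => x /=; rewrite in_itv/= ler_norml.
Qed.

Lemma bigcup_rV_box n : \bigcup_k rV_box n k = setT.
Proof.
apply/seteqP; split => // x _.
exists (Num.truncn `|x|%R).+1 => // j; apply: ltW.
apply: le_lt_trans (truncnS_gt `|x|%R).
rewrite [leRHS]/Num.Def.normr/= mx_normrE.
by apply: (le_bigmax _ (fun ij => `|x ij.1 ij.2|%R) (ord0, j)).
Qed.

Lemma lebesgue_rV_subproof n :
  [/\ @lebesgue_rV n set0 = 0, (forall A, 0 <= @lebesgue_rV n A),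
      semi_sigma_additive (@lebesgue_rV n) &
      (forall k, lebesgue_rV (rV_box n k) < +oo)].
Proof.
elim: n => [|n [mu0 mu_ge0 mu_add mu_box]].
  split; [exact: measure0|by []|exact: measure_semi_sigma_additive|].
  by move=> k; rewrite /= diracE; case: (_ \in _); rewrite ltry.
pose M := isMeasure.Build _ _ _ (@lebesgue_rV n) mu0 mu_ge0 mu_add.
pose mM : {measure set 'rV[R]_n -> \bar R} := HB.pack (@lebesgue_rV n) M.
have sfM : sigma_finite setT mM.
  exists (rV_box n); first by rewrite bigcup_rV_box.
  by move=> k; split; [exact: measurable_rV_box|exact: mu_box].
pose S := Measure_isSigmaFinite.Build _ _ _ mM sfM.
pose mu : {sigma_finite_measure set 'rV[R]_n -> \bar R} :=
  HB.pack (@lebesgue_rV n) M S.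
pose P : {measure set (measurableTypeR R * 'rV[R]_n) -> \bar R} :=
  lebesgue_measure \x mu.
have mc := @measurable_cons_rV n.
split.
- rewrite /= /pushforward preimage_set0; exact: (measure0 P).
- by move=> A; exact: (measure_ge0 P).
- exact: (@measure_semi_sigma_additive _ _ _ (pushforward P (@cons_rV n))).
move=> k; rewrite /= /pushforward.
have -> : @cons_rV n @^-1` rV_box n.+1 k = `[- k%:R, k%:R]%classic%R `*` rV_box n k.
  apply/seteqP; split => -[x y] /= h.
    split; first by have := h ord0; rewrite mxE unlift_none in_itv/= ler_norml.
    by move=> j; have := h (lift ord0 j); rewrite mxE liftK.
  move=> j; case: h; rewrite in_itv/= -ler_norml => hx hy.
  by case: (unliftP ord0 j) => [i|] ->; rewrite mxE ?liftK ?unlift_none.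
rewrite -[lebesgue_rV (n := n)]/(mu : set _ -> _) product_measure1E//; last first.
  exact: measurable_rV_box.
rewrite lte_mul_pinfty// ?mu_box//.
rewrite ge0_fin_numE//.
have H := lebesgue_measure_itv `[(- k%:R)%R, k%:R : R].
apply: (@eq_ind_r _ _ (fun x => x < +oo) _ _ H) => /=.
by case: ifP => _; rewrite ?ltry// -EFinB ltry.
Qed.

Let lebesgue_rV0 n : @lebesgue_rV n set0 = 0.
Proof. by case: (lebesgue_rV_subproof n). Qed.

Let lebesgue_rV_ge0 n A : 0 <= @lebesgue_rV n A.
Proof. by case: (lebesgue_rV_subproof n). Qed.

Let lebesgue_rV_sigma_additive n : semi_sigma_additive (@lebesgue_rV n).
Proof. by case: (lebesgue_rV_subproof n). Qed.

HB.instance Definition _ n := isMeasure.Build _ _ _ (@lebesgue_rV n)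
  (@lebesgue_rV0 n) (@lebesgue_rV_ge0 n) (@lebesgue_rV_sigma_additive n).

Let lebesgue_rV_sigma_finite n : sigma_finite setT (@lebesgue_rV n).
Proof.
exists (rV_box n); first by rewrite bigcup_rV_box.
move=> k; split; first exact: measurable_rV_box.
by case: (lebesgue_rV_subproof n).
Qed.

HB.instance Definition _ n := Measure_isSigmaFinite.Build _ _ _
  (@lebesgue_rV n) (@lebesgue_rV_sigma_finite n).

End lebesgue_measure_rV.
Arguments lebesgue_rV {R n}.

Section surface.
Context (R : realType) (m : nat).
Implicit Types (p : 'rV[R]_m * R) (A Om : set 'rV[R]_m) (x nu : 'rV[R]_m).

Definition dotv (u v : 'rV[R]_m) : R := \sum_j u ord0 j * v ord0 j.

Definition boundary A : set 'rV[R]_m := closure A `\` interior A.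

(* The parametrization of the hyperplane {x | dotv p.1 x = p.2}, p.1 i <> 0,
   by the coordinates other than the i-th one. *)
Definition hyperplane_graph p (i : 'I_m) (y : 'rV[R]_m.-1) : 'rV[R]_m :=
  \row_k if unlift i k is Some j then y ord0 j
         else (p.2 - \sum_j p.1 ord0 (lift i j) * y ord0 j) / p.1 ord0 i.

(* Surface measure of a hyperplane with unit normal p.1, computed on a graph
   x_i = phi(y): the surface element sqrt (1 + |grad phi|^2) is 1 / |p.1 i|. *)
Definition hyperplane_measure p A : \bar R :=
  if [pick i | p.1 ord0 i != 0] is Some i then
    (`|p.1 ord0 i|^-1)%:E * lebesgue_rV (hyperplane_graph p i @^-1` A)
  else 0%E.

Definition is_outward_normal Om x nu : Prop :=
  dotv nu nu = 1 /\
  exists2 e : R, 0 < e &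
    forall y, ball x e y -> (Om y <-> dotv nu (y - x) < 0).

(* 0 on the edges of a polyhedron, where there is no normal *)
Definition outward_normal Om x : 'rV[R]_m :=
  xget 0 [set nu | is_outward_normal Om x nu].

Definition facet Om p : set 'rV[R]_m :=
  [set x | is_outward_normal Om x p.1 /\ dotv p.1 x = p.2].

(* The surface measure on the boundary of a polyhedral set: the edges are
   negligible, and only finitely many terms are not 0. *)
Definition surface_measure Om A : \bar R :=
  \esum_(p in [set p | facet Om p !=set0])
    hyperplane_measure p (A `&` facet Om p).

Lemma measurable_hyperplane_graph p i :
  measurable_fun setT (hyperplane_graph p i).
Proof.
apply: measurable_fun_matrix => r k; rewrite /hyperplane_graph.
case: (unliftP i k) => [j ->|->].
- rewrite (_ : (fun _ => _) = fun y : 'rV[R]_m.-1 => y ord0 j).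
    exact: measurable_coord.
  by apply/funext => y; rewrite mxE liftK.
- rewrite (_ : (fun _ => _) = fun y : 'rV[R]_m.-1 =>
     (p.2 - \sum_j p.1 ord0 (lift i j) * y ord0 j) / p.1 ord0 i).
    apply: measurable_funM => //; apply: measurable_funB => //.
    apply: measurable_sum => j; apply: measurable_funM => //.
    exact: measurable_coord.
  by apply/funext => y; rewrite mxE unlift_none.
Qed.

Let hyperplane_measure0 p : hyperplane_measure p set0 = 0%E.
Proof.
rewrite /hyperplane_measure; case: pickP => // i _.
by rewrite preimage_set0 measure0 mule0.
Qed.

Let hyperplane_measure_ge0 p A : (0 <= hyperplane_measure p A)%E.
Proof.
rewrite /hyperplane_measure; case: pickP => // i _.
by rewrite mule_ge0// lee_fin.
Qed.

Let hyperplane_measure_sigma_additive p :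
  semi_sigma_additive (hyperplane_measure p).
Proof.
rewrite /hyperplane_measure; case: pickP => [i _|_].
  have mg := @measurable_hyperplane_graph p i.
  exact: (@measure_semi_sigma_additive _ _ _
    (mscale (`|p.1 ord0 i|^-1)%:nng
       (pushforward lebesgue_rV (hyperplane_graph p i)))).
exact: (@measure_semi_sigma_additive _ _ _ mzero).
Qed.

HB.instance Definition _ p := isMeasure.Build _ _ _ (hyperplane_measure p)
  (hyperplane_measure0 p) (@hyperplane_measure_ge0 p)
  (@hyperplane_measure_sigma_additive p).

Lemma continuous_dotv nu : continuous (dotv nu).
Proof.
move=> x; rewrite /dotv; apply: (@cvg_big R _ +%R 0 xpredT) => [||j _].
- exact: add_continuous.
- exact: (@nbhs_filter 'rV[R]_m x).
apply: (@cvgM _ _ (nbhs x) _ (cst (nu ord0 j))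
  (fun v : 'rV[R]_m => v ord0 j)); first exact: cvg_cst.
exact: (@coord_continuous R 1 m ord0 j x).
Qed.

Lemma measurable_facet Om p : measurable (facet Om p).
Proof.
have [p1|p1] := eqVneq (dotv p.1 p.1) 1; last first.
  rewrite (_ : facet _ _ = set0)//; apply/seteqP; split => x // -[[pp _] _].
  by rewrite pp eqxx in p1.
pose U := \bigcup_(xe in [set xe : 'rV[R]_m * R | 0 < xe.2 /\
  forall y, ball xe.1 xe.2 y -> (Om y <-> dotv p.1 y < p.2)]) ball xe.1 xe.2.
rewrite (_ : facet Om p = U `&` dotv p.1 @^-1` [set p.2]).
  apply: measurableI.
    by apply: open_measurable_matrix; apply: bigcup_open => -[x e] _; exact: ball_open.
  rewrite -[X in measurable X]setCK; apply: measurableC.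
  apply: open_measurable_matrix; rewrite preimage_setC.
  apply: open_comp; first by move=> x _; exact: continuous_dotv.
  by rewrite openC; exact: closed_eq.
have dotvB y x : dotv p.1 (y - x) = dotv p.1 y - dotv p.1 x.
  by rewrite /dotv -sumrB; apply: eq_bigr => j _; rewrite !mxE mulrBr.
apply/seteqP; split => x.
  case=> -[_ [e e0 xe]] px; split => //; exists (x, e) => /=; last exact: ballxx.
  by split => // y /xe; rewrite dotvB px subr_lt0.
case=> -[[z e]/= [e0 ze] zx] px; split=> //; split => //.
have /nbhs_ballP[r /= r0 xr] : nbhs x (ball z e).
  by apply: open_nbhs_nbhs; split => //; exact: ball_open.
by exists r => // y /xr/ze; rewrite dotvB px subr_lt0.
Qed.

Let surface_measure0 Om : surface_measure Om set0 = 0%E.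
Proof. by apply: esum1 => p _; rewrite set0I measure0. Qed.

Let surface_measure_ge0 Om A : (0 <= surface_measure Om A)%E.
Proof. by apply: esum_ge0 => p _; exact: measure_ge0. Qed.

Let surface_measure_sigma_additive Om :
  semi_sigma_additive (surface_measure Om).
Proof.
move=> F mF tF mUF.
rewrite [X in _ --> X](_ : _ = (\sum_(n <oo) surface_measure Om (F n))%E).
  by apply: is_cvg_nneseries => n _ _; exact: surface_measure_ge0.
rewrite nneseries_esumT// [RHS]esum_esum; last by move=> *; exact: measure_ge0.
rewrite [LHS](_ : _ = \esum_(p in [set p | facet Om p !=set0])
    \esum_(n in [set: nat]) hyperplane_measure p (F n `&` facet Om p)); last first.
  rewrite /surface_measure; apply: eq_esum => p _; rewrite -nneseries_esumT; last by move=> n; exact: measure_ge0.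
  apply/esym/cvg_lim => //; rewrite setI_bigcupl.
  have mFf n : measurable (F n `&` facet Om p).
    by apply: measurableI => //; exact: measurable_facet.
  apply: measure_semi_sigma_additive => //.
  - by apply: trivIset_setIr.
  - exact: bigcup_measurable.
rewrite esum_esum; last by move=> *; exact: measure_ge0.
apply: (@reindex_esum _ _ _ _ _ (fun np : nat * _ => (np.2, np.1))
  (fun pn => hyperplane_measure pn.1 (F pn.2 `&` facet Om pn.1))).
split => [[n q] [_ fq]//|[n q] [n' q'] _ _ /= [-> ->]//|[q n] [fq _]].
by exists (n, q).
Qed.

HB.instance Definition _ Om := isMeasure.Build _ _ _ (surface_measure Om)
  (surface_measure0 Om) (@surface_measure_ge0 Om)
  (@surface_measure_sigma_additive Om).

End surface.

Section square_integrable.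
Context d (T : measurableType d) (R : realType).

Definition square_integrable (mu : set T -> \bar R) (D : set T) (f : T -> R) :=
  measurable_fun D f /\ (\int[mu]_(x in D) ((f x) ^+ 2)%:E < +oo)%E.

End square_integrable.

Section domains.
Context (R : realType) (d : nat).
Implicit Types Om : set 'rV[R]_d.

(* In suitable Cartesian coordinates (given by the orthogonal matrix Q), Om is
   locally the set of the points below the graph of a Lipschitz function. *)
Definition lipschitz_boundary Om :=
  forall x, boundary Om x ->
  exists (Q : 'M[R]_d) (i : 'I_d) (phi : 'rV[R]_d.-1 -> R) (e : R),
    [/\ 0 < e, Q *m Q^T = 1%:M, [lipschitz phi z | z in setT] &
      forall y, ball x e y ->
        (Om y <-> (y *m Q) ord0 i < phi (col' i (y *m Q)))].

Definition polyhedral_boundary Om :=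
  exists H : seq ('rV[R]_d * R),
    (forall p, p \in H -> p.1 != 0) /\
    (forall x, boundary Om x -> exists2 p, p \in H & dotv p.1 x = p.2).

Definition polyhedral_lipschitz_domain Om :=
  [/\ open Om, Om !=set0, connected Om & bounded_set Om] /\
  lipschitz_boundary Om /\ polyhedral_boundary Om.

End domains.

Section sobolev.
Context (R : realType) (d : nat).
Implicit Types (Om : set 'rV[R]_d) (v g phi : 'rV[R]_d -> R).

Definition partial (i : 'I_d) v : 'rV[R]_d -> R :=
  fun x => 'D_(delta_mx ord0 i) v x.

Definition smooth v :=
  forall s : seq 'I_d, let w := foldr partial v s in
    continuous w /\ forall x i, derivable w x (delta_mx ord0 i).

Definition test_function Om phi :=
  smooth phi /\
  exists2 K, compact K /\ K `<=` Om & forall x, ~ K x -> phi x = 0.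

Definition weak_partial Om (i : 'I_d) v g :=
  forall phi, test_function Om phi ->
    \int[lebesgue_rV]_(x in Om) (v x * partial i phi x) =
    - \int[lebesgue_rV]_(x in Om) (g x * phi x).

Definition sobolev_H1 Om v :=
  square_integrable lebesgue_rV Om v /\
  forall i, exists2 g, square_integrable lebesgue_rV Om g &
    weak_partial Om i v g.

End sobolev.

Section finite_elements.
Context (R : realType) (d : nat).
Implicit Types (Om : set 'rV[R]_d) (V : set ('rV[R]_d -> R)).

Definition cell (h : seq ('rV[R]_d * R)) : set 'rV[R]_d :=
  [set x | forall p, p \in h -> dotv p.1 x < p.2].

(* A mesh is a list of open convex polytopes, given by their half-spaces. *)
Definition is_mesh Om (M : seq (seq ('rV[R]_d * R))) :=
  [/\ forall h, h \in M -> cell h !=set0 /\ cell h `<=` Om,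
      forall i j, (i < j < size M)%N ->
        cell (nth [::] M i) `&` cell (nth [::] M j) = set0 &
      Om `<=` \bigcup_(h in [set` M]) closure (cell h)].

Definition refines (M M' : seq (seq ('rV[R]_d * R))) :=
  (forall h', h' \in M' -> exists2 h, h \in M & cell h' `<=` cell h) /\
  (forall h, h \in M ->
    count (fun h' => `[< cell h' `<=` cell h >]) M' = (2 ^ d)%N).

(* Uniform refinement of the initial mesh M 1: the cells of the level l have
   their diameter and their inradius of the order of 2 ^ - l. *)
Definition uniform_refinements Om (M : nat -> seq (seq ('rV[R]_d * R))) :=
  [/\ forall l, (1 <= l)%N -> is_mesh Om (M l),
      forall l, (1 <= l)%N -> refines (M l) (M l.+1) &
      exists c C : R, [/\ 0 < c, 0 < C &
        forall l h, (1 <= l)%N -> h \in M l ->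
          (exists x, ball x (c / 2 ^+ l) `<=` cell h) /\
          (forall x y, cell h x -> cell h y -> `|x - y| <= C / 2 ^+ l)]].

(* degree at most k in each variable, hence P_k and Q_k are both covered *)
Definition is_polynomial (k : nat) (q : 'rV[R]_d -> R) :=
  exists a : {ffun 'I_d -> 'I_k.+1} -> R,
    forall x, q x = \sum_e a e * \prod_i x ord0 i ^+ e i.

Definition piecewise_polynomial k (M : seq (seq ('rV[R]_d * R)))
    (v : 'rV[R]_d -> R) :=
  forall h, h \in M ->
    exists2 q, is_polynomial k q & forall x, cell h x -> v x = q x.

Definition has_dim V (n : nat) :=
  exists b : 'I_n -> 'rV[R]_d -> R,
    (forall a : 'I_n -> R,
       (forall x, \sum_i a i * b i x = 0) -> forall i, a i = 0) /\
    V = [set v | exists a : 'I_n -> R, v = fun x => \sum_i a i * b i x].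

(* Piecewise polynomials in H^1 (Om) have a continuous representative on the
   closure of Om; the elements of a finite element space are these
   representatives, extended by 0, so that their traces on the boundary of Om
   are restrictions. *)
Definition conforming Om (v : 'rV[R]_d -> R) :=
  [/\ sobolev_H1 Om v, {within closure Om, continuous v} &
      forall x, ~ closure Om x -> v x = 0].

(* the levels are l = 1, 2, ...; V 0 is irrelevant *)
Definition finite_element_spaces Om (V : nat -> set ('rV[R]_d -> R)) :=
  (exists M, uniform_refinements Om M /\
     exists k, forall l v, (1 <= l)%N -> V l v ->
       conforming Om v /\ piecewise_polynomial k (M l) v) /\
  (forall l, (1 <= l)%N -> V l `<=` V l.+1) /\
  exists n : nat -> nat,
    (forall l, (1 <= l)%N -> has_dim (V l) (n l)) /\
    exists c C : R, [/\ 0 < c, 0 < C &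
      forall l, (1 <= l)%N ->
        c * 2 ^+ (d * l) <= (n l)%:R <= C * 2 ^+ (d * l)].

End finite_elements.

Section sparse_grids.
Context (R : realType) (d : nat).

Definition product_domain (Om1 Om2 : set 'rV[R]_d) : set 'rV[R]_(d + d) :=
  [set x | Om1 (lsubmx x) /\ Om2 (rsubmx x)].

Definition tensor_space (V W : set ('rV[R]_d -> R)) :
    set ('rV[R]_(d + d) -> R) :=
  [set v | exists (n : nat) (a b : 'I_n -> 'rV[R]_d -> R),
    [/\ forall i, V (a i), forall i, W (b i) &
        v = fun x => \sum_i a i (lsubmx x) * b i (rsubmx x)]].

Definition sparse_grid (V1 V2 : nat -> set ('rV[R]_d -> R)) (L : nat) :
    set ('rV[R]_(d + d) -> R) :=
  [set v | exists2 w : nat -> 'rV[R]_(d + d) -> R,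
    forall l, (1 <= l <= L)%N -> tensor_space (V1 l) (V2 (L.+1 - l)%N) (w l) &
    v = fun x => \sum_(1 <= l < L.+1) w l x].

End sparse_grids.

Section time_discretization.
Context (R : realType) (m : nat).

Definition time_grid (T : R) (N : nat) (tn : nat -> R) :=
  [/\ tn 0%N = 0, tn N = T & forall j, (j < N)%N -> tn j < tn j.+1].

Definition slab (tn : nat -> R) (j : nat) : set R :=
  [set t | tn j.-1 < t < tn j].

(* Only the values on the open intervals I_j matter. *)
Definition space_time (V : set ('rV[R]_m -> R)) (r N : nat) (tn : nat -> R) :
    set (R -> 'rV[R]_m -> R) :=
  [set v | forall j, (1 <= j <= N)%N ->
    exists2 c : 'I_r.+1 -> 'rV[R]_m -> R, forall k, V (c k) &
      forall t, slab tn j t -> v t = fun x => \sum_(k < r.+1) t ^+ k * c k x].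

End time_discretization.

Section forms.
Context (R : realType) (m : nat).
Variables (Om : set 'rV[R]_m) (beta : 'rV[R]_m) (sigma delta : R).
Variables (N : nat) (tn : nat -> R).
Implicit Types (u v w : 'rV[R]_m -> R) (G : set 'rV[R]_m).
Implicit Types (V W : R -> 'rV[R]_m -> R).

Local Notation normal := (outward_normal Om).

Definition inner u v : R := \int[lebesgue_rV]_(x in Om) (u x * v x).

Definition norm2 u : R := inner u u.

Definition inflow : set 'rV[R]_m :=
  [set x | boundary Om x /\ dotv beta (normal x) < 0].

Definition bd_inner G u v : R :=
  \int[surface_measure Om]_(x in G) (dotv beta (normal x) * u x * v x).

Definition bd_norm2 G u : R :=
  \int[surface_measure Om]_(x in G) (`|dotv beta (normal x)| * u x ^+ 2).

Definition trace_right V (t : R) : 'rV[R]_m -> R :=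
  fun x => lim (V s x @[s --> t^'+]).

Definition trace_left V (t : R) : 'rV[R]_m -> R :=
  fun x => lim (V s x @[s --> t^'-]).

Definition jump V (t : R) : 'rV[R]_m -> R :=
  fun x => trace_right V t x - trace_left V t x.

(* The pointwise directional derivative of a piecewise polynomial exists off
   the interfaces of the cells and equals the weak one almost everywhere. *)
Definition material_derivative V (t : R) : 'rV[R]_m -> R :=
  fun x => derive1 (fun s => V s x) t + 'D_beta (V t) x.

Local Notation D := material_derivative.

Definition sum_slabs (F : R -> R) : R :=
  \sum_(1 <= j < N.+1) \int[lebesgue_measure]_(t in slab tn j) F t.

Definition bilinear_form V W : R :=
  sum_slabs (fun t =>
    inner (fun x => D V t x + sigma * V t x)
          (fun x => W t x + delta * D W t x)
    - bd_inner inflow (V t) (W t))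
  + \sum_(1 <= j < N) inner (jump V (tn j)) (trace_right W (tn j))
  + inner (trace_right V (tn 0)) (trace_right W (tn 0)).

Definition linear_form (u0 : 'rV[R]_m -> R) (f g : R * 'rV[R]_m -> R) W : R :=
  sum_slabs (fun t =>
    inner (fun x => f (t, x)) (fun x => W t x + delta * D W t x)
    - bd_inner inflow (fun x => g (t, x)) (W t))
  + inner u0 (trace_right W (tn 0)).

Definition sd_norm2 V : R :=
  sum_slabs (fun t =>
    sigma * norm2 (V t) + delta * norm2 (D V t)
    + bd_norm2 (boundary Om) (V t))
  + \sum_(1 <= j < N) norm2 (jump V (tn j))
  + norm2 (trace_right V (tn 0)) + norm2 (trace_left V (tn N)).

Definition data_norm2 (u0 : 'rV[R]_m -> R) (f g : R * 'rV[R]_m -> R) : R :=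
  sum_slabs (fun t =>
    norm2 (fun x => f (t, x)) + bd_norm2 inflow (fun x => g (t, x)))
  + norm2 u0.

Definition admissible_data (T : R) u0 (f g : R * 'rV[R]_m -> R) :=
  [/\ square_integrable lebesgue_rV Om u0,
      square_integrable (lebesgue_measure \x lebesgue_rV)%E
        (`]0, T[%classic `*` Om) f &
      square_integrable (lebesgue_measure \x surface_measure Om)%E
        (`]0, T[%classic `*` inflow) g].

Definition sd_solution (X : set (R -> 'rV[R]_m -> R)) u0 f g U :=
  X U /\ forall W, X W -> bilinear_form U W = linear_form u0 f g W.

End forms.

(* Main.v *)
From HB Require Import structures.
Require Import Defs.
From mathcomp Require Import all_boot all_order all_algebra.
From mathcomp Require Import all_classical all_reals all_analysis measurable_realfun.
From mathcomp Require Import ring lra.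
Import Order.TTheory GRing.Theory Num.Theory.
Import numFieldNormedType.Exports.
Set Implicit Arguments. Unset Strict Implicit. Unset Printing Implicit Defensive.
Local Open Scope classical_set_scope.
Local Open Scope ring_scope.

(* On the sparse grid space the pointwise derivative in the direction beta,
   which exists off finitely many hyperplanes, satisfies Green's formula with
   the boundary flux. Let D be its sum with the time derivative. Integrating
   by parts in time and space and absorbing the term sigma delta (v, D v) by
   Young's inequality, which is where sigma delta <= 1 enters, one gets 2 A(v, v) >= |||v|||^2, truncated at any
   grid point. If |||v||| = 0 then v vanishes at the end of the last slab, D v
   and the boundary trace vanish, so v = 0 on that slab by the energy identity,
   and the jumps propagate this backwards: the form is definite on a space of
   finite dimension, and a solution exists and is unique. For the stability,
   test with the solution; if sigma = 0 the term |v|^2 is estimated by the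
   energy at the grid points, obtained by testing with v truncated in time. *)

(** * Lebesgue measure of row vectors, one coordinate at a time *)

(** Green's formula is obtained by Fubini along each coordinate axis: on almost every line the
    function is a finite chain of univariate polynomials, and its jumps where the line crosses the
    boundary make up the flux. Lines through an edge of the arrangement of hyperplanes are
    discarded. On the others one must know that the domain lies on exactly one side of a boundary
    hyperplane; the Lipschitz charts give this in the factors, and it passes to the product.

    Two more obstacles shape the proof. The derivative in the forms is pointwise and may be
    arbitrary on the interfaces, so integrals are compared off null sets without measurability. The
    data [f] and [g] are square integrable on a product only, whereas the estimates fix [t]; they
    are replaced by representatives all of whose sections are square integrable.

    For [sigma = 0] the place of a Gronwall argument is taken by an estimate up to the grid point of
    largest energy. It gives a constant polynomial in [T], which the exponential dominates. *)

Section insert_coordinate.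
Context (R : realType).

(** [lebesgue_rV] is built by prepending coordinates; insertion at an arbitrary position [i] makes
    Fubini available along every axis. *)
Definition ins_rV n (i : 'I_n.+1) (p : R * 'rV[R]_n) : 'rV[R]_n.+1 :=
  \row_k if unlift i k is Some j then p.2 ord0 j else p.1.

Lemma ins_rV_i n (i : 'I_n.+1) p : ins_rV i p ord0 i = p.1.
Proof. by rewrite mxE unlift_none. Qed.

Lemma ins_rV_lift n (i : 'I_n.+1) p j : ins_rV i p ord0 (lift i j) = p.2 ord0 j.
Proof. by rewrite mxE liftK. Qed.

Lemma ins_rV_col' n (i : 'I_n.+1) (x : 'rV[R]_n.+1) :
  ins_rV i (x ord0 i, col' i x) = x.
Proof.
by apply/rowP => k; case: (unliftP i k) => [j|] ->; rewrite ?ins_rV_i ?ins_rV_lift// mxE.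
Qed.

Lemma col'_ins_rV n (i : 'I_n.+1) p : col' i (ins_rV i p) = p.2.
Proof. by apply/rowP => k; rewrite mxE ins_rV_lift. Qed.

Lemma ins_rV0 n : @ins_rV n ord0 = @cons_rV R n.
Proof. by []. Qed.

Lemma cons_ins_rV n (i : 'I_n.+1) (s t : R) (y : 'rV[R]_n) :
  cons_rV (s, ins_rV i (t, y)) = ins_rV (lift ord0 i) (t, cons_rV (s, y)).
Proof.
apply/rowP => k; rewrite -!ins_rV0.
case: (unliftP ord0 k) => [j|] ->.
  rewrite ins_rV_lift; case: (unliftP i j) => [l|] ->.
    have -> : lift ord0 (lift i l) = lift (lift ord0 i) (lift ord0 l).
      by apply: val_inj; rewrite /= /bump /= !add1n !ltnS /=; case: leqP.
    by rewrite !ins_rV_lift.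
  by rewrite !ins_rV_i.
have -> : ord0 = lift (lift ord0 i) (ord0 : 'I_n.+1) by apply: val_inj.
rewrite ins_rV_lift.
have -> : lift (lift ord0 i) ord0 = ord0 :> 'I_n.+2 by apply: val_inj.
by rewrite !ins_rV_i.
Qed.

Lemma measurable_ins_rV n (i : 'I_n.+1) :
  measurable_fun [set: measurableTypeR R * 'rV[R]_n] (ins_rV i).
Proof.
apply: measurable_fun_matrix => z k; case: (unliftP i k) => [j ->|->].
- rewrite (_ : (fun _ => _) = (fun M : 'rV[R]_n => M ord0 j) \o snd).
    by apply: measurableT_comp => //; exact: measurable_coord.
  by apply/funext => p; rewrite ord1 ins_rV_lift.
- rewrite (_ : (fun _ => _) = fst) ?measurable_fst//.
  by apply/funext => p; rewrite ord1 ins_rV_i.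
Qed.

Lemma measurable_ins_rV2 n (i : 'I_n.+1) t :
  measurable_fun setT (fun y : 'rV[R]_n => ins_rV i (t, y)).
Proof.
apply: (@measurableT_comp _ _ _ _ _ _ (ins_rV i)); first exact: measurable_ins_rV.
exact: (@pair1_measurable _ _ (measurableTypeR R)).
Qed.

Lemma measurable_ins_rV1 n (i : 'I_n.+1) y :
  measurable_fun [set: measurableTypeR R] (fun t => ins_rV i (t, y)).
Proof.
apply: (@measurableT_comp _ _ _ _ _ _ (ins_rV i)); first exact: measurable_ins_rV.
exact: (@pair2_measurable _ _ (measurableTypeR R)).
Qed.

Local Open Scope ereal_scope.

Lemma ge0_integral_cons_rV n (phi : 'rV[R]_n.+1 -> \bar R) :
  measurable_fun setT phi -> (forall x, 0 <= phi x) ->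
  \int[lebesgue_rV]_x phi x =
  \int[lebesgue_measure]_t \int[lebesgue_rV]_y phi (cons_rV (t, y)).
Proof.
move=> mphi phi0.
rewrite -(@fubini_tonelli1 _ _ (measurableTypeR R) _ _ lebesgue_measure lebesgue_rV
   (phi \o @cons_rV R n)); first last.
- by move=> z; exact: phi0.
- exact: (measurableT_comp mphi (@measurable_cons_rV R n)).
pose P : {measure set (measurableTypeR R * 'rV[R]_n) -> \bar R} :=
  lebesgue_measure \x lebesgue_rV.
by have := @ge0_integral_pushforward _ _ (measurableTypeR R * 'rV[R]_n)%type _ _ _
  (@measurable_cons_rV R n) P setT phi measurableT mphi (fun x _ => phi0 x).
Qed.

Opaque lebesgue_rV.

(** Induction on the dimension: coordinate 0 is integrated outermost, the induction hypothesis
    extracts [t] from the remaining coordinates, Tonelli exchanges the two real integrals, and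
    coordinate 0 is put back. *)
Lemma ge0_integral_ins_rV12 n (i : 'I_n.+1) (phi : 'rV[R]_n.+1 -> \bar R) :
  measurable_fun setT phi -> (forall x, 0 <= phi x) ->
  \int[lebesgue_rV]_x phi x =
  \int[lebesgue_measure]_t \int[lebesgue_rV]_y phi (ins_rV i (t, y)).
Proof.
elim: n i phi => [|n IH] i phi mphi phi0.
  by rewrite (ge0_integral_cons_rV mphi phi0) (ord1 i) ins_rV0.
case: (unliftP ord0 i) => [j|] ->; last first.
  by rewrite (ge0_integral_cons_rV mphi phi0) ins_rV0.
rewrite (ge0_integral_cons_rV mphi phi0).
transitivity (\int[lebesgue_measure]_s \int[lebesgue_measure]_t
   \int[lebesgue_rV]_y phi (ins_rV (lift ord0 j) (t, cons_rV (s, y)))).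
  apply: eq_integral => s _; rewrite (IH j).
  - apply: eq_integral => t _; apply: eq_integral => y _.
    by rewrite cons_ins_rV.
  - by apply: measurableT_comp => //; exact: measurable_ins_rV2.
  - by move=> x; exact: phi0.
have mc : measurable_fun [set: (measurableTypeR R * measurableTypeR R) * 'rV[R]_n]
    (fun z => phi (ins_rV (lift ord0 j) (z.1.2, cons_rV (z.1.1, z.2)))).
  apply: measurableT_comp => //.
  apply: (@measurableT_comp _ _ _ _ _ _ (ins_rV (lift ord0 j))) => //.
    exact: measurable_ins_rV.
  apply: measurable_fun_pair; first exact: measurableT_comp.
  apply: (@measurableT_comp _ _ _ _ _ _ (@cons_rV R n)) => //.
    exact: measurable_cons_rV.
  by apply: measurable_fun_pair => //; exact: measurableT_comp.
have mF := @measurable_fun_fubini_tonelli_F _ _ _ _ _ lebesgue_rV _ mc (fun z => phi0 _).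
have := @fubini_tonelli _ _ _ _ _ lebesgue_measure lebesgue_measure _ mF.
rewrite /fubini_F /= => ->; last by move=> z; apply: integral_ge0 => *; exact: phi0.
apply: eq_integral => t _; apply/esym/ge0_integral_cons_rV => [|x]; last exact: phi0.
by apply: measurableT_comp => //; exact: measurable_ins_rV2.
Qed.

Lemma ge0_integral_ins_rV n (i : 'I_n.+1) (phi : 'rV[R]_n.+1 -> \bar R) :
  measurable_fun setT phi -> (forall x, 0 <= phi x) ->
  \int[lebesgue_rV]_x phi x =
  \int[lebesgue_rV]_y \int[lebesgue_measure]_t phi (ins_rV i (t, y)).
Proof.
move=> mphi phi0; rewrite (ge0_integral_ins_rV12 i mphi phi0).
have mc := measurableT_comp mphi (@measurable_ins_rV n i).
exact: (@fubini_tonelli _ _ _ _ _ lebesgue_measure lebesgue_rV _ mc (fun z => phi0 _)).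
Qed.

Lemma lebesgue_rV_ins n (i : 'I_n.+1) (A : set 'rV[R]_n.+1) : measurable A ->
  lebesgue_rV A = pushforward (lebesgue_measure \x lebesgue_rV) (ins_rV i) A.
Proof.
move=> mA.
have := integral_indic lebesgue_rV measurableT mA; rewrite setIT => <-.
rewrite (ge0_integral_ins_rV12 i); last by move=> x; rewrite lee_fin.
  rewrite /pushforward /product_measure1.
  apply: eq_integral => t _.
  have mt : measurable ((fun y => ins_rV i (t, y)) @^-1` A).
    by rewrite -[_ @^-1` _]setTI; exact: measurable_ins_rV2.
  have H := integral_indic lebesgue_rV measurableT mt; rewrite setIT in H.
  apply: (eq_trans H); congr (lebesgue_rV _).
  by apply/seteqP; split => y /=; rewrite /xsection /= inE.
by apply/measurable_EFinP; exact: measurable_indic.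
Qed.

Lemma lebesgue_rV_slice n (i : 'I_n.+1) (A : set 'rV[R]_n.+1) : measurable A ->
  lebesgue_rV A =
  \int[lebesgue_rV]_y lebesgue_measure ((fun t => ins_rV i (t, y)) @^-1` A).
Proof.
move=> mA.
have := integral_indic lebesgue_rV measurableT mA; rewrite setIT => <-.
rewrite (ge0_integral_ins_rV i); last by move=> x; rewrite lee_fin.
  apply: eq_integral => y _.
  have mt : measurable ((fun t => ins_rV i (t, y)) @^-1` A : set (measurableTypeR R)).
    by rewrite -[_ @^-1` _]setTI; exact: measurable_ins_rV1.
  by have := integral_indic lebesgue_measure measurableT mt; rewrite setIT.
by apply/measurable_EFinP; exact: measurable_indic.
Qed.

Lemma dotv_ins_rV n (i : 'I_n.+1) (a : 'rV[R]_n.+1) t y :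
  dotv a (ins_rV i (t, y)) = (a ord0 i * t + dotv (col' i a) y)%R.
Proof.
rewrite /dotv (bigD1_ord i) //= ins_rV_i; congr (_ + _)%R.
by apply: eq_bigr => j _; rewrite ins_rV_lift !mxE.
Qed.

Lemma measurable_dotv n (a : 'rV[R]_n) : measurable_fun setT (dotv a).
Proof.
rewrite /dotv; apply: measurable_sum => j.
by apply: measurable_funM => //; exact: measurable_coord.
Qed.

Lemma measurable_hyperplane n (a : 'rV[R]_n) (c : R) :
  measurable [set x | dotv a x = c].
Proof.
rewrite (_ : [set x | _] = setT `&` dotv a @^-1` [set c]); last first.
  by rewrite setTI.
by apply: measurable_dotv => //; exact: measurable_set1.
Qed.

(** A line parallel to an axis [i] with [a ord0 i] nonzero meets the hyperplane in a single
    point. *)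
Lemma lebesgue_rV_hyperplane n (a : 'rV[R]_n) (c : R) : a != 0%R ->
  lebesgue_rV [set x | dotv a x = c] = 0.
Proof.
move=> /rV0Pn [i ai]; case: n a i ai => [|n] a i ai; first by case: i ai.
rewrite (lebesgue_rV_slice i (@measurable_hyperplane _ a c)).
apply: integral0_eq => y _.
rewrite (_ : _ @^-1` _ = [set (c - dotv (col' i a) y) / a ord0 i]%R).
  exact: lebesgue_measure_set1.
apply/seteqP; split => t /=; rewrite dotv_ins_rV.
  by move=> <-; rewrite addrK mulrC mulKf.
by move=> ->; rewrite mulrC divfK// subrK.
Qed.

Lemma lebesgue_measure_translate (v : R) (A : set R) : measurable A ->
  lebesgue_measure ((fun t => t + v)%R @^-1` A) = lebesgue_measure A.
Proof.
move=> mA.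
have mv : measurable_fun setT (fun t : measurableTypeR R => t + v : measurableTypeR R)%R.
  by apply: measurable_funD.
apply/esym; have := @lebesgue_measure_unique R (pushforward lebesgue_measure
  (fun t : measurableTypeR R => t + v : measurableTypeR R)%R).
apply=> //= _ [[a b]] _ <-; rewrite /pushforward.
rewrite (_ : _ @^-1` _ = `]a - v, b - v]%classic)%R; last first.
  by apply/seteqP; split => t /=; rewrite !in_itv/= ltrBlDr lerBrDr.
rewrite !lebesgue_measure_itv/= !lte_fin ltrD2r.
by case: ifP => // _; rewrite -!EFinB; congr (_%:E); ring.
Qed.

(** Induction on the dimension: the translation splits into a shift of coordinate 0, under which the
    outer integral is invariant, and a translation of the slices. *)
Lemma lebesgue_rV_translate n (v : 'rV[R]_n) (A : set 'rV[R]_n) : measurable A ->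
  lebesgue_rV ((fun y => y + v)%R @^-1` A) = lebesgue_rV A.
Proof.
elim: n v A => [|n IH] v A mA.
  congr (lebesgue_rV _); apply/seteqP; split => y /=;
  by rewrite (_ : y + v = y)%R//; apply/rowP => -[].
have mv : measurable_fun setT (fun y : 'rV[R]_n.+1 => y + v)%R.
  apply: measurable_fun_matrix => i j.
  rewrite (_ : (fun _ => _) = (fun y : 'rV[R]_n.+1 => y i j + v i j)%R).
    by apply: measurable_funD => //; exact: measurable_coord.
  by apply/funext => y; rewrite mxE.
have mB : measurable ((fun y => y + v)%R @^-1` A).
  by rewrite -[_ @^-1` _]setTI; exact: mv.
have E t y : (ins_rV ord0 (t, y) + v =
    ins_rV ord0 (t + v ord0 ord0, y + col' ord0 v))%R.
  apply/rowP => k; case: (unliftP ord0 k) => [j|] ->; rewrite mxE.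
    by rewrite !ins_rV_lift !mxE.
  by rewrite !ins_rV_i.
rewrite !(lebesgue_rV_ins ord0)// /pushforward /product_measure1 /=.
pose F t := lebesgue_rV (xsection (ins_rV ord0 @^-1` A) t).
have mA' : measurable (ins_rV ord0 @^-1` A : set (measurableTypeR R * 'rV[R]_n)).
  by rewrite -[_ @^-1` _]setTI; exact: measurable_ins_rV.
have mF : measurable_fun [set: measurableTypeR R] F.
  exact: (@measurable_fun_xsection _ _ (measurableTypeR R) _ R lebesgue_rV _ mA').
have mt : measurable_fun setT (fun t : measurableTypeR R => t + v ord0 ord0 : measurableTypeR R)%R.
  by apply: measurable_funD.
transitivity (\int[lebesgue_measure]_t F (t + v ord0 ord0)%R).
  apply: eq_integral => t _; rewrite /F /=.
  rewrite -(IH (col' ord0 v) (xsection (ins_rV ord0 @^-1` A) (t + v ord0 ord0)%R)).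
    by congr (lebesgue_rV _); apply/seteqP; split => y /=; rewrite /xsection /= !inE /= E.
  exact: measurable_xsection.
have := @ge0_integral_pushforward _ _ _ (measurableTypeR R) R _ mt lebesgue_measure setT F
  measurableT mF (fun _ _ => measure_ge0 _ _).
move=> <-.
apply: eq_measure_integral => B mBB _.
exact: lebesgue_measure_translate.
Qed.

End insert_coordinate.

(** * Finite families of hyperplanes and their parametrization as graphs *)

Section hyperplanes.
Context (R : realType).
Implicit Types n : nat.

Lemma ball_rVP n (x y : 'rV[R]_n) e : 0 < e ->
  ball x e y <-> forall j, `|x ord0 j - y ord0 j| < e.
Proof.
move=> e0; split=> [[_ h] j|h]; first exact: h.
by split=> // i j; rewrite ord1; exact: h.
Qed.

Lemma lebesgue_rV_ball_gt0 n (x : 'rV[R]_n) e : 0 < e ->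
  (0 < lebesgue_rV (ball x e))%E.
Proof.
elim: n x => [|n IH] x e0.
  rewrite [lebesgue_rV _](_ : _ = \d_(0 : 'rV[R]_0) (ball x e)) //.
  rewrite diracE mem_set ?lte01//.
  by apply/ball_rVP => // -[].
have mb k (z : 'rV[R]_k) : measurable (ball z e).
  by apply: open_measurable_matrix; exact: ball_open.
rewrite (lebesgue_rV_ins ord0)// /pushforward.
rewrite (_ : _ @^-1` _ = ball (x ord0 ord0) e `*` ball (col' ord0 x) e); last first.
  apply/seteqP; split => -[t y] /=.
    move=> /(ball_rVP _ _ e0) h; split; first by have := h ord0; rewrite ins_rV_i.
    by apply/ball_rVP => // j; have := h (lift ord0 j); rewrite ins_rV_lift mxE.
  move=> [ht /(ball_rVP _ _ e0) hy]; apply/ball_rVP => // j.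
  case: (unliftP ord0 j) => [k|] ->; rewrite ?ins_rV_lift ?ins_rV_i//.
  by have := hy k; rewrite mxE.
have := @product_measure1E _ _ (measurableTypeR R) _ R lebesgue_measure lebesgue_rV
  (ball (x ord0 ord0) e) (ball (col' ord0 x) e) (measurable_ball _ _) (mb _ _).
move=> ->; apply: mule_gt0; last exact: IH.
have H := @lebesgue_measure_ball R (x ord0 ord0) e (ltW e0).
by apply: (@lt_le_trans _ _ (e *+ 2)%:E); rewrite ?lte_fin ?mulrn_wgt0// -H.
Qed.

Definition on_planes n (Hs : seq ('rV[R]_n * R)) : set 'rV[R]_n :=
  [set x | exists2 p, p \in Hs & dotv p.1 x = p.2].

Definition proper_planes n (Hs : seq ('rV[R]_n * R)) :=
  forall p, p \in Hs -> p.1 != 0.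

Lemma on_planesE n (Hs : seq ('rV[R]_n * R)) :
  on_planes Hs = \bigcup_(p in [set` Hs]) [set x | dotv p.1 x = p.2].
Proof. by apply/seteqP; split => x [p Hp px]; exists p. Qed.

Lemma measurable_on_planes n (Hs : seq ('rV[R]_n * R)) : measurable (on_planes Hs).
Proof.
rewrite on_planesE; apply: fin_bigcup_measurable => // p _.
exact: measurable_hyperplane.
Qed.

Lemma on_planes_null n (Hs : seq ('rV[R]_n * R)) : proper_planes Hs ->
  lebesgue_rV (on_planes Hs) = 0%E.
Proof.
elim: Hs => [|p Hs IH] pH.
  rewrite (_ : on_planes _ = set0) ?measure0//.
  by apply/seteqP; split => // x [].
have -> : on_planes (p :: Hs) = [set x | dotv p.1 x = p.2] `|` on_planes Hs.
  apply/seteqP; split => x.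
    by case=> q; rewrite in_cons => /orP[/eqP -> ?|qH qx]; [left|right; exists q].
  case=> [px|[q qH qx]]; first by exists p => //; rewrite mem_head.
  by exists q => //; rewrite in_cons qH orbT.
apply: null_set_setU.
- exact: measurable_hyperplane.
- exact: measurable_on_planes.
- by apply: lebesgue_rV_hyperplane; apply: pH; rewrite mem_head.
- by apply: IH => q qH; apply: pH; rewrite in_cons qH orbT.
Qed.

(** Balls have positive measure and finitely many proper hyperplanes have none. This is how points
    in general position are found. *)
Lemma ball_off_planes n (Hs : seq ('rV[R]_n * R)) x e : proper_planes Hs -> 0 < e ->
  exists2 y, ball x e y & ~ on_planes Hs y.
Proof.
move=> pH e0; apply: contrapT => h.
have : (lebesgue_rV (ball x e) <= lebesgue_rV (on_planes Hs))%E.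
  apply: le_measure; rewrite ?inE.
  - by apply: open_measurable_matrix; exact: ball_open.
  - exact: measurable_on_planes.
  - by move=> y xy; apply: contrapT => Hy; apply: h; exists y.
rewrite on_planes_null// leNgt; apply/negP; rewrite negbK.
exact: lebesgue_rV_ball_gt0.
Qed.

Lemma hyperplane_graphE n (p : 'rV[R]_n.+1 * R) i (y : 'rV[R]_n) :
  hyperplane_graph p i y =
  ins_rV i ((p.2 - dotv (col' i p.1) y) / p.1 ord0 i, y).
Proof.
apply/rowP => k; case: (unliftP i k) => [j|] ->.
  by rewrite ins_rV_lift mxE liftK.
rewrite ins_rV_i mxE unlift_none; congr ((_ - _) / _).
by apply: eq_bigr => j _; rewrite mxE.
Qed.

Lemma dotv_hyperplane_graph n (p : 'rV[R]_n.+1 * R) i y : p.1 ord0 i != 0 ->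
  dotv p.1 (hyperplane_graph p i y) = p.2.
Proof.
by move=> pi; rewrite hyperplane_graphE dotv_ins_rV/= mulrC divfK// subrK.
Qed.

Lemma col'_hyperplane_graph n (p : 'rV[R]_n.+1 * R) i y :
  col' i (hyperplane_graph p i y) = y.
Proof. by rewrite hyperplane_graphE col'_ins_rV. Qed.

Lemma ins_rV_hyperplane n (p : 'rV[R]_n.+1 * R) i t y : p.1 ord0 i != 0 ->
  dotv p.1 (ins_rV i (t, y)) = p.2 -> ins_rV i (t, y) = hyperplane_graph p i y.
Proof.
move=> pi; rewrite dotv_ins_rV hyperplane_graphE => <- /=.
by rewrite addrK mulrC mulKf.
Qed.

Lemma hyperplane_graph_col' n (p : 'rV[R]_n.+1 * R) i x : p.1 ord0 i != 0 ->
  dotv p.1 x = p.2 -> hyperplane_graph p i (col' i x) = x.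
Proof.
move=> pi px; rewrite -[RHS](ins_rV_col' i) (@ins_rV_hyperplane _ p)//.
by rewrite ins_rV_col'.
Qed.

Lemma dotvDr n (a x y : 'rV[R]_n) : dotv a (x + y) = dotv a x + dotv a y.
Proof. by rewrite /dotv -big_split; apply: eq_bigr => j _; rewrite mxE mulrDr. Qed.

Lemma dotvZr n (a x : 'rV[R]_n) c : dotv a (c *: x) = c * dotv a x.
Proof. by rewrite /dotv mulr_sumr; apply: eq_bigr => j _; rewrite mxE mulrCA. Qed.

Lemma dotvC n (a x : 'rV[R]_n) : dotv a x = dotv x a.
Proof. by apply: eq_bigr => j _; rewrite mulrC. Qed.

Lemma dotvZl n (a x : 'rV[R]_n) c : dotv (c *: a) x = c * dotv a x.
Proof. by rewrite dotvC dotvZr dotvC. Qed.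

Lemma dotv_delta n (a : 'rV[R]_n) i : dotv a (delta_mx ord0 i) = a ord0 i.
Proof.
rewrite /dotv (bigD1 i)//= big1 ?addr0; first by rewrite mxE !eqxx mulr1.
by move=> j /negPf ji; rewrite mxE ji andbF mulr0.
Qed.

Lemma lebesgue_measure_affine (a b : R) (A : set R) : a != 0 -> measurable A ->
  lebesgue_measure ((fun t => a * t + b) @^-1` A) =
  ((`|a|^-1)%:E * lebesgue_measure A)%E.
Proof.
move=> a0 mA.
pose f (t : measurableTypeR R) : measurableTypeR R := a * t + b.
have mf : measurable_fun setT f.
  by apply: measurable_funD => //; exact: measurable_funM.
pose m' : {measure set (measurableTypeR R) -> \bar R} := pushforward lebesgue_measure f.
pose m := m' mf.
have an0 : `|a| != 0 by rewrite normr_eq0.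
pose k : {nonneg R} := NngNum (normr_ge0 a).
suff H : lebesgue_measure A = mscale k m A.
  rewrite [in RHS]H /mscale /= muleA -EFinM mulVf// mul1e.
  by [].
refine (@lebesgue_measure_unique R (mscale k m) _ A mA) => //= _ [[x y]] _ <-.
transitivity (`|a|%:E * lebesgue_measure (f @^-1` `]x, y]))%E; last by [].
have [a_lt0|a_gt0|] := ltgtP a 0; last by move/eqP; rewrite (negPf a0).
  rewrite (_ : f @^-1` _ = `[(y - b) / a, (x - b) / a[%classic).
    rewrite !lebesgue_measure_itv/= !lte_fin ltr_nM2r ?invr_lt0// ltrD2r.
    case: ifPn => xy; last by rewrite mule0.
    by rewrite -!EFinB -EFinM ltr0_norm//; congr (_%:E); field.
  apply/seteqP; split => t /=; rewrite !in_itv/= /f => /andP[h1 h2]; apply/andP.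
    by rewrite ler_ndivrMr// ltr_ndivlMr//; split; rewrite mulrC; lra.
  by move: h1 h2; rewrite ler_ndivrMr// ltr_ndivlMr// mulrC => h1 h2; split; lra.
rewrite (_ : f @^-1` _ = `](x - b) / a, (y - b) / a]%classic).
  rewrite !lebesgue_measure_itv/= !lte_fin ltr_pM2r ?invr_gt0// ltrD2r.
  case: ifPn => xy; last by rewrite mule0.
  by rewrite -!EFinB -EFinM gtr0_norm//; congr (_%:E); field.
apply/seteqP; split => t /=; rewrite !in_itv/= /f => /andP[h1 h2]; apply/andP.
  by rewrite ltr_pdivrMr// ler_pdivlMr//; split; rewrite mulrC; lra.
by move: h1 h2; rewrite ltr_pdivrMr// ler_pdivlMr// mulrC => h1 h2; split; lra.
Qed.

End hyperplanes.

(** * Surface measure of hyperplanes *)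

Section hyperplane_measure_index.
Context (R : realType) (n : nat).
Implicit Types (p : 'rV[R]_n.+1 * R) (A : set 'rV[R]_n.+1).

Lemma measurable_graph p i : measurable_fun setT (hyperplane_graph p i : 'rV[R]_n -> _).
Proof. exact: (@measurable_hyperplane_graph R n.+1 p i). Qed.

Lemma measurable_col' (i : 'I_n.+1) :
  measurable_fun setT (col' i : 'rV[R]_n.+1 -> 'rV[R]_n).
Proof.
apply: measurable_fun_matrix => k j.
rewrite (_ : (fun _ => _) = (fun x : 'rV[R]_n.+1 => x k (lift i j))).
  exact: measurable_coord.
by apply/funext => x; rewrite mxE.
Qed.

(** Projection onto the hyperplane of [p] parallel to the [j]-th axis. *)
Definition project p j (x : 'rV[R]_n.+1) : 'rV[R]_n.+1 :=
  hyperplane_graph p j (col' j x).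

(** In the coordinates other than [i], sliding along the [j]-th axis from level [p.2 + c] to level
    [p.2] is a translation whose vector depends on [c] only. Hence the slices parallel to the
    hyperplane in [lebesgue_graph_index] all have the same measure. *)
Lemma project_graph p i j c (y : 'rV[R]_n) : p.1 ord0 i != 0 -> p.1 ord0 j != 0 ->
  project p j (hyperplane_graph (p.1, p.2 + c) i y) =
  hyperplane_graph p i (y + (- (c / p.1 ord0 j)) *: col' i (delta_mx ord0 j)).
Proof.
move=> pi pj; set e : 'rV[R]_n.+1 := delta_mx ord0 j.
set x := hyperplane_graph _ _ _; set s := - (c / p.1 ord0 j).
have xE : dotv p.1 x = p.2 + c by rewrite (@dotv_hyperplane_graph _ _ (p.1, p.2 + c)).
have zE : dotv p.1 (x + s *: e) = p.2.
  by rewrite dotvDr dotvZr xE dotv_delta /s mulNr divfK// addrK.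
have <- : col' i (x + s *: e) = y + s *: col' i e.
  rewrite raddfD /= /x col'_hyperplane_graph; congr (_ + _).
  by apply/rowP => k; rewrite !mxE.
rewrite hyperplane_graph_col'// /project.
have -> : col' j x = col' j (x + s *: e).
  apply/rowP => k; rewrite !mxE eqxx /= -[lift _ _ == _]negbK eq_sym.
  by rewrite neq_lift mulr0 addr0.
by rewrite hyperplane_graph_col'.
Qed.

Local Open Scope ereal_scope.

Lemma lebesgue_graph_index p i j A :
  p.1 ord0 i != 0%R -> p.1 ord0 j != 0%R -> measurable A ->
  (`|p.1 ord0 i|^-1)%:E * lebesgue_rV (hyperplane_graph p i @^-1` A : set 'rV[R]_n) =
  (`|p.1 ord0 j|^-1)%:E * lebesgue_rV (hyperplane_graph p j @^-1` A : set 'rV[R]_n).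
Proof.
move=> pi pj mA.
(* the volume of the part of the layer 0 < p.1 . x - p.2 < 1 that lies over A
   in the direction of the j-th axis *)
pose E := [set x | A (project p j x)] `&` [set x | 0 < dotv p.1 x - p.2 < 1]%R.
have mproj : measurable_fun setT (project p j).
  by apply: (measurableT_comp (@measurable_graph p j)); exact: measurable_col'.
have mE : measurable E.
  apply: measurableI; first by rewrite -[X in measurable X]setTI; exact: mproj.
  rewrite (_ : [set x | _] = setT `&` (fun x => dotv p.1 x - p.2)%R @^-1` `]0, 1[%classic%R).
    have mf : measurable_fun setT (fun x => dotv p.1 x - p.2)%R.
      by apply: measurable_funB => //; exact: measurable_dotv.
    exact: mf measurableT _ (measurable_itv _).
  by rewrite setTI; apply/seteqP; split => x /=; rewrite in_itv.
have m01 : lebesgue_measure `]0, 1[%classic%R = 1 :> \bar R.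
  by rewrite lebesgue_measure_itv/= lte_fin ltr01 oppr0 adde0.
have aff (k : 'I_n.+1) t y : (dotv p.1 (ins_rV k (t, y)) - p.2 =
    p.1 ord0 k * t + (dotv (col' k p.1) y - p.2))%R.
  by rewrite dotv_ins_rV addrA.
have mgraph k : measurable (hyperplane_graph p k @^-1` A : set 'rV[R]_n).
  by rewrite -[X in measurable X]setTI; exact: measurable_graph.
(* Along the [j]-th axis [E] consists of segments of length [1/|p_j|], one over each point whose
   lift to the hyperplane is in [A]. *)
transitivity (lebesgue_rV E); last first.
  rewrite (lebesgue_rV_slice j mE).
  transitivity (\int[lebesgue_rV]_y ((`|p.1 ord0 j|^-1)%:E *
      (\1_(hyperplane_graph p j @^-1` A : set 'rV[R]_n) y)%:E)).
    apply: eq_integral => y _.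
    have [Ay|Ay] := pselect (A (hyperplane_graph p j y)).
      rewrite indicE mem_set// mule1 -[RHS]mule1 -m01.
      rewrite -(lebesgue_measure_affine (dotv (col' j p.1) y - p.2))//.
      congr (lebesgue_measure _); apply/seteqP; split => t.
        by rewrite /E /= in_itv/= -aff => -[].
      by rewrite /E /= in_itv/= -aff /project col'_ins_rV.
    rewrite indicE memNset// mule0.
    rewrite (_ : _ @^-1` _ = set0) ?measure0//; apply/seteqP; split => // t.
    by rewrite /E /= /project col'_ins_rV/= => -[].
  rewrite ge0_integralZl//; last first.
    by apply/measurable_EFinP; exact: measurable_indic.
  have := integral_indic lebesgue_rV measurableT (mgraph j); rewrite setIT.
  by move=> ->.
(* Along the [i]-th axis the level [s] of [p.1 . x - p.2] becomes the variable, at the cost of a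
   factor [1/|p_i|]. The set [F] is [E] in the coordinates [(s, y)], and by [project_graph] its
   slices at fixed [s] are translates of the preimage of [A]. *)
rewrite (lebesgue_rV_slice i mE).
pose q (s : R) := (p.1, (p.2 + s)%R).
pose F : set (measurableTypeR R * 'rV[R]_n) :=
  [set z | 0 < z.1 < 1]%R `&`
  [set z | A (project p j (hyperplane_graph (q z.1) i z.2))].
have qE (s : R) (y : 'rV[R]_n) : hyperplane_graph (q s) i y =
    ins_rV i ((p.2 + s - dotv (col' i p.1) y) / p.1 ord0 i, y)%R.
  by rewrite hyperplane_graphE.
have mF : measurable F.
  apply: measurableI.
    rewrite (_ : [set _ | _] = setT `&` fst @^-1` `]0, 1[%classic%R).
      exact: (@measurable_fst _ _ (measurableTypeR R)) measurableT _ (measurable_itv _).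
    by rewrite setTI; apply/seteqP; split => x /=; rewrite in_itv.
  rewrite (_ : [set z | _] = setT `&` (fun z : measurableTypeR R * 'rV[R]_n =>
    project p j (ins_rV i ((p.2 + z.1 - dotv (col' i p.1) z.2) / p.1 ord0 i, z.2)%R)) @^-1` A).
    apply: (measurableT_comp mproj) => //.
    apply: (measurableT_comp (measurable_ins_rV i)) => //.
    apply: measurable_fun_pair => //; apply: measurable_funM => //.
    apply: measurable_funB; first exact: measurable_funD.
    by apply: (measurableT_comp (@measurable_dotv R n (col' i p.1))).
  by rewrite setTI; apply/seteqP; split => z /=; rewrite qE.
have -> : lebesgue_rV (hyperplane_graph p i @^-1` A : set 'rV[R]_n) =
    (lebesgue_measure \x lebesgue_rV) F.
  rewrite /product_measure1.
  transitivity (\int[lebesgue_measure]_s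
     (lebesgue_rV (hyperplane_graph p i @^-1` A : set 'rV[R]_n) *
      (\1_(`]0, 1[%classic%R) s)%:E)).
    rewrite ge0_integralZl//; last first.
      by apply/measurable_EFinP; exact: measurable_indic.
    have := integral_indic lebesgue_measure measurableT
      (measurable_itv `]0%R, 1%R[ : measurable (_ : set (measurableTypeR R))).
    rewrite setIT => H; rewrite H -[LHS]mule1; congr (_ * _).
    exact: (esym m01).
  apply: eq_integral => s _ /=.
  have [s01|s01] := boolP (0 < s < 1)%R; last first.
    rewrite indicE memNset ?mule0; last by rewrite /= in_itv/=; exact/negP.
    rewrite (_ : xsection _ _ = set0) ?measure0//; apply/seteqP; split => // y.
    by rewrite /xsection/= inE /F /= => -[]; rewrite (negPf s01).
  rewrite indicE mem_set ?mule1; last by rewrite /= in_itv.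
  rewrite -(lebesgue_rV_translate (- (s / p.1 ord0 j) *: col' i (delta_mx ord0 j))%R)//.
  congr (lebesgue_rV _); apply/seteqP; split => y; rewrite /xsection /= inE /F /= project_graph//.
  by case.
pose Fy y : set R := [set s | (0 < s < 1)%R /\ A (project p j (hyperplane_graph (q s) i y))].
have mFy y : measurable (Fy y).
  have := @measurable_ysection _ _ (measurableTypeR R) _ F y mF.
  by rewrite /ysection /=; congr (measurable _); apply/seteqP; split => s /=; rewrite inE.
transitivity (\int[lebesgue_rV]_y ((`|p.1 ord0 i|^-1)%:E * lebesgue_measure (Fy y))).
  rewrite ge0_integralZl//; last first.
    have := @measurable_fun_ysection _ _ (measurableTypeR R) _ R lebesgue_measure _ mF.
    congr (measurable_fun _ _); apply/funext => y /=; congr (lebesgue_measure _).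
    by rewrite /ysection /=; apply/seteqP; split => s /=; rewrite inE.
  congr (_ * _).
  transitivity ((lebesgue_measure \x^ lebesgue_rV) F).
    by apply: product_measure_unique => //; exact: product_measure2E.
  apply: eq_integral => y _ /=; congr (lebesgue_measure _).
  by rewrite /ysection /=; apply/seteqP; split => s /=; rewrite inE.
apply: eq_integral => y _.
rewrite -(lebesgue_measure_affine (dotv (col' i p.1) y - p.2))//.
have tE t : ((p.2 + (dotv p.1 (ins_rV i (t, y)) - p.2) - dotv (col' i p.1) y) /
    p.1 ord0 i = t)%R.
  by rewrite [X in (X - _)%R]addrC subrK dotv_ins_rV addrK mulrC mulKf.
congr (lebesgue_measure _); apply/seteqP; split => t; rewrite /E /Fy /= -aff qE tE.
  by case.
by case.
Qed.

(** [hyperplane_measure] picks one nonzero component of the normal, while Fubini along the [i]-th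
    axis produces the graph over precisely that axis. *)
Lemma hyperplane_measureE p i A : p.1 ord0 i != 0%R -> measurable A ->
  hyperplane_measure p A =
  (`|p.1 ord0 i|^-1)%:E * lebesgue_rV (hyperplane_graph p i @^-1` A : set 'rV[R]_n).
Proof.
move=> pi mA; rewrite /hyperplane_measure; case: pickP => [j pj|/(_ i)].
  exact: lebesgue_graph_index.
by rewrite pi.
Qed.

End hyperplane_measure_index.

(** * Integrals modulo null sets, and bounded measurable functions *)

Section null_set_insensitive.
Context d (T : measurableType d) (R : realType) (mu : {measure set T -> \bar R}).
Local Open Scope ereal_scope.
Import HBNNSimple.

(** A simple function below [f] comes below [g] once it is set to 0 on [N], and this does not change
    its integral. *)
Let sub_sintegral (N : set T) (f g : T -> \bar R) :
  measurable N -> mu N = 0 -> (forall x, 0 <= g x) ->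
  (forall x, ~ N x -> f x = g x) ->
  [set sintegral mu h | h in [set h : {nnsfun T >-> R} | forall x, (h x)%:E <= f x]] `<=`
  [set sintegral mu h | h in [set h : {nnsfun T >-> R} | forall x, (h x)%:E <= g x]].
Proof.
move=> mN N0 g0 fg _ [h /= hf <-].
have mNC := measurableC mN.
exists (proj_nnsfun h mNC).
  move=> x /=; rewrite mindicE; case: (boolP (x \in ~` N)) => xN.
    by rewrite mulr1 -fg//; exact/set_mem.
  by rewrite mulr0.
rewrite -!integralT_nnsfun; apply: ge0_ae_eq_integral => //.
- exact/measurable_EFinP.
- exact/measurable_EFinP.
- by move=> x _; rewrite lee_fin.
- by move=> x _; rewrite lee_fin.
exists N; split => // x /= hx; apply: contrapT => Nx; apply: hx => _.
by rewrite mindicE mem_set ?mulr1.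
Qed.

(* No measurability is assumed: the pointwise derivative of a piecewise
   polynomial is only controlled off the interfaces. *)
Lemma eq_integral_off_null (D N : set T) (f g : T -> \bar R) :
  measurable N -> mu N = 0 -> (forall x, D x -> ~ N x -> f x = g x) ->
  \int[mu]_(x in D) f x = \int[mu]_(x in D) g x.
Proof.
move=> mN N0 fg; rewrite /integral.
have fgD x : ~ N x -> (f \_ D) x = (g \_ D) x.
  by move=> Nx; rewrite !patchE; case: ifPn => // /set_mem Dx; exact: fg.
congr (ereal_sup _ - ereal_sup _); rewrite eqEsubset; split;
  by apply: (sub_sintegral mN N0) => x // Nx; rewrite !(funeposE, funenegE) fgD.
Qed.

End null_set_insensitive.

Lemma eq_Rintegral_off_null d (T : measurableType d) (R : realType)
    (mu : {measure set T -> \bar R}) (D N : set T) (f g : T -> R) :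
  measurable N -> mu N = 0%E -> (forall x, D x -> ~ N x -> f x = g x) ->
  \int[mu]_(x in D) f x = \int[mu]_(x in D) g x.
Proof.
move=> mN N0 fg; congr fine; apply: (eq_integral_off_null mN N0) => x Dx Nx.
by rewrite fg.
Qed.

Section bounded_measurable.
Context d (T : measurableType d) (R : realType).
Implicit Types (f g : T -> R) (D : set T).

(** All discrete functions belong to this class. It is closed under sums and products and consists
    of integrable functions on sets of finite measure, which settles the integrability conditions
    uniformly. *)
Definition bounded_measurable f :=
  measurable_fun setT f /\ exists M, forall x, `|f x| <= M.

Local Notation bm := bounded_measurable.

Lemma bm_cst c : bm (fun=> c).
Proof. by split; [exact: measurable_cst|exists `|c|]. Qed.

Lemma bmD f g : bm f -> bm g -> bm (fun x => f x + g x).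
Proof.
move=> [mf [M fM]] [mg [M' gM]]; split; first exact: measurable_funD.
by exists (M + M') => x; rewrite (le_trans (ler_normD _ _))// lerD.
Qed.

Lemma bmM f g : bm f -> bm g -> bm (fun x => f x * g x).
Proof.
move=> [mf [M fM]] [mg [M' gM]]; split; first exact: measurable_funM.
by exists (M * M') => x; rewrite normrM ler_pM.
Qed.

Lemma bmZ c f : bm f -> bm (fun x => c * f x).
Proof. by move=> ?; apply: bmM => //; exact: bm_cst. Qed.

Lemma bmN f : bm f -> bm (fun x => - f x).
Proof. by move=> /(bmZ (-1)); congr bm; apply/funext => x; rewrite mulN1r. Qed.

Lemma bmB f g : bm f -> bm g -> bm (fun x => f x - g x).
Proof. by move=> bf bg; apply: bmD => //; exact: bmN. Qed.

Lemma bm_norm f : bm f -> bm (fun x => `|f x|).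
Proof.
move=> [mf [M fM]]; split; first exact: measurableT_comp.
by exists M => x; rewrite normr_id.
Qed.

Lemma bm_sum I (s : seq I) (P : pred I) (F : I -> T -> R) : (forall i, bm (F i)) ->
  bm (fun x => \sum_(i <- s | P i) F i x).
Proof.
move=> bF; elim: s => [|i s IH].
  by under eq_fun do rewrite big_nil; exact: bm_cst.
under eq_fun do rewrite big_cons; case: (P i) => //.
exact: bmD.
Qed.

Lemma bm_indic D : measurable D -> bm (\1_D : T -> R).
Proof.
move=> mD; split; first exact: measurable_indic.
by exists 1 => x; rewrite indicE; case: (_ \in _); rewrite ?normr1 ?normr0.
Qed.

Variables (mu : {measure set T -> \bar R}) (D : set T).
Hypotheses (mD : measurable D) (finD : (mu D < +oo)%E).

Lemma bm_integrable f : bm f -> mu.-integrable D (EFin \o f).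
Proof.
move=> [mf [M fM]]; apply: measurable_bounded_integrable => //.
  exact: measurable_funTS.
exists M; split; first exact: num_real.
by move=> x Mx y _; apply: le_trans (ltW Mx); exact: fM.
Qed.

Lemma bm_RintegralD f g : bm f -> bm g ->
  \int[mu]_(x in D) (f x + g x) = \int[mu]_(x in D) f x + \int[mu]_(x in D) g x.
Proof. by move=> bf bg; apply: RintegralD => //; exact: bm_integrable. Qed.

Lemma bm_RintegralZ c f : bm f ->
  \int[mu]_(x in D) (c * f x) = c * \int[mu]_(x in D) f x.
Proof. by move=> bf; apply: RintegralZl => //; exact: bm_integrable. Qed.

Lemma bm_RintegralB f g : bm f -> bm g ->
  \int[mu]_(x in D) (f x - g x) = \int[mu]_(x in D) f x - \int[mu]_(x in D) g x.
Proof. by move=> bf bg; apply: RintegralB => //; exact: bm_integrable. Qed.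

Lemma bm_Rintegral_sum I (s : seq I) (F : I -> T -> R) : (forall i, bm (F i)) ->
  \int[mu]_(x in D) (\sum_(i <- s) F i x) = \sum_(i <- s) \int[mu]_(x in D) F i x.
Proof.
move=> bF; elim: s => [|i s IH].
  under eq_Rintegral do rewrite big_nil.
  by rewrite Rintegral_cst// mul0r big_nil.
under eq_Rintegral do rewrite big_cons.
by rewrite big_cons -IH bm_RintegralD//; exact: bm_sum.
Qed.

Lemma bm_le_Rintegral f g : bm f -> bm g -> (forall x, D x -> f x <= g x) ->
  \int[mu]_(x in D) f x <= \int[mu]_(x in D) g x.
Proof. by move=> bf bg fg; apply: le_Rintegral => //; exact: bm_integrable. Qed.

End bounded_measurable.

Lemma bm_comp d d' (T : measurableType d) (T' : measurableType d') (R : realType)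
    (h : T' -> T) (f : T -> R) :
  measurable_fun setT h -> bounded_measurable f -> bounded_measurable (f \o h).
Proof.
move=> mh [mf [M fM]]; split; first exact: measurableT_comp.
by exists M => x; exact: fM.
Qed.

Lemma bounded_set_box (R : realType) n (A : set 'rV[R]_n) : bounded_set A ->
  exists k, A `<=` @rV_box R n k.
Proof.
move=> [M [Mr AM]]; have : M < `|M| + 1 by rewrite ltr_pwDr// ler_norm.
move=> /AM bA; exists (Num.truncn (`|M| + 1)).+1 => x Ax j.
apply: le_trans (ltW (truncnS_gt _)); apply: le_trans (bA _ Ax).
rewrite [leRHS]/Num.Def.normr/= mx_normrE.
by apply: (le_bigmax _ (fun ij => `|x ij.1 ij.2|%R) (ord0, j)).
Qed.

Lemma bounded_lebesgue_rV_lty (R : realType) n (A : set 'rV[R]_n) :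
  measurable A -> bounded_set A -> (lebesgue_rV A < +oo)%E.
Proof.
move=> mA /bounded_set_box[k Ak].
have [_ _ _ /(_ k)] := lebesgue_rV_subproof R n; apply: le_lt_trans.
by apply: le_measure => //; rewrite inE//; exact: measurable_rV_box.
Qed.

(** * Boundaries of polyhedral domains *)

Section polyhedral_geometry.
Context (R : realType).

Lemma continuous_line n (x v : 'rV[R]_n) : continuous (fun t : R => x + t *: v).
Proof.
move=> t; apply: cvgD; first exact: cvg_cst.
by apply: cvgZr_tmp; exact: cvg_id.
Qed.

(** In [I] the points of the line in [Om] form a set that is open and, since no boundary point
    occurs, also the trace of the closed set [closure Om]. Connectedness of [I] concludes. *)
Lemma line_no_boundary n (Om : set 'rV[R]_n) x v (I : set R) :
  open Om -> is_interval I -> (forall t, I t -> ~ boundary Om (x + t *: v)) ->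
  forall s t, I s -> I t -> Om (x + s *: v) -> Om (x + t *: v).
Proof.
move=> oOm /connected_intervalP cI bI s t Is It Os.
pose f (t : R) := x + t *: v.
have cf : continuous f by exact: continuous_line.
suff H : I `&` f @^-1` Om = I by have : I t := It; rewrite -{1}H => -[].
apply: cI; first by exists s.
- by exists (f @^-1` Om) => //; apply: open_comp => // z _; exact: cf.
- exists (f @^-1` (closure Om)).
    by apply: closed_comp => [z _|]; [exact: cf|exact: closed_closure].
  apply/seteqP; split => z [Iz Oz]; split => //; first exact: subset_closure.
  apply: contrapT => nOz; apply: (bI _ Iz); split=> //.
  by rewrite (iffLR (interior_id _) oOm).
Qed.

Lemma dotvBr n (a x y : 'rV[R]_n) : dotv a (x - y) = dotv a x - dotv a y.
Proof. by rewrite -scaleN1r dotvDr dotvZr mulN1r. Qed.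

Lemma dotv_gt0 n (a : 'rV[R]_n) : a != 0 -> 0 < dotv a a.
Proof.
move=> /rV0Pn[i ai]; rewrite /dotv (bigD1 i)//= ltr_pwDl//.
  by rewrite -expr2 exprn_even_gt0.
by apply: sumr_ge0 => j _; rewrite -expr2 sqr_ge0.
Qed.

Lemma ball_line n (x v : 'rV[R]_n) e : 0 < e ->
  exists2 r, 0 < r & forall t, `|t| < r -> ball x e (x + t *: v).
Proof.
move=> e0; have := @continuous_line n x v 0; rewrite /continuous_at scale0r addr0.
move=> /(_ (ball x e)) /(_ (nbhsx_ballx _ _ e0)) /nbhs_ballP[r /= r0 h].
by exists r => // t tr; apply: h; rewrite /ball/= sub0r normrN.
Qed.

(** Hyperplanes that miss [x] stay away from a neighbourhood of [x], and those through [x] are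
    parallel to [p], hence equal to it. *)
Lemma local_planes n (Hs : seq ('rV[R]_n * R)) x p : proper_planes Hs ->
  dotv p.1 x = p.2 ->
  (forall q, q \in Hs -> dotv q.1 x = q.2 -> exists c, q.1 = c *: p.1) ->
  exists2 e, 0 < e & forall y, ball x e y -> on_planes Hs y -> dotv p.1 y = p.2.
Proof.
move=> pH px; elim: Hs pH => [|q Hs IH] pH par.
  by exists 1 => // y _ [].
have [||e e0 he] := IH.
- by move=> z zH; apply: pH; rewrite in_cons zH orbT.
- by move=> z zH; apply: par; rewrite in_cons zH orbT.
have [e' e'0 he'] : exists2 e', 0 < e' &
    forall y, ball x e' y -> dotv q.1 y = q.2 -> dotv p.1 y = p.2.
  have [qx|qx] := eqVneq (dotv q.1 x) q.2.
    have [|c qc] := par q _ qx; first by rewrite mem_head.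
    exists 1 => // y _; rewrite -qx qc !dotvZl px => /mulfI; apply.
    apply: contra_neq (pH _ (mem_head _ _)) => c0.
    by rewrite qc c0 scale0r.
  have q0 : 0 < `|dotv q.1 x - q.2| by rewrite normr_gt0 subr_eq0.
  have := @continuous_dotv R n q.1 x.
  move=> /cvgrPdist_lt /(_ _ q0) /nbhs_ballP[r /= r0 h].
  exists r => // y /h /=; rewrite distrC => + qy; rewrite qy distrC.
  by rewrite ltxx.
exists (Num.min e e'); first by rewrite lt_min e0.
move=> y xy [z]; rewrite in_cons => /orP[/eqP ->|zH] zy.
  by apply: he' => //; apply: le_ball xy; rewrite ge_min lexx orbT.
apply: he; last by exists z.
by apply: le_ball xy; rewrite ge_min lexx.
Qed.

Definition parallel n (a b : 'rV[R]_n) := exists c : R, b = c *: a.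

Lemma ball_convex n (x y z : 'rV[R]_n) e t : 0 < e -> ball x e y -> ball x e z ->
  0 <= t <= 1 -> ball x e (y + t *: (z - y)).
Proof.
move=> e0 /(ball_rVP _ _ e0) hy /(ball_rVP _ _ e0) hz /andP[t0 t1].
apply/ball_rVP => // j; rewrite !mxE.
have {hy} := hy j; have {hz} := hz j.
rewrite !ltr_distl => /andP[h1 h2] /andP[h3 h4].
set a := x ord0 j in h1 h2 h3 h4 *; set b := y ord0 j in h3 h4 *.
set c := z ord0 j in h1 h2 *.
have -> : b + t * (c - b) = (1 - t) * b + t * c by ring.
have [->|tn0] := eqVneq t 0; first by rewrite subr0 mul1r mul0r addr0 h3 h4.
have tp : 0 < t by rewrite lt_neqAle eq_sym tn0.
have H1 : t * (c - e) < t * a by rewrite ltr_pM2l.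
have H2 : t * a < t * (c + e) by rewrite ltr_pM2l.
have H3 : (1 - t) * (b - e) <= (1 - t) * a by rewrite ler_wpM2l ?subr_ge0// ltW.
have H4 : (1 - t) * a <= (1 - t) * (b + e) by rewrite ler_wpM2l ?subr_ge0// ltW.
apply/andP; split; nra.
Qed.

(** The hyperplanes of [Hs] merely contain the boundary, so the domain might a priori lie on both
    sides of [p], as along a slit. Each open half of a small ball is entirely inside or entirely
    outside [Om]. One half is inside because [x] is a limit of points of [Om]; the Lipschitz chart
    provides a point outside, so the other half is outside. *)
Lemma local_half_space n (Om : set 'rV[R]_n) Hs x p :
  open Om -> lipschitz_boundary Om -> proper_planes Hs ->
  boundary Om `<=` on_planes Hs -> boundary Om x ->
  p \in Hs -> dotv p.1 x = p.2 ->
  (forall q, q \in Hs -> dotv q.1 x = q.2 -> parallel p.1 q.1) ->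
  exists c, is_outward_normal Om x (c *: p.1).
Proof.
move=> oOm lip pH bH bx pHs px par.
have [e1 e10 he1] := local_planes pH px par.
have [Q [i [phi [e2 [e20 Qt lphi chart]]]]] := lip _ bx.
pose e := Num.min e1 e2.
have e0 : 0 < e by rewrite lt_min e10.
have bnd y : ball x e y -> boundary Om y -> dotv p.1 y = p.2.
  move=> xy by_; apply: he1; last exact: bH.
  by apply: le_ball xy; rewrite ge_min lexx.
have Oml y : ball x e y -> (Om y <-> (y *m Q) ord0 i < phi (col' i (y *m Q))).
  by move=> xy; apply: chart; apply: le_ball xy; rewrite ge_min lexx orbT.
have p0 := pH _ pHs; have pp0 := dotv_gt0 p0.
have nOmx : ~ Om x.
  by case: bx => _; rewrite (iffLR (interior_id _) oOm).
(* The segment from [y] to [z] stays strictly on one side of [p], where the ball contains no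
   boundary point; the sign [s] selects the side. *)
have half s y z : ball x e y -> ball x e z ->
    0 < s * (dotv p.1 y - p.2) -> 0 < s * (dotv p.1 z - p.2) -> Om y -> Om z.
  move=> xy xz sy sz Oy.
  have := @line_no_boundary _ Om y (z - y) [set t | 0 <= t <= 1] oOm _ _ 0 1.
  rewrite scale0r addr0 scale1r [y + (z - y)]addrC subrK; apply => //=.
  - move=> u v /= /andP[u0 u1] /andP[v0 v1] w /andP[uw wv]; apply/andP; split.
      exact: le_trans uw.
    exact: le_trans v1.
  - move=> t t01 /bnd; rewrite dotvDr dotvZr dotvBr => h.
    have {}h := h (ball_convex e0 xy xz t01).
    case/andP: t01 => t0 t1.
    set a := dotv p.1 y in sy h; set b := dotv p.1 z in sz h.
    have h2 : (1 - t) * (s * (a - p.2)) + t * (s * (b - p.2)) = 0.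
      by transitivity (s * (a + t * (b - a) - p.2)); [ring|rewrite h subrr mulr0].
    have h3 : 0 <= (1 - t) * (s * (a - p.2)) by rewrite mulr_ge0 ?subr_ge0// ltW.
    have h4 : 0 <= t * (s * (b - p.2)) by rewrite mulr_ge0// ltW.
    have [t12|t12] := ltP t 1.
      have : 0 < (1 - t) * (s * (a - p.2)) by rewrite mulr_gt0 ?subr_gt0.
      by rewrite ltNge; apply/negP; rewrite negbK -h2 lerDl.
    have : 0 < t * (s * (b - p.2)) by rewrite mulr_gt0// (lt_le_trans _ t12).
    by rewrite ltNge; apply/negP; rewrite negbK -h2 lerDr.
  - by rewrite lexx ler01.
  - by rewrite lexx ler01.
have offp A y : open A -> A y -> exists2 z, A z & dotv p.1 z != p.2.
  move=> oA Ay; have /nbhs_ballP[r /= r0 hr] := open_nbhs_nbhs (conj oA Ay).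
  have [|z yz nz] := @ball_off_planes R n [:: p] y r _ r0.
    by move=> q; rewrite inE => /eqP ->.
  exists z; first exact: hr.
  by apply/eqP => pz; apply: nz; exists p; rewrite ?mem_head.
have [y0 [xy0 Oy0] py0] : exists2 y, ball x e y /\ Om y & dotv p.1 y != p.2.
  have [y [Oy xy]] := bx.1 _ (nbhsx_ballx x e e0).
  have [|//|z [xz Oz] pz] := offp (ball x e `&` Om) y.
    by apply: openI => //; exact: ball_open.
  by exists z.
(* the points above the graph in the Lipschitz chart *)
have [y1 [xy1 nOy1] py1] : exists2 y, ball x e y /\ ~ Om y & dotv p.1 y != p.2.
  pose w : 'rV[R]_n := delta_mx ord0 i *m Q^T.
  have wQ : w *m Q = delta_mx ord0 i.
    by rewrite -mulmxA (mulmx1C Qt) mulmx1.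
  have [r r0 hr] := ball_line x w e0.
  pose s := r / 2.
  have s0 : 0 < s by rewrite divr_gt0.
  have xs : ball x e (x + s *: w).
    by apply: hr; rewrite gtr0_norm// /s ltr_pdivrMr// ltr_pMr// ltr1n.
  pose b := x + s *: w.
  have bQ : b *m Q = x *m Q + s *: delta_mx ord0 i.
    by rewrite mulmxDl -scalemxAl wQ.
  have phix : phi (col' i (x *m Q)) <= (x *m Q) ord0 i.
    by rewrite leNgt; apply/negP => /(Oml x (ballxx _ e0)).
  have cb : col' i (b *m Q) = col' i (x *m Q).
    rewrite bQ; apply/rowP => k; rewrite !mxE /=.
    by rewrite [lift i k == i]eq_sym (negPf (neq_lift _ _)) mulr0 addr0.
  have bi : (b *m Q) ord0 i = (x *m Q) ord0 i + s.
    by rewrite bQ !mxE !eqxx mulr1.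
  have [pb|pb] := eqVneq (dotv p.1 b) p.2; last first.
    exists b => //; split => // /(Oml _ xs); rewrite -/b cb bi => h.
    by have := lt_le_trans h phix; rewrite gtrDl ltNge (ltW s0).
  have /nbhs_ballP[rb /= rb0 hrb] : nbhs b (ball x e).
    by apply: open_nbhs_nbhs; split => //; exact: ball_open.
  have [t1 t10 ht1] := ball_line b p.1 rb0.
  have [M [M0 lM]] : exists M, 0 < M /\ forall u v, `|phi u - phi v| <= M * `|u - v|.
    have [M0 [_ h]] := lphi; exists (`|M0| + 1); split; first by rewrite ltr_pwDr.
    move=> u v.
    by apply: (h (`|M0| + 1) _ (u, v)) => //; rewrite ltr_pwDr// ler_norm.
  (* [K] bounds the change of the height over the graph per unit of displacement along [p.1]. The
     point [b] is at height at least [s], and [t * K <= s / 2] keeps the displaced point above the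
     graph. *)
  pose K := `|p.1 *m Q| + M * `|col' i (p.1 *m Q)| + 1.
  have K0 : 0 < K by rewrite ltr_wpDl// addr_ge0// mulr_ge0// ltW.
  pose t := Num.min (t1 / 2) (s / (2 * K)).
  have t0 : 0 < t by rewrite lt_min !divr_gt0// mulr_gt0.
  have xt : ball x e (b + t *: p.1).
    apply: hrb; apply: ht1; rewrite gtr0_norm// gt_min ltr_pdivrMr//.
    by rewrite ltr_pMr// ltr1n.
  exists (b + t *: p.1); last first.
    by rewrite dotvDr pb dotvZr -subr_eq0 addrAC subrr add0r mulf_neq0// gt_eqF.
  split => //; move=> /(Oml _ xt) h.
  have hQ : (b + t *: p.1) *m Q = b *m Q + t *: (p.1 *m Q).
    by rewrite mulmxDl -scalemxAl.
  have tK : t * K <= s / 2.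
    have : t <= s / (2 * K) by rewrite ge_min lexx orbT.
    rewrite ler_pdivlMr ?mulr_gt0// => h'.
    by rewrite ler_pdivlMr// mulrC mulrCA.
  have h1 : `|t * (p.1 *m Q) ord0 i| <= t * `|p.1 *m Q|.
    rewrite normrM gtr0_norm// ler_pM2l//.
    rewrite [leRHS]/Num.Def.normr/= mx_normrE.
    by apply: (le_bigmax _ (fun ij => `|(p.1 *m Q) ij.1 ij.2|%R) (ord0, i)).
  have h2 : `|phi (col' i (b *m Q + t *: (p.1 *m Q))) - phi (col' i (b *m Q))| <=
      t * (M * `|col' i (p.1 *m Q)|).
    apply: le_trans (lM _ _) _.
    have -> : col' i (b *m Q + t *: (p.1 *m Q)) - col' i (b *m Q) =
        t *: col' i (p.1 *m Q).
      by rewrite -raddfB /= addrAC subrr add0r; apply/rowP => k; rewrite !mxE.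
    by rewrite normrZ gtr0_norm// mulrCA.
  move: h; rewrite hQ mxE bi [X in _ + X]mxE => h.
  move: h1 h2; rewrite cb => /ler_normlP[h1 h1'] /ler_normlP[h2 h2'].
  move: tK; rewrite /K !mulrDr mulr1 => tK.
  lra.
(* The sign [sg] orients [p.1] so that it points away from the half that contains [y0], which is the
   inner one. *)
have [sg sgy0] : exists2 s : R, s ^+ 2 = 1 & 0 < s * (p.2 - dotv p.1 y0).
  have [y0p|y0p|] := ltgtP (dotv p.1 y0) p.2; last by move/eqP; rewrite (negPf py0).
    by exists 1; rewrite ?expr1n// mul1r subr_gt0.
  by exists (-1); rewrite ?sqrrN ?expr1n// mulN1r opprB subr_gt0.
move=> sy0.
have sgN0 : sg != 0.
  by apply/eqP => s0; move: sgy0; rewrite s0 expr0n => /eqP; rewrite eq_sym oner_eq0.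
have inOm y : ball x e y -> sg * (dotv p.1 y - p.2) < 0 -> Om y.
  move=> xy h; apply: (half (- sg) y0) => //.
    by rewrite mulNr -mulrN opprB.
  by rewrite mulNr oppr_gt0.
have outOm y : ball x e y -> 0 < sg * (dotv p.1 y - p.2) -> ~ Om y.
  move=> xy h Oy; apply: nOy1.
  have [h1|h1] := ltP 0 (sg * (dotv p.1 y1 - p.2)); first exact: (half sg y).
  apply: inOm => //; rewrite lt_neqAle h1 andbT mulf_neq0// subr_eq0.
  by [].
(* A point of the hyperplane in [Om] would have a neighbourhood in [Om], which reaches into the
   outer half. *)
have onOm y : ball x e y -> dotv p.1 y = p.2 -> ~ Om y.
  move=> xy py Oy.
  have oB : open (ball x e `&` Om) by apply: openI => //; exact: ball_open.
  have /nbhs_ballP[r /= r0 hr] := open_nbhs_nbhs (conj oB (conj xy Oy)).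
  have [t t0 ht] := ball_line y p.1 r0.
  pose u := sg * (t / 2).
  have sgn1 : `|sg| = 1.
    by apply/eqP; rewrite -[_ == _](@eqrXn2 _ 2%N) ?normr_ge0// -normrX sgy0 normr1 expr1n.
  have [xu Ou] : (ball x e `&` Om) (y + u *: p.1).
    apply: hr; apply: ht; rewrite /u normrM sgn1 mul1r gtr0_norm ?divr_gt0//.
    by rewrite ltr_pdivrMr// ltr_pMr// ltr1n.
  apply: outOm Ou => //; rewrite dotvDr py dotvZr addrAC subrr add0r /u.
  by rewrite !mulrA -expr2 sgy0 mul1r !mulr_gt0.
pose nrm := Num.sqrt (dotv p.1 p.1).
have nrm0 : 0 < nrm by rewrite sqrtr_gt0.
exists (sg / nrm); split.
  rewrite dotvZl dotvZr mulrA -expr2 expr_div_n sgy0 sqr_sqrtr ?ltW//.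
  by rewrite mul1r mulVf// gt_eqF.
exists e => // y xy; rewrite dotvZl dotvBr px mulrAC pmulr_llt0 ?invr_gt0//.
split; last exact: inOm.
move=> Oy; rewrite ltNge le_eqVlt; apply/negP => /orP[|h]; last exact: outOm Oy.
rewrite eq_sym mulf_eq0 (negPf sgN0) subr_eq0 => /= /eqP h; exact: onOm Oy.
Qed.

End polyhedral_geometry.

(** * Facets and the surface measure of a polyhedral domain *)

Section facets.
Context (R : realType).

(** If [a] and [b] are different unit vectors, a small step from [x] in the direction [b - a]
    decreases [dotv a] and increases [dotv b]: it would enter [Om] according to [a] but not
    according to [b]. *)
Lemma outward_normal_unique n (Om : set 'rV[R]_n) x a b :
  is_outward_normal Om x a -> is_outward_normal Om x b -> a = b.
Proof.
move=> [a1 [e e0 ea]] [b1 [e' e'0 eb]]; apply/eqP; rewrite -subr_eq0.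
apply/negPn/negP => ab0.
have ab := dotv_gt0 ab0.
have abE : dotv (a - b) (a - b) = 2 - 2 * dotv a b.
  rewrite dotvBr dotvC dotvBr dotvC -[dotv (a - b) b]dotvC dotvBr a1 b1.
  by rewrite [dotv b a]dotvC; ring.
have [r r0 hr] := ball_line x (b - a) e0.
have [r' r'0 hr'] := ball_line x (b - a) e'0.
pose t := Num.min (r / 2) (r' / 2).
have t0 : 0 < t by rewrite lt_min !divr_gt0.
have tr : `|t| < r.
  by rewrite gtr0_norm// gt_min ltr_pdivrMr// ltr_pMr// ltr1n.
have tr' : `|t| < r'.
  by rewrite gtr0_norm// gt_min [X in _ || X]ltr_pdivrMr// ltr_pMr// ltr1n orbT.
have := ea _ (hr _ tr); have := eb _ (hr' _ tr').
rewrite [x + _]addrC addrK !dotvZr !dotvBr a1 b1 [dotv b a]dotvC => h1 h2.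
have h3 : t * (dotv a b - 1) < 0 by rewrite pmulr_rlt0//; lra.
by have := (h1.1 (h2.2 h3)); rewrite pmulr_rlt0//; lra.
Qed.

Definition vnorm n (a : 'rV[R]_n) : R := Num.sqrt (dotv a a).

(** A facet is indexed by its outward unit normal, so each hyperplane of [Hs] yields two candidates,
    one for each orientation. This makes the sum over the facets finite. *)
Definition normalized_planes n (Hs : seq ('rV[R]_n * R)) : seq ('rV[R]_n * R) :=
  [seq ((vnorm p.1)^-1 *: p.1, (vnorm p.1)^-1 * p.2) | p <- Hs] ++
  [seq (- (vnorm p.1)^-1 *: p.1, - (vnorm p.1)^-1 * p.2) | p <- Hs].

Lemma unit_normal_neq0 n (a : 'rV[R]_n) : dotv a a = 1 -> exists i, a ord0 i != 0.
Proof.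
move=> a1; apply/rV0Pn; apply/eqP => a0; move: a1; rewrite a0 /dotv big1.
  by move/eqP; rewrite eq_sym oner_eq0.
by move=> j _; rewrite mxE mul0r.
Qed.

Lemma facet_boundary n (Om : set 'rV[R]_n) x (p : 'rV[R]_n * R) e y : open Om ->
  dotv p.1 p.1 = 1 -> 0 < e ->
  (forall y, ball x e y -> (Om y <-> dotv p.1 (y - x) < 0)) ->
  ball x e y -> dotv p.1 (y - x) = 0 -> boundary Om y.
Proof.
move=> oOm p1 e0 xe xy pyx; split; last first.
  by rewrite (iffLR (interior_id _) oOm) => /(xe _ xy); rewrite pyx ltxx.
move=> B yB.
have /nbhs_ballP[r /= r0 hr] : nbhs y (B `&` ball x e).
  apply: filterI => //; apply: open_nbhs_nbhs; split => //; exact: ball_open.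
have [t t0 ht] := ball_line y p.1 r0.
have [Bz xz] : (B `&` ball x e) (y + (- (t / 2)) *: p.1).
  apply: hr; apply: ht; rewrite normrN gtr0_norm ?divr_gt0//.
  by rewrite ltr_pdivrMr// ltr_pMr// ltr1n.
exists (y + (- (t / 2)) *: p.1); split => //; apply/xe => //.
by rewrite addrAC dotvDr pyx dotvZr p1 mulr1 add0r oppr_lt0 divr_gt0.
Qed.

Lemma hyperplane_graph_near n (p : 'rV[R]_n.+1 * R) i x e : p.1 ord0 i != 0 ->
  dotv p.1 x = p.2 -> 0 < e ->
  exists2 r, 0 < r & forall z, ball (col' i x) r z ->
    ball x e (hyperplane_graph p i z).
Proof.
move=> pi px e0; have q0 : 0 < e * `|p.1 ord0 i| by rewrite mulr_gt0// normr_gt0.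
have := @continuous_dotv R n (col' i p.1) (col' i x).
move=> /cvgrPdist_lt /(_ _ q0) /nbhs_ballP[r /= r0 h].
exists (Num.min e r); first by rewrite lt_min e0.
move=> z xz; have /h /= hz : ball (col' i x) r z.
  by apply: le_ball xz; rewrite ge_min lexx orbT.
apply/ball_rVP => // k; rewrite hyperplane_graphE.
have me : 0 < Num.min e r by rewrite lt_min e0.
case: (unliftP i k) => [j|] ->.
  rewrite ins_rV_lift; move/(ball_rVP _ _ me)/(_ j): xz.
  by rewrite mxE => /lt_le_trans; apply; rewrite ge_min lexx.
rewrite ins_rV_i /= -px -[X in dotv p.1 X](ins_rV_col' i) dotv_ins_rV.
have -> : x ord0 i - (p.1 ord0 i * x ord0 i + dotv (col' i p.1) (col' i x) -
    dotv (col' i p.1) z) / p.1 ord0 i =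
   - ((dotv (col' i p.1) (col' i x) - dotv (col' i p.1) z) / p.1 ord0 i).
  by field.
by rewrite normrN normrM normfV ltr_pdivrMr// normr_gt0.
Qed.

(** Near a facet point the whole hyperplane [p] consists of boundary points, so the hyperplanes of
    [Hs] cover an open piece of it. Proper traces cannot do this, having measure 0; hence some
    member of [Hs] coincides with [p]. *)
Lemma facet_normalized n (Om : set 'rV[R]_n) Hs p : open Om -> proper_planes Hs ->
  boundary Om `<=` on_planes Hs -> facet Om p !=set0 -> p \in normalized_planes Hs.
Proof.
move=> oOm pH bH [x [[p1 [e e0 xe]] px]].
have [i pi] := unit_normal_neq0 p1.
case: n Om Hs p oOm pH bH x p1 e e0 xe px i pi => [|n] Om Hs p oOm pH bH x p1 e e0 xe px i pi.
  by case: i pi.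
have [r r0 hr] := hyperplane_graph_near pi px e0.
(* [tr h] is the equation of [h] restricted to the hyperplane [p], in the coordinates other than
   [i]. It is degenerate exactly when [h.1] is a multiple of [p.1]. *)
pose tr (h : 'rV[R]_n.+1 * R) : 'rV[R]_n * R :=
  (col' i h.1 - (h.1 ord0 i / p.1 ord0 i) *: col' i p.1,
   h.2 - h.1 ord0 i / p.1 ord0 i * p.2).
have trE h z : dotv h.1 (hyperplane_graph p i z) - h.2 = dotv (tr h).1 z - (tr h).2.
  rewrite hyperplane_graphE dotv_ins_rV /tr /=.
  rewrite [dotv (_ - _) z]dotvC dotvBr dotvZr ![dotv z _]dotvC.
  by field.
pose Hs' := [seq q <- [seq tr h | h <- Hs] | q.1 != 0].
have [|z xz nz] := @ball_off_planes R n Hs' (col' i x) r _ r0.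
  by move=> q; rewrite mem_filter => /andP[].
have xg := hr z xz.
have pg := dotv_hyperplane_graph z pi.
have [h hH hz] : on_planes Hs (hyperplane_graph p i z).
  apply: bH; apply: (facet_boundary oOm p1 e0 xe xg).
  by rewrite dotvBr pg px subrr.
have thz : dotv (tr h).1 z = (tr h).2.
  by apply/eqP; rewrite -subr_eq0 -trE hz subrr.
have th0 : (tr h).1 = 0.
  apply/eqP/negPn/negP => h0; apply: nz; exists (tr h) => //.
  by rewrite mem_filter h0; apply/mapP; exists h.
pose c := h.1 ord0 i / p.1 ord0 i.
have h1 : h.1 = c *: p.1.
  apply/rowP => k; case: (unliftP i k) => [j|] ->.
    have /rowP/(_ j) := th0; rewrite !mxE => /eqP.
    by rewrite subr_eq0 => /eqP.
  by rewrite mxE /c divfK.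
have h2 : h.2 = c * p.2.
  move: thz; rewrite th0 /tr /= => /esym.
  have -> : dotv 0 z = 0 by rewrite /dotv big1// => j _; rewrite mxE mul0r.
  by move/eqP; rewrite subr_eq0 => /eqP.
have c0 : c != 0.
  by apply: contra_neq (pH h hH) => c0; rewrite h1 c0 scale0r.
have nh : vnorm h.1 = `|c|.
  by rewrite /vnorm h1 dotvZl dotvZr p1 mulr1 -expr2 sqrtr_sqr.
rewrite mem_cat; apply/orP; have [c_gt0|c_lt0] := ltP 0 c.
  left; apply/mapP; exists h => //; rewrite nh gtr0_norm// h1 h2 scalerA.
  by rewrite mulVf// scale1r mulKf//; case: (p).
right; apply/mapP; exists h => //; rewrite nh ler0_norm// invrN opprK h1 h2 scalerA.
by rewrite mulVf// scale1r mulKf//; case: (p).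
Qed.

Section surface_of_polyhedron.
Context (n : nat) (Om : set 'rV[R]_n.+1) (Hs : seq ('rV[R]_n.+1 * R)).
Hypotheses (oOm : open Om) (bOm : bounded_set Om) (pH : proper_planes Hs).
Hypothesis bH : boundary Om `<=` on_planes Hs.

Definition facets : seq ('rV[R]_n.+1 * R) :=
  [seq p <- undup (normalized_planes Hs) | `[< facet Om p !=set0 >]].

Lemma facets_uniq : uniq facets.
Proof. by rewrite filter_uniq// undup_uniq. Qed.

Lemma facetsP p : reflect (facet Om p !=set0) (p \in facets).
Proof.
rewrite mem_filter mem_undup; apply: (iffP andP).
  by case=> /asboolP.
move=> fp; split; first exact/asboolP.
exact: (facet_normalized oOm pH bH fp).
Qed.

Lemma facet_in_facets p x : facet Om p x -> p \in facets.
Proof. by move=> px; apply/facetsP; exists x. Qed.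

Lemma facet_inj p q x : facet Om p x -> facet Om q x -> p = q.
Proof.
case: p q => [a b] [c d] [na pa] [nc pc]; have E := outward_normal_unique na nc.
by move: pa pc => /=; rewrite /= in E; rewrite E => -> ->.
Qed.

Lemma facet_sub_boundary p x : facet Om p x -> boundary Om x.
Proof.
move=> [[p1 [e e0 xe]] _]; apply: (facet_boundary oOm p1 e0 xe).
  exact: ballxx.
by rewrite subrr /dotv big1// => j _; rewrite mxE mulr0.
Qed.

Lemma outward_normal_facet p x : facet Om p x -> outward_normal Om x = p.1.
Proof.
move=> px; rewrite /outward_normal; case: xgetP => [y -> /= h|h].
  exact: outward_normal_unique h px.1.
by have := h _ px.1.
Qed.

Lemma outward_normal_edge x : (forall p, ~ facet Om p x) -> outward_normal Om x = 0.
Proof.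
move=> px; rewrite /outward_normal; case: xgetP => // y yE h.
by have := px (y, dotv y x) (conj h erefl).
Qed.

Lemma surface_measureE A : surface_measure Om A =
  (\sum_(p <- facets) hyperplane_measure p (A `&` facet Om p))%E.
Proof.
rewrite /surface_measure (_ : [set p | _] = [set` facets]); last first.
  by apply/seteqP; split => p /=; [move/facetsP|move=> /facetsP].
rewrite esum_fset; [|exact: finite_seq|by move=> *; exact: measure_ge0].
by rewrite -fsbig_seq ?facets_uniq.
Qed.

Lemma surface_measure_facet p A : p \in facets -> A `<=` facet Om p ->
  surface_measure Om A = hyperplane_measure p A.
Proof.
move=> pF Ap; rewrite surface_measureE (bigD1_seq p)//=; last exact: facets_uniq.
rewrite (setIidl Ap) big1 ?adde0// => q qp.
rewrite (_ : _ `&` _ = set0) ?measure0//; apply/seteqP; split => // x [/Ap px qx].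
by move: qp; rewrite (facet_inj px qx) eqxx.
Qed.

Lemma surface_measure_edges :
  surface_measure Om (~` \bigcup_(p in [set` facets]) facet Om p) = 0%E.
Proof.
rewrite surface_measureE big1_seq// => p /= pF.
rewrite (_ : _ `&` _ = set0) ?measure0//; apply/seteqP; split => // x [nx px].
by apply: nx; exists p.
Qed.

Lemma measurable_facets : measurable (\bigcup_(p in [set` facets]) facet Om p).
Proof. by apply: fin_bigcup_measurable => // p _; exact: measurable_facet. Qed.

Lemma closure_box : exists k, closure Om `<=` @rV_box R n.+1 k.
Proof.
have [k Ok] := bounded_set_box bOm; exists k.
have cb : closed (@rV_box R n.+1 k).
  rewrite (_ : rV_box k = \bigcap_(j in setT) [set x | `|x ord0 j| <= k%:R]).
    apply: closed_bigI => j _.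
    apply: (@closed_comp _ _ (fun x : 'rV[R]_n.+1 => x ord0 j) [set t | `|t| <= k%:R]).
      by move=> x _; exact: (@coord_continuous R 1 n.+1 ord0 j x).
    apply: (@closed_comp _ _ (Num.norm : R -> R) [set t | t <= k%:R]).
      by move=> x _; exact: norm_continuous.
    exact: closed_le.
  by apply/seteqP; split => x h j; [move=> _; exact: h|exact: h].
by rewrite (iffLR (closure_id _) cb); exact: closureS.
Qed.

Lemma hyperplane_measure_facet_lty p : (hyperplane_measure p (facet Om p) < +oo)%E.
Proof.
have [[x [[p1 _] _]]|/set0P] := pselect (facet Om p !=set0); last first.
  by move/negP; rewrite negbK => /eqP ->; rewrite measure0.
have [i pi] := unit_normal_neq0 p1.
rewrite (hyperplane_measureE pi); last exact: measurable_facet.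
rewrite lte_mul_pinfty ?lee_fin//.
have [k hk] := closure_box.
have [_ _ _ /(_ k)] := lebesgue_rV_subproof R n; apply: le_lt_trans.
have mf : measurable (hyperplane_graph p i @^-1` facet Om p : set 'rV[R]_n).
  rewrite -[X in measurable X]setTI; apply: measurable_graph => //.
  exact: measurable_facet.
apply: le_measure; rewrite ?inE//; first exact: measurable_rV_box.
move=> y /= fy j; have /hk/(_ (lift i j)) := (facet_sub_boundary fy).1.
by rewrite hyperplane_graphE ins_rV_lift.
Qed.

Lemma surface_measure_lty : (surface_measure Om setT < +oo)%E.
Proof.
rewrite surface_measureE; apply: lte_sum_pinfty => p _.
by rewrite setTI; exact: hyperplane_measure_facet_lty.
Qed.

(** [outward_normal] is defined by choice; this finite sum over the facets, which is 0 on the edges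
    as the normal is there, exhibits its measurability. *)
Lemma dotv_outward_normal beta x : dotv beta (outward_normal Om x) =
  \sum_(p <- facets) \1_(facet Om p) x * dotv beta p.1.
Proof.
have [[p px]|h] := pselect (exists p, facet Om p x).
  rewrite (outward_normal_facet px) (bigD1_seq p)//=; last 2 first.
  - exact: (facet_in_facets px).
  - exact: facets_uniq.
  rewrite indicE mem_set// mul1r big1 ?addr0// => q qp.
  rewrite indicE memNset ?mul0r// => qx.
  by move: qp; rewrite (facet_inj px qx) eqxx.
rewrite outward_normal_edge; last by move=> p px; apply: h; exists p.
rewrite big1.
  by rewrite /dotv big1// => j _; rewrite mxE mulr0.
move=> p _; rewrite indicE memNset ?mul0r// => px; apply: h; by exists p.
Qed.

Lemma bm_dotv_outward_normal beta :
  bounded_measurable (fun x => dotv beta (outward_normal Om x)).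
Proof.
under eq_fun do rewrite dotv_outward_normal.
apply: bm_sum => p; apply: bmM; last exact: bm_cst.
by apply: bm_indic; exact: measurable_facet.
Qed.

Lemma measurable_closure_rV : measurable (closure Om).
Proof.
rewrite -[X in measurable X]setCK; apply: measurableC.
by apply: open_measurable_matrix; rewrite openC; exact: closed_closure.
Qed.

Lemma measurable_boundary : measurable (boundary Om).
Proof.
apply: measurableD; first exact: measurable_closure_rV.
by apply: open_measurable_matrix; exact: open_interior.
Qed.

Lemma measurable_inflow beta : measurable (inflow Om beta).
Proof.
rewrite (_ : inflow Om beta = boundary Om `&`
    (setT `&` (fun x => dotv beta (outward_normal Om x)) @^-1` `]-oo, 0[%classic)).
  apply: measurableI; first exact: measurable_boundary.
  by apply: (bm_dotv_outward_normal beta).1 => //; exact: measurable_itv.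
by rewrite setTI; apply/seteqP; split => x /=; rewrite in_itv.
Qed.

End surface_of_polyhedron.
End facets.

Section scaled_pushforward.
Context d1 d2 (X : measurableType d1) (Y : measurableType d2) (R : realType).
Variables (phi : X -> Y) (mphi : measurable_fun setT phi).
Variables (mu : {measure set X -> \bar R}) (nu : {measure set Y -> \bar R}).
Variables (D : set Y) (k : R).
Hypotheses (k0 : 0 < k) (mD : measurable D) (finD : (nu D < +oo)%E).
Hypothesis nuE : forall A, measurable A -> A `<=` D ->
  nu A = (k%:E * mu (phi @^-1` A))%E.

Let mphiD : measurable (phi @^-1` D).
Proof. by rewrite -[X in measurable X]setTI; exact: mphi. Qed.

Let finphiD : (mu (phi @^-1` D) < +oo)%E.
Proof.
have := nuE mD (@subset_refl _ D); move: finD => /[swap] -> .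
rewrite ltey; case: (mu _) (measure_ge0 mu (phi @^-1` D)) => // [r _|].
  by rewrite ltry.
by move=> _; rewrite gt0_muley ?lte_fin.
Qed.

Let ge0 (u : Y -> R) : bounded_measurable u -> (forall y, 0 <= u y) ->
  \int[nu]_(y in D) u y = k * \int[mu]_(x in phi @^-1` D) u (phi x).
Proof.
move=> bu u0.
have mu' : measurable_fun D (EFin \o u).
  by apply/measurable_EFinP; apply: measurable_funTS; exact: bu.1.
pose pm' : {measure set Y -> \bar R} := pushforward mu phi.
pose pm := pm' mphi.
have kE : (\int[nu]_(y in D) (u y)%:E = k%:E * \int[mu]_(x in phi @^-1` D) (u (phi x))%:E)%E.
  transitivity (\int[mscale (NngNum (ltW k0)) pm]_(y in D) (u y)%:E)%E.
    by apply: eq_measure_integral => A mA AD; rewrite nuE.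
  rewrite ge0_integral_mscale//; last by move=> y _; rewrite lee_fin.
  congr (_ * _)%E.
  have := @ge0_integral_pushforward _ _ _ _ _ phi mphi mu D (EFin \o u) mD mu'.
  by apply => y _; rewrite lee_fin.
rewrite /Rintegral kE fineM//.
apply: integrable_fin_num => //.
exact: (bm_integrable mphiD finphiD (bm_comp mphi bu)).
Qed.

Lemma bm_Rintegral_scaled_pushforward (u : Y -> R) : bounded_measurable u ->
  \int[nu]_(y in D) u y = k * \int[mu]_(x in phi @^-1` D) u (phi x).
Proof.
move=> bu; have [_ [M uM]] := bu.
(* The formula holds for nonnegative functions and for constants, and is linear: it is applied to
   [u + M] and to [M]. *)
have bM : bounded_measurable (fun y => u y + M) by apply: bmD => //; exact: bm_cst.
have u0 y : 0 <= u y + M by rewrite -lerBlDr sub0r; have /ler_normlP[] := uM y; rewrite lerNl.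
have M0 : bounded_measurable (fun _ : Y => `|M|) by exact: bm_cst.
have bc := bm_comp mphi bu.
have cst : \int[nu]_(y in D) M = k * \int[mu]_(x in phi @^-1` D) M.
  rewrite !Rintegral_cst// nuE// fineM//; first by rewrite mulrCA.
  by rewrite ge0_fin_numE.
have := ge0 bM u0.
rewrite (bm_RintegralD mD finD bu (@bm_cst _ _ R M)).
rewrite (bm_RintegralD mphiD finphiD bc (@bm_cst _ _ R M)) cst mulrDr.
by move/addIr.
Qed.

End scaled_pushforward.

Lemma Rintegral_sum d (T : measurableType d) (R : realType)
    (mu : {measure set T -> \bar R}) (D : set T) I (s : seq I) (F : I -> T -> R) :
  measurable D -> (forall i, mu.-integrable D (EFin \o F i)) ->
  \int[mu]_(x in D) (\sum_(i <- s) F i x) = \sum_(i <- s) \int[mu]_(x in D) F i x.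
Proof.
move=> mD iF; elim: s => [|i s IH].
  under eq_Rintegral do rewrite big_nil.
  by rewrite Rintegral_cst// mul0r big_nil.
under eq_Rintegral do rewrite big_cons.
rewrite big_cons -IH RintegralD//.
rewrite (_ : _ \o _ = (fun x => \sum_(i <- s) (EFin \o F i) x)%E).
  exact: integrable_sum.
by apply/funext => x /=; rewrite sumEFin.
Qed.

Section surface_integral.
Context (R : realType) (n : nat) (Om : set 'rV[R]_n.+1) (Hs : seq ('rV[R]_n.+1 * R)).
Hypotheses (oOm : open Om) (bOm : bounded_set Om) (pH : proper_planes Hs).
Hypothesis bH : boundary Om `<=` on_planes Hs.

Lemma surface_measure_finite D : measurable D -> (surface_measure Om D < +oo)%E.
Proof.
move=> mD; apply: le_lt_trans (surface_measure_lty oOm bOm pH bH).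
by apply: le_measure; rewrite ?inE.
Qed.

Lemma Rintegral_surface D u : measurable D -> bounded_measurable u ->
  \int[surface_measure Om]_(x in D) u x =
  \sum_(p <- facets Om Hs) \int[hyperplane_measure p]_(x in D `&` facet Om p) u x.
Proof.
move=> mD bu.
transitivity (\int[surface_measure Om]_(x in D)
    (\sum_(p <- facets Om Hs) (u \_ (facet Om p)) x)).
  apply: (@eq_Rintegral_off_null _ _ _ (surface_measure Om) D
    (~` \bigcup_(p in [set` facets Om Hs]) facet Om p)).
  - by apply: measurableC; exact: measurable_facets.
  - exact: surface_measure_edges oOm pH bH.
  move=> x Dx /contrapT[p /= pF px].
  rewrite (bigD1_seq p)//=; last exact: facets_uniq.
  rewrite patchE mem_set// big1 ?addr0// => q qp.
  rewrite patchE memNset// => qx.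
  by move: qp; rewrite (facet_inj px qx) eqxx.
rewrite bm_Rintegral_sum//; last 2 first.
- exact: surface_measure_finite.
- move=> p; rewrite (_ : _ \_ _ = fun x => u x * \1_(facet Om p) x).
    by apply: bmM => //; apply: bm_indic; exact: measurable_facet.
  by apply/funext => x; rewrite patchE indicE; case: ifP; rewrite ?mulr1 ?mulr0.
rewrite !big_seq; apply: eq_bigr => p pF.
rewrite -Rintegral_mkcondr; congr fine; apply: eq_measure_integral => A mA AD.
by apply: (surface_measure_facet oOm pH bH pF) => x /AD[].
Qed.

Lemma Rintegral_hyperplane_measure (p : 'rV[R]_n.+1 * R) i u :
  p.1 ord0 i != 0 -> bounded_measurable u ->
  \int[hyperplane_measure p]_(x in facet Om p) u x =
  `|p.1 ord0 i|^-1 * \int[lebesgue_rV]_(y in hyperplane_graph p i @^-1` facet Om p : set 'rV[R]_n)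
      u (hyperplane_graph p i y).
Proof.
move=> pi bu; apply: bm_Rintegral_scaled_pushforward => //.
- exact: measurable_graph.
- by rewrite invr_gt0 normr_gt0.
- exact: measurable_facet.
- exact: hyperplane_measure_facet_lty oOm bOm p.
- by move=> A mA _; exact: (hyperplane_measureE pi mA).
Qed.

End surface_integral.

Section fubini_insert.
Context (R : realType) (n : nat).

Lemma Rintegral_ins_rV (i : 'I_n.+1) (f : 'rV[R]_n.+1 -> R) :
  lebesgue_rV.-integrable setT (EFin \o f) ->
  \int[lebesgue_rV]_x f x =
  \int[lebesgue_rV]_y (\int[lebesgue_measure]_t f (ins_rV i (t, y))).
Proof.
move=> intf; have mf := measurable_int _ intf.
pose P : {measure set (measurableTypeR R * 'rV[R]_n) -> \bar R} :=
  (lebesgue_measure \x lebesgue_rV)%E.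
have mi := @measurable_ins_rV R n i.
pose g := (EFin \o f) \o ins_rV i.
have mg : measurable_fun setT g by exact: measurableT_comp.
pose pm' : {measure set 'rV[R]_n.+1 -> \bar R} := pushforward P (ins_rV i).
pose pm := pm' mi.
have eqpm h : (\int[lebesgue_rV]_x h x = \int[pm]_x h x)%E.
  by apply: eq_measure_integral => A mA _; exact: lebesgue_rV_ins.
have intg : P.-integrable setT g.
  apply/integrableP; split => //.
  move/integrableP : intf => [_]; rewrite eqpm.
  have ma : measurable_fun setT (abse \o (EFin \o f)) by exact: measurableT_comp.
  have := @ge0_integral_pushforward _ _ (measurableTypeR R * 'rV[R]_n)%type _ _ _
    mi P setT (abse \o (EFin \o f)) measurableT ma (fun x _ => abse_ge0 _).
  by move=> ->.
rewrite /Rintegral eqpm.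
have := @integral_pushforward _ _ (measurableTypeR R * 'rV[R]_n)%type _ _ _
  mi P setT (EFin \o f) mf intg measurableT.
move=> ->; rewrite preimage_setT; congr fine.
have := @integral21_prod_meas1 _ _ (measurableTypeR R) _ _ lebesgue_measure lebesgue_rV g intg.
move=> <-.
(* For the lines in a null set the section need not be integrable, and [fine] would alter its
   integral; these lines are ignored. *)
have [N [mN N0 hN]] := @ae_integrable2 _ _ (measurableTypeR R) _ _ lebesgue_measure lebesgue_rV g intg.
apply: (eq_integral_off_null mN N0) => y _ Ny.
have iy : lebesgue_measure.-integrable setT (fun t : measurableTypeR R => g (t, y)).
  by apply: contrapT => h; apply: Ny; apply: hN.
rewrite /fubini_G fineK//; exact: (integrable_fin_num _ iy).
Qed.

End fubini_insert.

(** * Piecewise polynomials and Green's formula *)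

Section polynomial_functions.
Context (R : realType).

(** Polynomials given by their construction instead of their coefficients: derivatives, restrictions
    to lines and pullbacks to a product are then obtained by induction, and no degree has to be
    tracked. *)
Inductive polyfun n : ('rV[R]_n -> R) -> Prop :=
| polyfun_cst c : polyfun (fun=> c)
| polyfun_coord i : polyfun (fun x => x ord0 i)
| polyfun_add f g : polyfun f -> polyfun g -> polyfun (fun x => f x + g x)
| polyfun_mul f g : polyfun f -> polyfun g -> polyfun (fun x => f x * g x).

Lemma polyfun_sum n I (s : seq I) (F : I -> 'rV[R]_n -> R) :
  (forall i, polyfun (F i)) -> polyfun (fun x => \sum_(i <- s) F i x).
Proof.
move=> pF; elim: s => [|i s IH].
  by under eq_fun do rewrite big_nil; exact: polyfun_cst.
by under eq_fun do rewrite big_cons; exact: polyfun_add.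
Qed.

Lemma polyfun_prod n I (s : seq I) (F : I -> 'rV[R]_n -> R) :
  (forall i, polyfun (F i)) -> polyfun (fun x => \prod_(i <- s) F i x).
Proof.
move=> pF; elim: s => [|i s IH].
  by under eq_fun do rewrite big_nil; exact: polyfun_cst.
by under eq_fun do rewrite big_cons; exact: polyfun_mul.
Qed.

Lemma polyfun_exp n (f : 'rV[R]_n -> R) k : polyfun f -> polyfun (fun x => f x ^+ k).
Proof.
move=> pf; elim: k => [|k IH]; first by under eq_fun do rewrite expr0; exact: polyfun_cst.
by under eq_fun do rewrite exprS; exact: polyfun_mul.
Qed.

Lemma is_polynomial_polyfun n k (q : 'rV[R]_n -> R) : is_polynomial k q -> polyfun q.
Proof.
case=> a qE; rewrite (_ : q = fun x => \sum_e a e * \prod_i x ord0 i ^+ e i).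
  apply: polyfun_sum => e; apply: polyfun_mul; first exact: polyfun_cst.
  by apply: polyfun_prod => i; apply: polyfun_exp; exact: polyfun_coord.
exact/funext.
Qed.

Lemma polyfun_lsubmx n1 n2 (q : 'rV[R]_n1 -> R) : polyfun q ->
  polyfun (fun x : 'rV[R]_(n1 + n2) => q (lsubmx x)).
Proof.
elim=> [c|i|f g _ IHf _ IHg|f g _ IHf _ IHg].
- exact: polyfun_cst.
- under eq_fun do rewrite mxE; exact: polyfun_coord.
- exact: polyfun_add.
- exact: polyfun_mul.
Qed.

Lemma polyfun_rsubmx n1 n2 (q : 'rV[R]_n2 -> R) : polyfun q ->
  polyfun (fun x : 'rV[R]_(n1 + n2) => q (rsubmx x)).
Proof.
elim=> [c|i|f g _ IHf _ IHg|f g _ IHf _ IHg].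
- exact: polyfun_cst.
- under eq_fun do rewrite mxE; exact: polyfun_coord.
- exact: polyfun_add.
- exact: polyfun_mul.
Qed.

Lemma is_derive_coord n (i : 'I_n) (x v : 'rV[R]_n) :
  is_derive x v (fun y : 'rV[R]_n => y ord0 i) (v ord0 i).
Proof.
have E : (fun h : R => h^-1 *: ((fun y : 'rV[R]_n => y ord0 i) (h *: v + x) - x ord0 i))
    @ 0^' --> v ord0 i.
  apply: cvg_near_cst; near=> h.
  have h0 : h != 0 by near: h; exact: nbhs_dnbhs_neq.
  by rewrite !mxE addrK /GRing.scale /= mulKf.
by apply: DeriveDef; [apply/cvg_ex; exists (v ord0 i)|exact: cvg_lim E].
Unshelve. all: by end_near. Qed.

Lemma polyfun_derive n (q : 'rV[R]_n -> R) v : polyfun q ->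
  exists2 q', polyfun q' & forall x, is_derive x v q (q' x).
Proof.
elim=> [c|i|f g pf [f' pf' hf] pg [g' pg' hg]|f g pf [f' pf' hf] pg [g' pg' hg]].
- exists (fun=> 0); first exact: polyfun_cst.
  by move=> x; exact: is_derive_cst.
- exists (fun=> v ord0 i); first exact: polyfun_cst.
  by move=> x; exact: is_derive_coord.
- exists (fun x => f' x + g' x); first exact: polyfun_add.
  by move=> x; exact: is_deriveD.
- exists (fun x => f x * g' x + g x * f' x).
    by apply: polyfun_add; apply: polyfun_mul.
  by move=> x; exact: is_deriveM.
Qed.

Lemma polyfun_derivable n (q : 'rV[R]_n -> R) v x : polyfun q -> derivable q x v.
Proof. by move=> /(polyfun_derive v)[q' _ /(_ x)]. Qed.

Lemma polyfun_line n (q : 'rV[R]_n.+1 -> R) i y : polyfun q ->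
  exists P : {poly R}, forall t, q (ins_rV i (t, y)) = P.[t] /\
    'D_(delta_mx ord0 i) q (ins_rV i (t, y)) = P^`().[t].
Proof.
elim=> [c|j|f g pf [P hP] pg [Q hQ]|f g pf [P hP] pg [Q hQ]].
- by exists c%:P => t; rewrite hornerC derivC horner0 derive_cst.
- case: (unliftP i j) => [k|] ->.
    exists (y ord0 k)%:P => t; rewrite hornerC derivC horner0 ins_rV_lift; split => //.
    rewrite (@derive_val _ _ _ _ _ _ _ (is_derive_coord _ _ _)) mxE eqxx /=.
    by rewrite eq_sym (negPf (neq_lift _ _)).
  exists 'X => t; rewrite hornerX derivX hornerC ins_rV_i; split => //.
  by rewrite (@derive_val _ _ _ _ _ _ _ (is_derive_coord _ _ _)) mxE !eqxx.
- exists (P + Q) => t; have [hP1 hP2] := hP t; have [hQ1 hQ2] := hQ t.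
  rewrite hornerD derivD hornerD -hP1 -hQ1 -hP2 -hQ2; split => //.
  by rewrite -deriveD//; exact: polyfun_derivable.
- exists (P * Q) => t; have [hP1 hP2] := hP t; have [hQ1 hQ2] := hQ t.
  rewrite hornerM derivM hornerD !hornerM -hP1 -hQ1 -hP2 -hQ2; split => //.
  rewrite [LHS](@deriveM _ _ f g); try exact: polyfun_derivable.
  by rewrite /GRing.scale /= addrC mulrC.
Qed.

Lemma polyfun_derive_partial n (q : 'rV[R]_n -> R) v x : polyfun q ->
  'D_v q x = \sum_i v ord0 i * 'D_(delta_mx ord0 i) q x.
Proof.
elim=> [c|j|f g pf IHf pg IHg|f g pf IHf pg IHg].
- by rewrite derive_cst big1// => i _; rewrite derive_cst mulr0.
- rewrite (@derive_val _ _ _ _ _ _ _ (is_derive_coord _ _ _)).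
  rewrite (bigD1 j)//= (@derive_val _ _ _ _ _ _ _ (is_derive_coord _ _ _)).
  rewrite mxE !eqxx mulr1 big1 ?addr0// => i ij.
  rewrite (@derive_val _ _ _ _ _ _ _ (is_derive_coord _ _ _)) mxE eqxx/=.
  by rewrite eq_sym (negPf ij) mulr0.
- have dD w : 'D_w (fun x => f x + g x) x = 'D_w f x + 'D_w g x.
    by apply: deriveD; exact: polyfun_derivable.
  rewrite dD IHf IHg -big_split /=; apply: eq_bigr => i _.
  by rewrite dD mulrDr.
- have dM w : 'D_w (fun x => f x * g x) x = f x * 'D_w g x + g x * 'D_w f x.
    by apply: deriveM; exact: polyfun_derivable.
  rewrite dM IHf IHg !mulr_sumr -big_split /=; apply: eq_bigr => i _.
  by rewrite dM; ring.
Qed.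

Lemma measurable_polyfun n (q : 'rV[R]_n -> R) : polyfun q -> measurable_fun setT q.
Proof.
elim=> [c|i|f g _ IHf _ IHg|f g _ IHf _ IHg].
- exact: measurable_cst.
- exact: measurable_coord.
- exact: measurable_funD.
- exact: measurable_funM.
Qed.

Lemma polyfun_bounded n (q : 'rV[R]_n -> R) k : polyfun q ->
  exists M, forall x, rV_box k x -> `|q x| <= M.
Proof.
elim=> [c|i|f g _ [M hM] _ [M' hM']|f g _ [M hM] _ [M' hM']].
- by exists `|c|.
- by exists k%:R => x; exact.
- exists (M + M') => x kx.
  by rewrite (le_trans (ler_normD _ _))// lerD// ?hM ?hM'.
- exists (M * M') => x kx; rewrite normrM ler_pM// ?hM ?hM'//.
Qed.

End polynomial_functions.

Section piecewise_polynomial_line.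
Context (R : realType).

Lemma integral_deriv_poly (P : {poly R}) (a b : R) : a < b ->
  \int[lebesgue_measure]_(t in `[a, b]) (P^`()).[t] = P.[b] - P.[a].
Proof.
move=> ab; rewrite /Rintegral (@continuous_FTC2 _ _ (horner P))//.
- by apply/continuous_subspaceT => x; exact: continuous_horner.
- split.
  + by move=> x _; exact: derivable_horner.
  + by apply: cvg_at_right_filter; exact: continuous_horner.
  + by apply: cvg_at_left_filter; exact: continuous_horner.
- by move=> x _; rewrite derivE.
Qed.

Lemma integrable_horner (P : {poly R}) (a b : R) :
  lebesgue_measure.-integrable `[a, b] (EFin \o horner P).
Proof.
apply: continuous_compact_integrable; first exact: segment_compact.
by apply/continuous_subspaceT => x; exact: continuous_horner.
Qed.

(* Fp and Fm are the right and left limits of a primitive of G with jumps at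
   the break points *)
Variables (G Fp Fm : R -> R).

Definition piece x y := x < y /\ exists P : {poly R},
  [/\ forall t, x < t < y -> G t = P^`().[t], Fp x = P.[x] & Fm y = P.[y]].

Lemma piece_integral x y : piece x y ->
  \int[lebesgue_measure]_(t in `[x, y]) G t = Fm y - Fp x.
Proof.
move=> [xy [P [GP -> ->]]]; pose N : set R := [set x; y].
have mN : measurable (N : set (measurableTypeR R)).
  by apply: measurableU; exact: measurable_set1.
have N0 : lebesgue_measure N = 0%E.
  apply: null_set_setU; by [exact: measurable_set1|exact: lebesgue_measure_set1].
rewrite -(integral_deriv_poly P xy); apply: (eq_Rintegral_off_null mN N0).
move=> t; rewrite /= in_itv/= => /andP[xt ty] /not_orP[tx ty']; apply: GP.
rewrite !lt_neqAle xt ty !andbT; apply/andP; split; apply/eqP; last exact: ty'.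
by move/esym.
Qed.

Hypothesis bG : bounded_measurable (G : measurableTypeR R -> R).

Lemma bm_integrable_itv a b : lebesgue_measure.-integrable `[a, b] (EFin \o G).
Proof.
have H := lebesgue_measure_itv `[a, b].
apply: bm_integrable => //.
apply: (@eq_ind_r _ _ (fun x => (x < +oo)%E) _ _ H) => /=.
by case: ifP => _; rewrite ?ltry// -EFinB ltry.
Qed.

(** A piece contributes [Fm y - Fp x]. Adding and subtracting [Fp] at every break point, the last
    one included, separates the jumps from the end values. *)
Lemma piece_path_integral a s : path (fun x y => `[< piece x y >]) a s ->
  \int[lebesgue_measure]_(t in `[a, last a s]) G t =
  Fp (last a s) - Fp a + \sum_(x <- s) (Fm x - Fp x) /\ a <= last a s.
Proof.
elim: s a => [|b s IH] a /=.
  rewrite big_nil subrr add0r set_itv1 Rintegral_set1; split => //.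
case/andP => /asboolP pab /IH[Es bs]; have ab := pab.1; split; last first.
  exact: le_trans (ltW ab) bs.
have iG := bm_integrable_itv a (last b s).
have := @Rintegral_itvB _ G (BLeft a) (BRight (last b s)) b iG.
rewrite !bnd_simp => /(_ (ltW ab) bs) E.
rewrite -[LHS](subrK (\int[lebesgue_measure]_(t in `[a, b]) G t)) E.
rewrite Rintegral_itv_obnd_cbnd; last first.
  apply: integrableS (bm_integrable_itv b (last b s)) => //.
  by apply: subset_itvr; rewrite bnd_simp.
rewrite Es (piece_integral pab) big_cons; ring.
Qed.

Lemma path_piece a s :
  path <%R a s ->
  (forall x y, x \in a :: s -> y \in s -> x < y ->
     (forall z, z \in s -> ~ (x < z < y)) -> piece x y) ->
  path (fun x y => `[< piece x y >]) a s.
Proof.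
elim: s a => [//|b s IH] a /= /andP[ab pbs] h; apply/andP; split.
  apply/asboolP; apply: h; rewrite ?mem_head// => z.
  rewrite in_cons => /orP[/eqP ->|zs]; first by rewrite ltxx andbF.
  move/(order_path_min lt_trans)/allP/(_ z zs): pbs => bz /andP[_ zb].
  by have := lt_trans bz zb; rewrite ltxx.
apply: IH => // x y xs ys xy hz; apply: h => //.
- by rewrite in_cons xs orbT.
- by rewrite in_cons ys orbT.
move=> z; rewrite in_cons => /orP[/eqP -> /andP[xb _]|zs]; last exact: hz.
move: xs; rewrite in_cons => /orP[/eqP xb'|xs]; first by rewrite xb' ltxx in xb.
move/(order_path_min lt_trans)/allP/(_ x xs): pbs => bx.
by have := lt_trans bx xb; rewrite ltxx.
Qed.

End piecewise_polynomial_line.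

Section piecewise_polynomials.
Context (R : realType) (m : nat).
Variables (Om : set 'rV[R]_m) (Hs : seq ('rV[R]_m * R)).
Variable Cs : seq (seq ('rV[R]_m * R)).

(** [Hs] gathers the hyperplanes of the boundary and of the faces of all cells. The second clause,
    an outward normal at each boundary point where all hyperplanes of [Hs] are parallel, is the form
    in which the Lipschitz condition is used; it is easier to transfer to a product than charts
    are. *)
Definition polyhedral_mesh := [/\
  [/\ open Om, bounded_set Om, proper_planes Hs & boundary Om `<=` on_planes Hs],
  forall x p, boundary Om x -> p \in Hs -> dotv p.1 x = p.2 ->
    (forall q, q \in Hs -> dotv q.1 x = q.2 -> parallel p.1 q.1) ->
    exists c, is_outward_normal Om x (c *: p.1),
  forall h, h \in Cs -> cell h `<=` Om /\ forall p, p \in h -> p.1 != 0 -> p \in Hs &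
  forall x, Om x -> ~ on_planes Hs x -> exists2 h, h \in Cs & cell h x].

Definition fe_function (u : 'rV[R]_m -> R) := [/\ bounded_measurable u,
  {within closure Om, continuous u}, forall x, ~ closure Om x -> u x = 0 &
  forall h, h \in Cs -> exists2 q, polyfun q & forall x, cell h x -> u x = q x].

Definition regular_points := Om `\` on_planes Hs.

(* The pointwise derivative is set to 0 on the interfaces of the cells, where
   it may be a junk value. *)
Definition cell_derivative v (u : 'rV[R]_m -> R) x : R :=
  if `[< regular_points x >] then 'D_v u x else 0.

Lemma fe_functionM u w : fe_function u -> fe_function w ->
  fe_function (fun x => u x * w x).
Proof.
move=> [bu cu ou pu] [bw cw ow pw]; split.
- exact: bmM.
- by move=> x; apply: (@continuousM _ (subspace (closure Om))); [exact: cu|exact: cw].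
- by move=> x cx; rewrite ou// mul0r.
move=> h hC; have [q pq uq] := pu h hC; have [q' pq' wq] := pw h hC.
exists (fun x => q x * q' x); first exact: polyfun_mul.
by move=> x hx; rewrite uq// wq.
Qed.

Lemma fe_functionD u w : fe_function u -> fe_function w ->
  fe_function (fun x => u x + w x).
Proof.
move=> [bu cu ou pu] [bw cw ow pw]; split.
- exact: bmD.
- by move=> x; apply: (@continuousD _ _ (subspace (closure Om))); [exact: cu|exact: cw].
- by move=> x cx; rewrite ou// ow// addr0.
move=> h hC; have [q pq uq] := pu h hC; have [q' pq' wq] := pw h hC.
exists (fun x => q x + q' x); first exact: polyfun_add.
by move=> x hx; rewrite uq// wq.
Qed.

Lemma fe_function0 : fe_function (fun=> 0).
Proof.
split => //; first exact: bm_cst.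
- by move=> x; exact: cvg_cst.
- by move=> h _; exists (fun=> 0) => //; exact: polyfun_cst.
Qed.

Lemma fe_function_sum I (s : seq I) (F : I -> 'rV[R]_m -> R) :
  (forall i, fe_function (F i)) -> fe_function (fun x => \sum_(i <- s) F i x).
Proof.
move=> pF; elim: s => [|i s IH].
  by under eq_fun do rewrite big_nil; exact: fe_function0.
by under eq_fun do rewrite big_cons; exact: fe_functionD.
Qed.

End piecewise_polynomials.

(** * The fundamental theorem of calculus along coordinate lines *)

Section green.
Context (R : realType) (n : nat).
Variables (Om : set 'rV[R]_n.+1) (Hs : seq ('rV[R]_n.+1 * R)).
Variable Cs : seq (seq ('rV[R]_n.+1 * R)).
Local Notation polyhedral_mesh := (polyhedral_mesh Om Hs Cs).
Local Notation fe_function := (fe_function Om Cs).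
Local Notation regular_points := (regular_points Om Hs).
Local Notation dd := (cell_derivative Om Hs).
Hypothesis mesh : polyhedral_mesh.

Let oOm : open Om. Proof. by case: mesh => -[]. Qed.
Let bOm : bounded_set Om. Proof. by case: mesh => -[]. Qed.
Let pH : proper_planes Hs. Proof. by case: mesh => -[]. Qed.
Let bH : boundary Om `<=` on_planes Hs. Proof. by case: mesh => -[]. Qed.

Lemma open_cell (h : seq ('rV[R]_n.+1 * R)) : open (cell h).
Proof.
elim: h => [|p h IH].
  by rewrite (_ : cell _ = setT); [exact: openT|apply/seteqP; split].
rewrite (_ : cell _ = dotv p.1 @^-1` [set t | t < p.2] `&` cell h).
  apply: openI => //; apply: open_comp; last exact: open_lt.
  by move=> x _; exact: continuous_dotv.
apply/seteqP; split => x /=.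
  move=> hx; split; first by apply: hx; rewrite mem_head.
  by move=> q qh; apply: hx; rewrite in_cons qh orbT.
by move=> [px hx] q; rewrite in_cons => /orP[/eqP ->|/hx].
Qed.

Lemma fe_function_local u x : fe_function u -> Om x -> ~ on_planes Hs x ->
  exists2 q, polyfun q & \near x, u x = q x.
Proof.
move=> [_ _ _ uC] Ox Hx; case: mesh => _ _ _ /(_ x Ox Hx)[h hC hx].
have [q pq uq] := uC h hC; exists q => //.
by near do apply: uq; apply: open_nbhs_nbhs; split => //; exact: open_cell.
Unshelve. all: by end_near. Qed.

Lemma cell_derivativeE v u x : Om x -> ~ on_planes Hs x -> dd v u x = 'D_v u x.
Proof. by move=> Ox Hx; rewrite /cell_derivative; case: asboolP => // -[]. Qed.

Lemma cell_derivative_out v u x : ~ regular_points x -> dd v u x = 0.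
Proof. by rewrite /cell_derivative; case: asboolP. Qed.

Lemma cell_derivative_cell v u h q x : h \in Cs ->
  (forall x, cell h x -> u x = q x) -> cell h x -> ~ on_planes Hs x ->
  dd v u x = 'D_v q x.
Proof.
move=> hC uq hx Hx.
have Ox : Om x by case: mesh => _ _ /(_ h hC)[+ _] _; apply.
rewrite cell_derivativeE//; apply: near_eq_derive.
by near do apply: uq; apply: open_nbhs_nbhs; split => //; exact: open_cell.
Unshelve. all: by end_near. Qed.

Lemma fe_function_derivable v u x : fe_function u -> Om x -> ~ on_planes Hs x ->
  derivable u x v.
Proof.
move=> fu Ox Hx; have [q pq uq] := fe_function_local fu Ox Hx.
apply: (@near_eq_derivable _ _ _ q); last exact: polyfun_derivable.
by near do apply/esym; exact: uq.
Unshelve. all: by end_near. Qed.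

(** A directional derivative need not be linear in the direction; here it is, because [u] is a
    polynomial near every regular point. This reduces the divergence theorem to the coordinate
    axes. *)
Lemma cell_derivative_partial v u x : fe_function u ->
  dd v u x = \sum_i v ord0 i * dd (delta_mx ord0 i) u x.
Proof.
move=> fu; have [[Ox Hx]|rx] := pselect (regular_points x); last first.
  rewrite cell_derivative_out// big1// => i _.
  by rewrite cell_derivative_out// mulr0.
have [q pq uq] := fe_function_local fu Ox Hx.
rewrite cell_derivativeE// (near_eq_derive _ uq) (polyfun_derive_partial _ _ pq).
by apply: eq_bigr => i _; rewrite cell_derivativeE// (near_eq_derive _ uq).
Qed.

Lemma cell_derivativeM v u w x : fe_function u -> fe_function w ->
  dd v (fun x => u x * w x) x = u x * dd v w x + dd v u x * w x.
Proof.
move=> fu fw; have [[Ox Hx]|rx] := pselect (regular_points x); last first.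
  by rewrite !cell_derivative_out// mulr0 mul0r addr0.
rewrite !cell_derivativeE//.
rewrite [LHS](@deriveM _ _ u w); try exact: fe_function_derivable.
by rewrite /GRing.scale /= [w x * _]mulrC.
Qed.

Lemma cell_derivativeD v u w x : fe_function u -> fe_function w ->
  dd v (fun x => u x + w x) x = dd v u x + dd v w x.
Proof.
move=> fu fw; have [[Ox Hx]|rx] := pselect (regular_points x); last first.
  by rewrite !cell_derivative_out// addr0.
by rewrite !cell_derivativeE//; apply: deriveD; exact: fe_function_derivable.
Qed.

Lemma cell_derivativeZ v c u x : fe_function u ->
  dd v (fun x => c * u x) x = c * dd v u x.
Proof.
move=> fu; have [[Ox Hx]|rx] := pselect (regular_points x); last first.
  by rewrite !cell_derivative_out// mulr0.
by rewrite !cell_derivativeE//; apply: deriveZ; exact: fe_function_derivable.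
Qed.

Lemma bm_cell_derivative v u : fe_function u -> bounded_measurable (dd v u).
Proof.
move=> fu; have [k Ok] := bounded_set_box bOm.
have mN := measurable_on_planes Hs.
pose A h := cell h `\` on_planes Hs.
have mA h : measurable (A h).
  by apply: measurableD => //; apply: open_measurable_matrix; exact: open_cell.
have bq q : polyfun q -> bounded_measurable (fun x => \1_(@rV_box R n.+1 k) x * q x).
  move=> pq; have [M hM] := polyfun_bounded k pq; split.
    apply: measurable_funM; last exact: measurable_polyfun.
    by apply: measurable_indic; exact: measurable_rV_box.
  exists `|M| => x; rewrite indicE; have [kx|kx] := boolP (x \in rV_box k).
    by rewrite mul1r (le_trans (hM x (set_mem kx)))// ler_norm.
  by rewrite mul0r normr0.
(* The derivative is glued cell by cell over the list [L]. On [A h] it is the derivative of a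
   polynomial, which the indicator of a box containing [Om] makes bounded. *)
suff H (L : seq (seq ('rV[R]_n.+1 * R))) : {subset L <= Cs} ->
    bounded_measurable (fun x => if `[< exists2 h, h \in L & A h x >] then dd v u x else 0).
  have := H Cs (fun _ => id); congr bounded_measurable; apply/funext => x.
  case: asboolP => // nx; rewrite cell_derivative_out// => -[Ox Hx].
  have [h hC hx] : exists2 h, h \in Cs & cell h x by case: mesh => _ _ _; exact.
  by apply: nx; exists h.
elim: L => [|h L IH] sL.
  rewrite (_ : (fun _ => _) = fun=> 0); first exact: bm_cst.
  by apply/funext => x; case: asboolP => // -[].
have hC : h \in Cs by apply: sL; rewrite mem_head.
have {}IH := IH (fun z zL => sL z (@mem_behead _ (h :: L) z zL)).
have [_ _ _ /(_ h hC)[q pq uq]] := fu.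
have [q' pq' qq'] := polyfun_derive v pq.
pose g x := \1_(A h) x * (\1_(@rV_box R n.+1 k) x * q' x) + \1_(~` A h) x *
   (if `[< exists2 h, h \in L & A h x >] then dd v u x else 0).
have bg : bounded_measurable g.
  apply: bmD; apply: bmM => //; try exact: bq.
    exact: bm_indic.
  by apply: bm_indic; exact: measurableC.
move: bg; congr bounded_measurable; apply/funext => x; rewrite /g !indicE in_setC.
have [/set_mem hx|hx] := boolP (x \in A h).
  rewrite mul0r addr0 mul1r; case: asboolP => [_|]; last by case; exists h; rewrite ?mem_head.
  have Ox : Om x by case: mesh => _ _ /(_ h hC)[+ _] _; apply; case: hx.
  rewrite mem_set ?mul1r; last exact: Ok.
  rewrite (cell_derivative_cell v hC uq hx.1 hx.2).
  by apply/esym; exact: derive_val.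
rewrite mul0r add0r mul1r; congr (if _ then _ else _).
apply/asboolP/asboolP => -[h' h'L hx']; exists h' => //; first by rewrite in_cons h'L orbT.
move: h'L; rewrite in_cons => /orP[/eqP h'h|//].
by move: hx; rewrite -h'h mem_set.
Qed.

Section coordinate_lines.
Variable i : 'I_n.+1.
Implicit Types (p q : 'rV[R]_n.+1 * R) (s t a b : R).

Definition crossing (p : 'rV[R]_n.+1 * R) (y : 'rV[R]_n) : R :=
  (p.2 - dotv (col' i p.1) y) / p.1 ord0 i.

Definition crossings (y : 'rV[R]_n) : seq R :=
  undup [seq crossing p y |
    p <- [seq p : 'rV[R]_n.+1 * R <- Hs | p.1 ord0 i != 0]].

(* The lines that meet an edge of the arrangement Hs, or lie in one of its
   hyperplanes, have their base points on these hyperplanes. *)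
Definition bad_planes : seq ('rV[R]_n * R) :=
  [seq q : 'rV[R]_n * R <-
     [seq (col' i p.1, p.2) | p <- [seq p : 'rV[R]_n.+1 * R <- Hs | p.1 ord0 i == 0]] ++
     [seq (col' i (p.1 ord0 i *: q.1 - q.1 ord0 i *: p.1),
           p.1 ord0 i * q.2 - q.1 ord0 i * p.2) |
       p : 'rV[R]_n.+1 * R <- Hs, q : 'rV[R]_n.+1 * R <- Hs] | q.1 != 0].

Lemma bad_planes_proper : proper_planes bad_planes.
Proof. by move=> q; rewrite mem_filter => /andP[]. Qed.

Lemma col'_eq0 (a : 'rV[R]_n.+1) : a ord0 i = 0 -> col' i a = 0 -> a = 0.
Proof.
move=> ai /rowP ca; apply/rowP => k; case: (unliftP i k) => [j|] ->; rewrite !mxE//.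
by have := ca j; rewrite !mxE.
Qed.

Variable y : 'rV[R]_n.
Hypothesis good : ~ on_planes bad_planes y.

Local Notation line t := (ins_rV i (t, y)).

Lemma good_transversal p t : p \in Hs -> dotv p.1 (line t) = p.2 -> p.1 ord0 i != 0.
Proof.
move=> pHs pt; apply/eqP => pi; apply: good; exists (col' i p.1, p.2) => /=.
  rewrite mem_filter mem_cat; apply/andP; split; last first.
    apply/orP; left; apply/mapP; exists p => //.
    by rewrite mem_filter pi eqxx.
  by apply: contra_neq (pH pHs); exact: col'_eq0.
by rewrite -pt dotv_ins_rV pi mul0r add0r.
Qed.

(** Eliminating the [i]-th coordinate from the equations of two nonparallel hyperplanes leaves the
    equation of a proper hyperplane of base points, one of the [bad_planes]. *)
Lemma good_parallel p q t : p \in Hs -> q \in Hs ->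
  dotv p.1 (line t) = p.2 -> dotv q.1 (line t) = q.2 -> parallel p.1 q.1.
Proof.
move=> pHs qHs pt qt; have pi := good_transversal pHs pt.
pose w := p.1 ord0 i *: q.1 - q.1 ord0 i *: p.1.
have wi : w ord0 i = 0 by rewrite !mxE mulrC subrr.
have [w0|w0] := eqVneq w 0.
  exists (q.1 ord0 i / p.1 ord0 i); move/eqP: w0; rewrite subr_eq0 => /eqP w0.
  by rewrite mulrC -scalerA -w0 scalerA mulVf// scale1r.
exfalso; apply: good.
exists (col' i w, p.1 ord0 i * q.2 - q.1 ord0 i * p.2).
  rewrite mem_filter mem_cat; apply/andP; split.
    by apply: contra_neq w0; exact: col'_eq0.
  by apply/orP; right; apply/allpairsP; exists (p, q).
have : dotv w (line t) = p.1 ord0 i * q.2 - q.1 ord0 i * p.2.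
  by rewrite dotvC dotvBr !dotvZr ![dotv (line t) _]dotvC pt qt.
by rewrite dotv_ins_rV wi mul0r add0r.
Qed.

Lemma crossingP p t : p.1 ord0 i != 0 ->
  dotv p.1 (line t) = p.2 <-> t = crossing p y.
Proof.
move=> pi; rewrite dotv_ins_rV /crossing; split=> [<-|->].
  by rewrite addrK mulrC mulKf.
by rewrite mulrC divfK// subrK.
Qed.

Lemma crossingsP t : on_planes Hs (line t) <-> t \in crossings y.
Proof.
rewrite mem_undup; split.
  move=> [p pHs pt]; have pi := good_transversal pHs pt.
  apply/mapP; exists p; first by rewrite mem_filter pi.
  exact/crossingP.
move/mapP => [p]; rewrite mem_filter => /andP[pi pHs] tp; exists p => //.
exact/crossingP.
Qed.

Lemma lineE t : line t = line 0 + t *: delta_mx ord0 i.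
Proof.
apply/rowP => k.
have -> : (line 0 + t *: delta_mx ord0 i) ord0 k = line 0 ord0 k + t * (k == i)%:R.
  by rewrite mxE; congr (_ + _); rewrite !mxE eqxx.
case: (unliftP i k) => [j|] ->.
  by rewrite !ins_rV_lift eq_sym (negPf (neq_lift _ _)) mulr0 addr0.
by rewrite !ins_rV_i eqxx mulr1 add0r.
Qed.

Lemma continuous_ins_line : continuous (fun t : R => line t).
Proof.
by under eq_fun do rewrite lineE; exact: continuous_line.
Qed.

Lemma line_Om a b : (forall t, a < t < b -> t \notin crossings y) ->
  forall s t, a < s < b -> a < t < b -> Om (line s) -> Om (line t).
Proof.
move=> h s t sab tab; rewrite (lineE s) (lineE t).
apply: (@line_no_boundary _ _ _ _ _ [set t | a < t < b]) => //.
- move=> u v /= /andP[au ub] /andP[av vb] w /andP[uw wv]; apply/andP; split.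
    exact: lt_le_trans uw.
  exact: le_lt_trans vb.
move=> w /= wab /bH; rewrite -lineE => /crossingsP; exact/negP/h.
Qed.

(** A cell is left only through one of its faces, and the hyperplane of this face belongs to [Hs],
    so the line would have a crossing there. *)
Lemma line_cell h a b s : h \in Cs -> (forall t, a < t < b -> t \notin crossings y) ->
  a < s < b -> cell h (line s) -> forall t, a < t < b -> cell h (line t).
Proof.
move=> hC hab sab hs t tab p ph; have := hs p ph.
have [p0|p0] := eqVneq p.1 0.
  by rewrite p0 /dotv !big1// => j _; rewrite mxE mul0r.
have pHs : p \in Hs by case: mesh => _ _ /(_ h hC)[_ /(_ p ph p0)] + _; apply.
rewrite !dotv_ins_rV; set b0 := dotv _ y; set c := p.1 ord0 i.
move=> hs'; rewrite ltNge; apply/negP => ht.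
have [c0|c0] := eqVneq c 0; first by move: hs' ht; rewrite c0 !mul0r; lra.
pose r := crossing p y.
have cr : c * r = p.2 - b0 by rewrite /r /crossing mulrC divfK.
have rC : r \in crossings y.
  by rewrite mem_undup; apply/mapP; exists p => //; rewrite mem_filter c0.
have rab : a < r < b.
  move: sab tab => /andP[as_ sb] /andP[at_ tb].
  have [c_gt0|c_lt0|] := ltgtP 0 c; last by move=> /esym/eqP; rewrite (negPf c0).
    have h1 : s < r by rewrite -(ltr_pM2l c_gt0) cr; lra.
    have h2 : r <= t by rewrite -(ler_pM2l c_gt0) cr; lra.
    by apply/andP; split; lra.
  have h1 : r < s by rewrite -(ltr_nM2l c_lt0) cr; lra.
  have h2 : t <= r by rewrite -(ler_nM2l c_lt0) cr; lra.
  by apply/andP; split; lra.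
by move: (hab r rab); rewrite rC.
Qed.

Variable u : 'rV[R]_n.+1 -> R.
Hypothesis fu : fe_function u.

Definition enters s := exists2 e : R, 0 < e & forall t, s < t < s + e -> Om (line t).
Definition leaves s := exists2 e : R, 0 < e & forall t, s - e < t < s -> Om (line t).

(** One-sided limits along the line of [u] cut off outside [Om]. At a boundary point [u] itself has
    a single value, which counts only on the side where the line runs inside the domain. *)
Let Fp s := if `[< enters s >] then u (line s) else 0.
Let Fm s := if `[< leaves s >] then u (line s) else 0.
Let G t := dd (delta_mx ord0 i) u (line t).

Lemma piece_line a b : a < b -> (forall t, a < t < b -> t \notin crossings y) ->
  piece G Fp Fm a b.
Proof.
move=> ab hab; split=> //; pose m := (a + b) / 2.
have mab : a < m < b by rewrite /m; apply/andP; split; lra.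
(* On an interval outside the domain the piece is that of the polynomial 0: [G] vanishes there by
   convention, and the line neither enters at [a] nor leaves at [b]. *)
have [Om_m|nOm] := pselect (Om (line m)); last first.
  have nO t : a < t < b -> ~ Om (line t) by move=> tab /(line_Om hab tab mab).
  exists 0; split.
  - move=> t tab; rewrite deriv0 horner0 /G cell_derivative_out// => -[+ _].
    exact: nO.
  - rewrite horner0 /Fp; case: asboolP => // -[e e0 he].
    exfalso; apply: (nO (a + Num.min (e / 2) ((b - a) / 2))).
      by rewrite ltrDl lt_min !divr_gt0 ?subr_gt0//= -ltrBrDl gt_min; apply/orP; right; lra.
    apply: he; rewrite ltrDl lt_min !divr_gt0 ?subr_gt0//= ltrD2l gt_min.
    by apply/orP; left; lra.
  - rewrite horner0 /Fm; case: asboolP => // -[e e0 he].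
    exfalso; apply: (nO (b - Num.min (e / 2) ((b - a) / 2))).
      rewrite gtrBl lt_min !divr_gt0 ?subr_gt0//= andbT ltrBrDr -ltrBrDl gt_min.
      by apply/orP; right; lra.
    apply: he; rewrite gtrBl lt_min !divr_gt0 ?subr_gt0//= andbT ltrD2l ltrN2 gt_min.
    by apply/orP; left; lra.
have Hm : ~ on_planes Hs (line m) by move/crossingsP; exact/negP/hab.
have [h hC hm] : exists2 h, h \in Cs & cell h (line m) by case: mesh => _ _ _; exact.
have hO t : a < t < b -> Om (line t) by move=> tab; exact: (line_Om hab mab tab).
have hh := line_cell hC hab mab hm.
have [_ cu _ /(_ h hC)[q pq uq]] := fu.
have [P hP] := polyfun_line i y pq.
have uP t : a < t < b -> u (line t) = P.[t].
  by move=> tab; rewrite (uq _ (hh t tab)); exact: (hP t).1.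
(* Both end points are limits of points of [Om], so continuity of [u] on the closure identifies its
   value there with that of [P]. The filter [F] stands for the one-sided limit at either end. *)
have closure_line s (F : set_system R) : ProperFilter F -> F --> nbhs s ->
    (\forall t \near F, a < t < b) -> u (line s) = P.[s].
  move=> PF Fs Fab.
  have cl : closure Om (line s).
    move=> B nB; have : \forall t \near F, B (line t) /\ a < t < b.
      apply: filterI => //; apply: Fs; exact: (@continuous_ins_line s).
    by move=> /filter_ex[t [Bt tab]]; exists (line t); split => //; exact: hO.
  have c1 : u (line t) @[t --> F] --> u (line s).
    move/subspace_continuousP: cu => /(_ _ cl) cu'.
    apply: cvg_trans cu' => A; rewrite /= !nbhs_simpl /within /= => nA.
    have nA' : \forall t \near F, closure Om (line t) -> A (u (line t)).
      by apply: Fs; exact: (@continuous_ins_line s _ nA).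
    apply: (@filterS _ F _ _ _ _ (filterI nA' Fab)) => t [h1 tab]; apply: h1.
    exact: subset_closure (hO t tab).
  have c2 : u (line t) @[t --> F] --> P.[s].
    apply: cvg_trans (near_eq_cvg _) (cvg_trans (cvg_app _ Fs) (@continuous_horner _ P s)).
    by apply: filterS Fab => t tab; exact/esym/uP.
  have E1 := cvg_lim (@Rhausdorff R) c1.
  by rewrite -E1 (cvg_lim (@Rhausdorff R) c2).
exists P; split.
- move=> t tab; rewrite /G (cell_derivative_cell _ hC uq (hh t tab)).
    have [h1 h2] := hP t; rewrite -h2.
    have [q' pq' hq'] := polyfun_derive (delta_mx ord0 i) pq.
    by [].
  by move/crossingsP; exact/negP/hab.
- rewrite /Fp asboolT; last first.
    exists (b - a); first by rewrite subr_gt0.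
    by move=> t; rewrite addrC subrK; exact: hO.
  apply: (closure_line a a^'+); first by move=> A; exact: cvg_within.
  near=> t; apply/andP; split; near: t; first exact: nbhs_right_gt.
  exact: nbhs_right_lt.
- rewrite /Fm asboolT; last first.
    exists (b - a); first by rewrite subr_gt0.
    by move=> t; rewrite opprB addrC subrK; exact: hO.
  apply: (closure_line b b^'-); first by move=> A; exact: cvg_within.
  near=> t; apply/andP; split; near: t; first exact: nbhs_left_gt.
  exact: nbhs_left_lt.
Unshelve. all: by end_near. Qed.

Lemma near_line s e : 0 < e ->
  exists2 r, 0 < r & forall t, `|t - s| < r -> ball (line s) e (line t).
Proof.
move=> e0; have := @continuous_ins_line s (ball (line s) e) (nbhsx_ballx _ _ e0).
move=> /nbhs_ballP[r /= r0 h]; exists r => // t ts.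
by apply: h; rewrite /ball/= distrC.
Qed.

(** Inside [Om] the two limits agree, and off the closure both are 0. At a boundary point of a good
    line all hyperplanes are parallel, so there is exactly one facet, transversal to the line; the
    sign of the [i]-th component of its normal tells whether the line leaves or enters. *)
Lemma jump_line s :
  Fm s - Fp s = \sum_(p <- facets Om Hs)
    \1_(facet Om p) (line s) * (Num.sg (p.1 ord0 i) * u (line s)).
Proof.
have no_facet : (forall p, ~ facet Om p (line s)) ->
    \sum_(p <- facets Om Hs)
      \1_(facet Om p) (line s) * (Num.sg (p.1 ord0 i) * u (line s)) = 0.
  by move=> h; rewrite big1// => p _; rewrite indicE memNset ?mul0r//; exact: h.
have [Os|nOs] := pselect (Om (line s)).
  rewrite no_facet; last first.
    by move=> p /(facet_sub_boundary oOm)[_]; rewrite (iffLR (interior_id _) oOm).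
  have /nbhs_ballP[e /= e0 he] := open_nbhs_nbhs (conj oOm Os).
  have [r r0 hr] := near_line s e0.
  rewrite /Fm /Fp !asboolT ?subrr//; exists r => // t /andP[h1 h2].
    by apply: he; apply: hr; rewrite gtr0_norm; lra.
  by apply: he; apply: hr; rewrite ltr0_norm; lra.
have [cs|ncs] := pselect (closure Om (line s)); last first.
  have [_ _ /(_ _ ncs) us _] := fu.
  rewrite no_facet; last by move=> p /(facet_sub_boundary oOm)[].
  by rewrite /Fm /Fp us !if_same subrr.
have bs : boundary Om (line s) by split => //; rewrite (iffLR (interior_id _) oOm).
have [p pHs ps] := bH bs.
have [c nc] : exists c, is_outward_normal Om (line s) (c *: p.1).
  case: mesh => _ /(_ _ _ bs pHs ps) + _ _; apply => q qHs qs.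
  exact: good_parallel pHs qHs ps qs.
have pi := good_transversal pHs ps.
pose nu := c *: p.1; pose f0 := (nu, dotv nu (line s)).
have f0s : facet Om f0 (line s) by [].
have nui : nu ord0 i != 0.
  rewrite mxE mulf_neq0//; apply: contraPneq nc.1 => ->.
  rewrite scale0r /dotv big1; last by move=> j _; rewrite mxE mul0r.
  by move/eqP; rewrite eq_sym oner_eq0.
rewrite (bigD1_seq f0)//=; [|exact: (facet_in_facets oOm pH bH f0s)|exact: facets_uniq].
rewrite indicE mem_set// mul1r big1 ?addr0; last first.
  move=> q qf0; rewrite indicE memNset ?mul0r// => qs.
  by move: qf0; rewrite (facet_inj qs f0s) eqxx.
have [_ [e e0 he]] := nc; have [r r0 hr] := near_line s e0.
have lineO t : `|t - s| < r -> (Om (line t) <-> nu ord0 i * (t - s) < 0).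
  move=> ts; have := he _ (hr t ts).
  rewrite (lineE t) (lineE s) opprD addrACA subrr add0r -scalerBl dotvZr dotv_delta.
  by rewrite -lineE mulrC.
have [nu_gt0|nu_lt0|] := ltgtP 0 (nu ord0 i); last by move=> /esym/eqP; rewrite (negPf nui).
  rewrite gtr0_sg// mul1r /Fm asboolT; last first.
    exists r => // t /andP[h1 h2]; apply/lineO; first by rewrite ltr0_norm; lra.
    by rewrite pmulr_rlt0//; lra.
  rewrite /Fp; case: asboolP => [[e' e'0 he']|]; last by rewrite subr0.
  exfalso; pose t := s + Num.min (e' / 2) (r / 2).
  have mn : 0 < Num.min (e' / 2) (r / 2) by rewrite lt_min !divr_gt0.
  have : Om (line t).
    apply: he'; rewrite /t ltrDl mn ltrD2l gt_min; apply/orP; left; lra.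
  move/lineO; rewrite /t addrC addKr gtr0_norm// gt_min.
  have -> : (r / 2 < r) by lra.
  by rewrite orbT pmulr_rlt0// => /(_ isT); rewrite ltNge (ltW mn).
rewrite ltr0_sg// mulN1r /Fp asboolT; last first.
  exists r => // t /andP[h1 h2]; apply/lineO; first by rewrite gtr0_norm; lra.
  by rewrite nmulr_rlt0//; lra.
rewrite /Fm; case: asboolP => [[e' e'0 he']|]; last by rewrite sub0r.
exfalso; pose t := s - Num.min (e' / 2) (r / 2).
have mn : 0 < Num.min (e' / 2) (r / 2) by rewrite lt_min !divr_gt0.
have : Om (line t).
  apply: he'; rewrite /t gtrBl mn andbT ltrD2l ltrN2 gt_min; apply/orP; left; lra.
move/lineO; rewrite /t addrAC subrr add0r normrN gtr0_norm// gt_min.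
have -> : (r / 2 < r) by lra.
by rewrite orbT nmulr_rlt0// oppr_gt0 => /(_ isT); rewrite ltNge (ltW mn).
Qed.

Lemma sum_crossings p : p \in facets Om Hs ->
  \sum_(s <- crossings y) \1_(facet Om p) (line s) * (Num.sg (p.1 ord0 i) * u (line s)) =
  Num.sg (p.1 ord0 i) *
    (\1_(facet Om p) (hyperplane_graph p i y) * u (hyperplane_graph p i y)).
Proof.
move=> pF; have [pi|pi] := eqVneq (p.1 ord0 i) 0.
  by rewrite pi sgr0 mul0r big1// => s _; rewrite mul0r mulr0.
have onp s : facet Om p (line s) -> s = crossing p y.
  by move=> [_ ps]; apply/crossingP.
have gE : hyperplane_graph p i y = line (crossing p y).
  by rewrite hyperplane_graphE.
have [gp|gp] := pselect (facet Om p (hyperplane_graph p i y)); last first.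
  rewrite big1 ?indicE ?memNset ?mul0r ?mulr0// => s _.
  rewrite indicE memNset ?mul0r// => ps; apply: gp.
  by rewrite gE -(onp s ps).
have sC : crossing p y \in crossings y.
  apply/crossingsP; rewrite -gE; apply: bH; exact: (facet_sub_boundary oOm gp).
rewrite (bigD1_seq (crossing p y))//=; last exact: undup_uniq.
rewrite -gE big1 ?addr0; first by rewrite mulrCA.
move=> s sp; rewrite indicE memNset ?mul0r// => /onp ps.
by rewrite ps eqxx in sp.
Qed.

Lemma integral_line : \int[lebesgue_measure]_t G t =
  \sum_(p <- facets Om Hs) Num.sg (p.1 ord0 i) *
    (\1_(facet Om p) (hyperplane_graph p i y) * u (hyperplane_graph p i y)).
Proof.
have bG : bounded_measurable (G : measurableTypeR R -> R).
  apply: (bm_comp (@measurable_ins_rV1 R n i y)).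
  exact: bm_cell_derivative.
have [k Ok] := closure_box bOm.
(* [K] exceeds the size of a box around the closure and all crossings, so that [Fp] and [Fm] vanish
   at both ends of the path and only the jumps at the crossings remain. *)
have [K [K0 KC]] : exists K, k%:R < K /\ forall s, s \in crossings y -> - K < s < K.
  exists (k%:R + 1 + \sum_(s <- crossings y) `|s|); split.
    by rewrite -addrA ltrDl ltr_pwDl// sumr_ge0.
  move=> s sC; rewrite -ltr_norml (big_rem s)//= addrCA ltrDl.
  by rewrite -addrA ltr_wpDl// ltr_pwDl// sumr_ge0.
have outside t : k%:R < `|t| -> ~ closure Om (line t).
  move=> kt /Ok /(_ i); rewrite ins_rV_i /= => tk.
  by have := lt_le_trans kt tk; rewrite ltxx.
have u0 t : k%:R < `|t| -> u (line t) = 0.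
  by move=> /outside h; case: fu => _ _ uo _; exact: uo.
have K_gt0 : 0 < K by apply: le_lt_trans K0.
pose S := sort <=%R (crossings y).
have SC s : (s \in S) = (s \in crossings y) by rewrite mem_sort.
have pS : path <%R (- K) (rcons S K).
  rewrite rcons_path; apply/andP; split.
    rewrite path_min_sorted; last first.
      by apply/allP => s; rewrite SC => /KC/andP[].
    by rewrite lt_sorted_uniq_le sort_uniq undup_uniq/= sort_sorted//; exact: le_total.
  have : last (- K) S \in - K :: S by exact: mem_last.
  rewrite in_cons => /orP[/eqP ->|]; first by rewrite gtrN.
  by rewrite SC => /KC/andP[].
have pp : path (fun x y => `[< piece G Fp Fm x y >]) (- K) (rcons S K).
  apply: path_piece => // a b aS bS ab hz; apply: piece_line => // t tab.
  apply/negP => tC; apply: (hz t) => //.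
  by rewrite mem_rcons in_cons SC tC orbT.
have [+ _] := piece_path_integral bG pp.
rewrite last_rcons => E.
have FK : Fp K = 0 by rewrite /Fp u0 ?if_same// gtr0_norm.
have FK' : Fm K = 0 by rewrite /Fm u0 ?if_same// gtr0_norm.
have FNK : Fp (- K) = 0 by rewrite /Fp u0 ?if_same// normrN gtr0_norm.
move: E; rewrite FK FNK subrr add0r -cats1 big_cat /= big_seq1 FK FK' subrr addr0.
move=> E; transitivity (\int[lebesgue_measure]_(t in `[- K, K]) G t).
  rewrite [RHS]Rintegral_mkcond; apply: eq_Rintegral => t _.
  rewrite patchE; case: ifPn => // /negP tK.
  rewrite /G cell_derivative_out// => -[/subset_closure + _].
  apply: outside; apply: (lt_trans K0); rewrite ltNge; apply/negP.
  by rewrite ler_norml => h; apply: tK; rewrite inE /= in_itv.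
rewrite E (perm_big _ (permEl (perm_sort _ _))) /=.
under eq_bigr do rewrite jump_line.
rewrite exchange_big /= big_seq [RHS]big_seq; apply: eq_bigr => p pF.
exact: sum_crossings.
Qed.

End coordinate_lines.
End green.

(** * The divergence theorem, Green's formula and definiteness of the norm *)

Section divergence.
Context (R : realType) (n : nat).
Variables (Om : set 'rV[R]_n.+1) (Hs : seq ('rV[R]_n.+1 * R)).
Variable Cs : seq (seq ('rV[R]_n.+1 * R)).
Hypothesis mesh : polyhedral_mesh Om Hs Cs.
Implicit Types (p : 'rV[R]_n.+1 * R) (u v w : 'rV[R]_n.+1 -> R).

Let oOm : open Om. Proof. by case: mesh => -[]. Qed.
Let bOm : bounded_set Om. Proof. by case: mesh => -[]. Qed.
Let pH : proper_planes Hs. Proof. by case: mesh => -[]. Qed.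
Let bH : boundary Om `<=` on_planes Hs. Proof. by case: mesh => -[]. Qed.

Local Notation dd := (cell_derivative Om Hs).
Local Notation fe_function := (fe_function Om Cs).

Lemma measurable_Om : measurable Om.
Proof. exact: open_measurable_matrix. Qed.

Lemma finite_Om : (lebesgue_rV Om < +oo)%E.
Proof. by apply: bounded_lebesgue_rV_lty => //; exact: measurable_Om. Qed.

(** By [integral_line] almost every line contributes, for each facet that it crosses, the value of
    [u] times the sign of [p_i]. The surface element over this axis is [1/|p_i|], so the sign turns
    into the component [p_i] of the normal. Facets with [p_i = 0] contribute nothing on either
    side. *)
Lemma integral_partial i u : fe_function u ->
  \int[lebesgue_rV]_(x in Om) dd (delta_mx ord0 i) u x =
  \sum_(p <- facets Om Hs) p.1 ord0 i * \int[hyperplane_measure p]_(x in facet Om p) u x.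
Proof.
move=> fu; have bu : bounded_measurable u by case: fu.
have bdd := bm_cell_derivative mesh (delta_mx ord0 i) fu.
have iOm := bm_integrable measurable_Om finite_Om bdd.
have ddE : dd (delta_mx ord0 i) u \_ Om = dd (delta_mx ord0 i) u.
  apply/funext => x; rewrite patchE; case: ifPn => // /negP xO.
  by rewrite cell_derivative_out// => -[Ox _]; apply: xO; rewrite inE.
have iT : lebesgue_rV.-integrable setT (EFin \o dd (delta_mx ord0 i) u).
  by rewrite -ddE -restrict_EFin -integrable_mkcond//; exact: measurable_Om.
rewrite Rintegral_mkcond ddE (Rintegral_ins_rV i iT).
pose F p (y : 'rV[R]_n) := Num.sg (p.1 ord0 i) *
    (\1_(facet Om p) (hyperplane_graph p i y) * u (hyperplane_graph p i y)).
transitivity (\int[lebesgue_rV]_(y in [set: 'rV[R]_n]) \sum_(p <- facets Om Hs) F p y).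
  apply: (eq_Rintegral_off_null (measurable_on_planes (bad_planes Hs i))).
    exact/on_planes_null/bad_planes_proper.
  by move=> y _ gy; rewrite (integral_line mesh gy fu).
have FE p : F p = (fun y => Num.sg (p.1 ord0 i) * u (hyperplane_graph p i y)) \_
    (hyperplane_graph p i @^-1` facet Om p : set 'rV[R]_n).
  apply/funext => y; rewrite /F patchE indicE.
  have [px|px] := boolP (hyperplane_graph p i y \in facet Om p).
    by rewrite mem_set ?mul1r//; exact/set_mem.
  rewrite memNset ?mul0r ?mulr0//= => px'.
  by move: px; rewrite mem_set.
have mG p : measurable (hyperplane_graph p i @^-1` facet Om p : set 'rV[R]_n).
  rewrite -[X in measurable X]setTI; apply: measurable_graph => //.
  exact: measurable_facet.
have bg p : bounded_measurable (fun y : 'rV[R]_n => u (hyperplane_graph p i y)).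
  exact: (bm_comp (@measurable_graph _ _ p i)).
have finG p : p.1 ord0 i != 0 ->
    (lebesgue_rV (hyperplane_graph p i @^-1` facet Om p : set 'rV[R]_n) < +oo)%E.
  move=> pi; have := hyperplane_measure_facet_lty oOm bOm p.
  rewrite (hyperplane_measureE pi); last exact: measurable_facet.
  rewrite ltey; case: (lebesgue_rV _)
    (measure_ge0 lebesgue_rV (hyperplane_graph p i @^-1` facet Om p : set 'rV[R]_n)) => // [s _|].
    by rewrite ltry.
  by move=> _; rewrite gt0_muley ?lte_fin// invr_gt0 normr_gt0.
have iF p : lebesgue_rV.-integrable setT (EFin \o F p).
  have [pi|pi] := eqVneq (p.1 ord0 i) 0.
    rewrite (_ : EFin \o F p = cst 0%E); first exact: integrable0.
    by apply/funext => y; rewrite /F /= pi sgr0 mul0r.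
  rewrite FE -restrict_EFin -integrable_mkcond//.
  apply: bm_integrable => //; first exact: finG.
  exact: bmZ.
rewrite Rintegral_sum//; apply: eq_bigr => p _.
have [pi|pi] := eqVneq (p.1 ord0 i) 0.
  rewrite pi mul0r (_ : F p = fun=> 0).
    by rewrite Rintegral_cst// mul0r.
  by apply/funext => y; rewrite /F pi sgr0 mul0r.
rewrite FE -Rintegral_mkcond bm_RintegralZ//; last exact: finG.
rewrite (Rintegral_hyperplane_measure oOm bOm pi bu) mulrA; congr (_ * _).
by rewrite {2}[p.1 ord0 i]numEsg -mulrA mulfV ?mulr1// normr_eq0.
Qed.

Lemma divergence_theorem beta u : fe_function u ->
  \int[lebesgue_rV]_(x in Om) dd beta u x =
  \int[surface_measure Om]_(x in boundary Om) (dotv beta (outward_normal Om x) * u x).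
Proof.
move=> fu; have bu : bounded_measurable u by case: fu.
have bdd i := bm_cell_derivative mesh (delta_mx ord0 i) fu.
rewrite (Rintegral_surface oOm bOm pH bH (measurable_boundary Om)); last first.
  by apply: bmM => //; exact: (bm_dotv_outward_normal oOm pH bH).
transitivity (\int[lebesgue_rV]_(x in Om)
    \sum_i beta ord0 i * dd (delta_mx ord0 i) u x).
  by apply: eq_Rintegral => x _; exact: (cell_derivative_partial mesh).
rewrite (bm_Rintegral_sum measurable_Om finite_Om); last by move=> i; exact: bmZ.
under eq_bigr => i _ do rewrite (bm_RintegralZ measurable_Om finite_Om _ (bdd i))
  (integral_partial i fu) mulr_sumr.
rewrite exchange_big /=; apply: eq_bigr => p _.
have -> : boundary Om `&` facet Om p = facet Om p.
  by apply/setIidr => x /(facet_sub_boundary oOm).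
transitivity (\int[hyperplane_measure p]_(x in facet Om p) (dotv beta p.1 * u x)).
  rewrite bm_RintegralZ//.
  - by rewrite /dotv mulr_suml; apply: eq_bigr => i _; rewrite mulrA.
  - exact: measurable_facet.
  - exact: hyperplane_measure_facet_lty oOm bOm p.
by apply: eq_Rintegral => x /set_mem px; rewrite (outward_normal_facet px).
Qed.

(** The product of two piecewise polynomials is again one, so the divergence theorem applies to
    [u * w] and the product rule does the rest. *)
Lemma green_identity beta u w : fe_function u -> fe_function w ->
  inner Om (dd beta u) w + inner Om u (dd beta w) = bd_inner Om beta (boundary Om) u w.
Proof.
move=> fu fw; have fuw := fe_functionM fu fw.
have [bu _ _ _] := fu; have [bw _ _ _] := fw.
have bdu := bm_cell_derivative mesh beta fu; have bdw := bm_cell_derivative mesh beta fw.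
rewrite /inner -(bm_RintegralD measurable_Om finite_Om); try exact: bmM.
transitivity (\int[lebesgue_rV]_(x in Om) dd beta (fun x => u x * w x) x).
  apply: eq_Rintegral => x _.
  by rewrite (cell_derivativeM mesh beta x fu fw) addrC.
rewrite divergence_theorem//; apply: eq_Rintegral => x _.
by rewrite mulrA.
Qed.

(** A nonzero value inside [Om] persists on a ball of positive measure. The conclusion reaches all
    points: on the boundary by continuity on the closure, outside because elements are extended by
    0. *)
Lemma fe_function_definite u : fe_function u -> norm2 Om u = 0 -> forall x, u x = 0.
Proof.
move=> [bu cu ou pu] u0.
have near_u x : closure Om x -> u x != 0 ->
    \forall y \near x, closure Om y -> `|u x - u y| < `|u x| / 2.
  move=> cx ux; have ux0 : 0 < `|u x| / 2 by rewrite divr_gt0 ?normr_gt0.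
  move/subspace_continuousP: cu => /(_ x cx) /cvgrPdist_lt /(_ _ ux0).
  by [].
have uO x : Om x -> u x = 0.
  move=> Ox; apply/eqP/negPn/negP => ux.
  have := near_u x (subset_closure Ox) ux.
  move=> /(filterI (open_nbhs_nbhs (conj oOm Ox))) /nbhs_ballP[e /= e0 he].
  have mb : measurable (ball x e) by apply: open_measurable_matrix; exact: ball_open.
  pose c := (`|u x| / 2) ^+ 2.
  have c0 : 0 < c by rewrite exprn_gt0// divr_gt0 ?normr_gt0.
  have : c * \int[lebesgue_rV]_(y in Om) \1_(ball x e) y <= norm2 Om u.
    rewrite -(bm_RintegralZ measurable_Om finite_Om); last exact: bm_indic.
    apply: (bm_le_Rintegral measurable_Om finite_Om).
    - by apply: bmZ; exact: bm_indic.
    - exact: bmM.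
    move=> y Oy; rewrite indicE; have [xy|xy] := pselect (ball x e y); last first.
      by rewrite memNset// mulr0 -expr2 sqr_ge0.
    rewrite mem_set// mulr1 -expr2 -(real_normK (num_real (u y))) /c ler_pXn2r ?nnegrE ?divr_ge0//.
    have /(_ (subset_closure Oy)) h := (he y xy).2.
    have := ler_normD (u x - u y) (u y); rewrite subrK => h2; lra.
  rewrite u0 leNgt; apply/negP; rewrite negbK mulr_gt0//.
  have := integral_indic lebesgue_rV measurable_Om mb.
  have -> : ball x e `&` Om = ball x e by apply/setIidl => y /he[].
  rewrite /Rintegral => ->; apply: fine_gt0; apply/andP; split; first exact: lebesgue_rV_ball_gt0.
  apply: le_lt_trans finite_Om.
  by apply: (@le_measure _ _ _ lebesgue_rV _ _ (mem_set mb) (mem_set measurable_Om)) => y /he[].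
move=> x; have [cx|/ou//] := pselect (closure Om x).
apply/eqP/negPn/negP => ux; have := cx _ (near_u x cx ux).
move=> [y [Oy /(_ (subset_closure Oy))]]; rewrite (uO y Oy) subr0 => h.
have : 0 < `|u x| by rewrite normr_gt0.
by move: h; lra.
Qed.

End divergence.

(** * Product domains and sparse grids *)

Section product_geometry.
Context (R : realType).

Lemma ball_lsubmx n1 n2 (x y : 'rV[R]_(n1 + n2)) e :
  ball x e y -> ball (lsubmx x) e (lsubmx y).
Proof. by case=> e0 h; split => // i j; rewrite !mxE; exact: h. Qed.

Lemma ball_rsubmx n1 n2 (x y : 'rV[R]_(n1 + n2)) e :
  ball x e y -> ball (rsubmx x) e (rsubmx y).
Proof. by case=> e0 h; split => // i j; rewrite !mxE; exact: h. Qed.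

Lemma ball_lrsubmx n1 n2 (x y : 'rV[R]_(n1 + n2)) e :
  ball (lsubmx x) e (lsubmx y) -> ball (rsubmx x) e (rsubmx y) -> ball x e y.
Proof.
move=> [e0 hl] [_ hr]; split => // i j; case: (split_ordP j) => k ->.
  by have := hl i k; rewrite !mxE.
by have := hr i k; rewrite !mxE.
Qed.

Lemma continuous_lsubmx n1 n2 : continuous (@lsubmx R 1 n1 n2).
Proof.
move=> x A /= /nbhs_ballP[e /= e0 he]; apply/nbhs_ballP; exists e => // y xy.
by apply: he; exact: ball_lsubmx.
Qed.

Lemma continuous_rsubmx n1 n2 : continuous (@rsubmx R 1 n1 n2).
Proof.
move=> x A /= /nbhs_ballP[e /= e0 he]; apply/nbhs_ballP; exists e => // y xy.
by apply: he; exact: ball_rsubmx.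
Qed.

Lemma box_bounded n (A : set 'rV[R]_n) k : A `<=` @rV_box R n k -> bounded_set A.
Proof.
move=> Ak; exists k%:R; split; first exact: num_real.
move=> M kM x /Ak kx; suff : `|x| <= M by [].
rewrite [leLHS]/Num.Def.normr/= mx_normrE.
apply: bigmax_le => [|[i j] _]; first by rewrite ltW// (le_lt_trans _ kM).
by rewrite ord1 (le_trans (kx j))// ltW.
Qed.

Variable d : nat.
Implicit Types (Om : set 'rV[R]_d).

Lemma open_product Om1 Om2 : open Om1 -> open Om2 -> open (product_domain Om1 Om2).
Proof.
move=> op1 op2; rewrite (_ : product_domain _ _ =
   (@lsubmx R 1 d d) @^-1` Om1 `&` (@rsubmx R 1 d d) @^-1` Om2)//.
apply: openI; apply: open_comp => // x _.
- exact: continuous_lsubmx.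
- exact: continuous_rsubmx.
Qed.

Lemma bounded_product Om1 Om2 : bounded_set Om1 -> bounded_set Om2 ->
  bounded_set (product_domain Om1 Om2).
Proof.
move=> /bounded_set_box[k1 h1] /bounded_set_box[k2 h2].
apply: (@box_bounded _ _ (maxn k1 k2)) => x [/h1 hl /h2 hr] j.
case: (split_ordP j) => k ->.
  have := hl k; rewrite mxE => /le_trans; apply.
  by rewrite ler_nat leq_maxl.
have := hr k; rewrite mxE => /le_trans; apply.
by rewrite ler_nat leq_maxr.
Qed.

Lemma closure_product Om1 Om2 (x : 'rV[R]_(d + d)) :
  closure (product_domain Om1 Om2) x <-> closure Om1 (lsubmx x) /\ closure Om2 (rsubmx x).
Proof.
split=> [cx|[c1 c2]].
  split=> B nB.
    have [y [[Oy _] By]] := cx _ (@continuous_lsubmx d d x _ nB).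
    by exists (lsubmx y).
  have [y [[_ Oy] By]] := cx _ (@continuous_rsubmx d d x _ nB).
  by exists (rsubmx y).
move=> B /nbhs_ballP[e /= e0 he].
have [y1 [y1O b1]] := c1 _ (nbhsx_ballx (lsubmx x) _ e0).
have [y2 [y2O b2]] := c2 _ (nbhsx_ballx (rsubmx x) _ e0).
exists (row_mx y1 y2); split; first by rewrite /product_domain /= row_mxKl row_mxKr.
by apply: he; apply: ball_lrsubmx; rewrite ?row_mxKl ?row_mxKr.
Qed.

Lemma boundary_product Om1 Om2 x : open Om1 -> open Om2 ->
  boundary (product_domain Om1 Om2) x -> boundary Om1 (lsubmx x) \/ boundary Om2 (rsubmx x).
Proof.
move=> op1 op2 [/closure_product[c1 c2]].
rewrite (iffLR (interior_id _) (open_product op1 op2)) => nx.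
have [Ol|nOl] := pselect (Om1 (lsubmx x)).
  right; split => //; rewrite (iffLR (interior_id _) op2) => Or.
  by apply: nx; split.
by left; split => //; rewrite (iffLR (interior_id _) op1).
Qed.

Definition lift1 (p : 'rV[R]_d * R) : 'rV[R]_(d + d) * R := (row_mx p.1 0, p.2).
Definition lift2 (p : 'rV[R]_d * R) : 'rV[R]_(d + d) * R := (row_mx 0 p.1, p.2).

Lemma dotv_lift1 p x : dotv (lift1 p).1 x = dotv p.1 (lsubmx x).
Proof.
rewrite /dotv /= big_split_ord /= [X in _ + X]big1 ?addr0.
  by apply: eq_bigr => j _; rewrite row_mxEl mxE.
by move=> j _; rewrite row_mxEr mxE mul0r.
Qed.

Lemma dotv_lift2 p x : dotv (lift2 p).1 x = dotv p.1 (rsubmx x).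
Proof.
rewrite /dotv /= big_split_ord /= [X in X + _]big1 ?add0r.
  by apply: eq_bigr => j _; rewrite row_mxEr mxE.
by move=> j _; rewrite row_mxEl mxE mul0r.
Qed.

Lemma lift1_neq0 p : ((lift1 p).1 != 0) = (p.1 != 0).
Proof. by rewrite /= row_mx_eq0 eqxx andbT. Qed.

Lemma lift2_neq0 p : ((lift2 p).1 != 0) = (p.1 != 0).
Proof. by rewrite /= row_mx_eq0 eqxx. Qed.

Lemma lift12_parallel p q : p.1 != 0 -> q.1 != 0 -> ~ parallel (lift1 p).1 (lift2 q).1.
Proof.
move=> p0 q0 [c /= h]; move: q0; rewrite -[q.1](row_mxKr (0 : 'rV[R]_d)) h.
by rewrite linearZ /= row_mxKr scaler0 eqxx.
Qed.

Lemma lift21_parallel p q : p.1 != 0 -> q.1 != 0 -> ~ parallel (lift2 p).1 (lift1 q).1.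
Proof.
move=> p0 q0 [c /= h]; move: q0; rewrite -[q.1](row_mxKl _ (0 : 'rV[R]_d)) h.
by rewrite linearZ /= row_mxKl scaler0 eqxx.
Qed.

Lemma lift1_parallel p q : parallel (lift1 p).1 (lift1 q).1 -> parallel p.1 q.1.
Proof.
move=> [c /= h]; exists c; rewrite -[LHS](row_mxKl _ (0 : 'rV[R]_d)) h.
by rewrite linearZ /= row_mxKl.
Qed.

Lemma lift2_parallel p q : parallel (lift2 p).1 (lift2 q).1 -> parallel p.1 q.1.
Proof.
move=> [c /= h]; exists c; rewrite -[LHS](row_mxKr (0 : 'rV[R]_d)) h.
by rewrite linearZ /= row_mxKr.
Qed.

Lemma outward_normal_product1 Om1 Om2 (x : 'rV[R]_(d + d)) a : open Om2 ->
  is_outward_normal Om1 (lsubmx x) a -> Om2 (rsubmx x) ->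
  is_outward_normal (product_domain Om1 Om2) x (row_mx a 0).
Proof.
move=> op2 [a1 [e e0 he]] Or; have d1 := dotv_lift1 (a, 0); split.
  by rewrite d1 /= row_mxKl.
have /nbhs_ballP[e' /= e'0 he'] := open_nbhs_nbhs (conj op2 Or).
exists (Num.min e e'); first by rewrite lt_min e0.
move=> y xy; rewrite d1 /= linearB /= -he; last first.
  by apply: ball_lsubmx; apply: le_ball xy; rewrite ge_min lexx.
split=> [[] //|Ol]; split=> //; apply: he'; apply: ball_rsubmx.
by apply: le_ball xy; rewrite ge_min lexx orbT.
Qed.

Lemma outward_normal_product2 Om1 Om2 (x : 'rV[R]_(d + d)) a : open Om1 ->
  is_outward_normal Om2 (rsubmx x) a -> Om1 (lsubmx x) ->
  is_outward_normal (product_domain Om1 Om2) x (row_mx 0 a).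
Proof.
move=> op1 [a1 [e e0 he]] Ol; have d2 := dotv_lift2 (a, 0); split.
  by rewrite d2 /= row_mxKr.
have /nbhs_ballP[e' /= e'0 he'] := open_nbhs_nbhs (conj op1 Ol).
exists (Num.min e e'); first by rewrite lt_min e0.
move=> y xy; rewrite d2 /= linearB /= -he; last first.
  by apply: ball_rsubmx; apply: le_ball xy; rewrite ge_min lexx.
split=> [[] //|Or]; split=> //; apply: he'; apply: ball_lsubmx.
by apply: le_ball xy; rewrite ge_min lexx orbT.
Qed.

Definition product_cell (h1 h2 : seq ('rV[R]_d * R)) := map lift1 h1 ++ map lift2 h2.

Lemma product_cellP h1 h2 x : cell (product_cell h1 h2) x <->
  cell h1 (lsubmx x) /\ cell h2 (rsubmx x).
Proof.
split=> [h|[c1 c2] p].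
  split=> p ph.
    by rewrite -dotv_lift1; apply: (h (lift1 p)); rewrite mem_cat map_f.
  by rewrite -dotv_lift2; apply: (h (lift2 p)); rewrite mem_cat map_f// orbT.
by rewrite mem_cat => /orP[] /mapP[q qh ->]; rewrite ?dotv_lift1 ?dotv_lift2;
  [exact: c1|exact: c2].
Qed.

(** The description of a cell may contain half-spaces with normal 0, which define no hyperplane and
    are removed. *)
Definition faces (H : seq ('rV[R]_d * R)) (M : seq (seq ('rV[R]_d * R))) :=
  [seq p <- H ++ flatten M | p.1 != 0].

Lemma closure_cell (h : seq ('rV[R]_d * R)) x p : closure (cell h) x -> p \in h ->
  dotv p.1 x <= p.2.
Proof.
move=> cx ph; pose H := [set y | dotv p.1 y <= p.2].
have : closed H.
  apply: (@closed_comp _ _ (dotv p.1) [set t | t <= p.2]); last exact: closed_le.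
  by move=> y _; exact: continuous_dotv.
move=> /closure_id HE; suff : H x by [].
by rewrite HE; apply: closureS cx => y /(_ p ph); exact: ltW.
Qed.

Lemma mesh_cell Om H M x : is_mesh Om M -> Om x -> ~ on_planes (faces H M) x ->
  exists2 h, h \in M & cell h x.
Proof.
move=> [hM _ cM] Ox Hx; have [h /= hin cx] := cM x Ox; exists h => // p ph.
(* A half-space with normal 0 is everything or empty; it is not empty because the cell is not. *)
have [p0|p0] := eqVneq p.1 0.
  have d0 z : dotv p.1 z = 0 by rewrite p0 /dotv big1// => j _; rewrite mxE mul0r.
  have [[z /(_ p ph) zp] _] := hM h hin.
  by rewrite d0; move: zp; rewrite d0.
rewrite lt_neqAle (closure_cell cx ph) andbT; apply/eqP => px; apply: Hx.
exists p => //; rewrite mem_filter p0 mem_cat; apply/orP; right.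
by apply/flattenP; exists h.
Qed.

End product_geometry.

(** If all hyperplanes through a boundary point of the product are parallel, they come from one
    factor. The component in the other factor is then an interior point, and the normal of the first
    factor, padded by 0, is the normal of the product. *)
Lemma product_polyhedral_mesh (R : realType) d (Om1 Om2 : set 'rV[R]_d) M1 M2 :
  polyhedral_lipschitz_domain Om1 -> polyhedral_lipschitz_domain Om2 ->
  is_mesh Om1 M1 -> is_mesh Om2 M2 ->
  exists Hs, polyhedral_mesh (product_domain Om1 Om2) Hs
    [seq product_cell h1 h2 | h1 <- M1, h2 <- M2].
Proof.
move=> [[op1 _ _ b1] [lip1 [H1 [H1p bH1]]]] [[op2 _ _ b2] [lip2 [H2 [H2p bH2]]]] m1 m2.
pose F1 := faces H1 M1; pose F2 := faces H2 M2.
have F1p : proper_planes F1 by move=> p; rewrite mem_filter => /andP[].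
have F2p : proper_planes F2 by move=> p; rewrite mem_filter => /andP[].
have bF1 : boundary Om1 `<=` on_planes F1.
  by move=> x /bH1[p pH px]; exists p => //; rewrite mem_filter H1p// mem_cat pH.
have bF2 : boundary Om2 `<=` on_planes F2.
  by move=> x /bH2[p pH px]; exists p => //; rewrite mem_filter H2p// mem_cat pH.
pose Hs : seq ('rV[R]_(d + d) * R) := map (@lift1 R d) F1 ++ map (@lift2 R d) F2.
have in1 p : p \in F1 -> lift1 p \in Hs by move=> pF; rewrite mem_cat map_f.
have in2 p : p \in F2 -> lift2 p \in Hs by move=> pF; rewrite mem_cat (map_f _ pF) orbT.
have HsP p : p \in Hs -> (exists2 q, q \in F1 & p = lift1 q) \/ (exists2 q, q \in F2 & p = lift2 q).
  by rewrite mem_cat => /orP[] /mapP[q qF ->]; [left|right]; exists q.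
exists Hs; split.
- split.
  + exact: (open_product op1 op2).
  + exact: (bounded_product b1 b2).
  + move=> p /HsP[] [q qF ->]; first by rewrite lift1_neq0; exact: F1p.
    by rewrite lift2_neq0; exact: F2p.
  + move=> x /(boundary_product op1 op2)[/bF1|/bF2] [p pF px].
      by exists (lift1 p); [exact: in1|rewrite dotv_lift1].
    by exists (lift2 p); [exact: in2|rewrite dotv_lift2].
- move=> x p bx pH px par.
  have [/closure_product[c1 c2] _] := bx.
  (* A hyperplane lifted from the first factor is never parallel to one lifted from the second, so
     they cannot both pass through [x]. *)
  have n12 q1 q2 : q1 \in F1 -> q2 \in F2 -> dotv q1.1 (lsubmx x) = q1.2 ->
      dotv q2.1 (rsubmx x) = q2.2 -> False.
    move=> q1F q2F q1x q2x.
    have par1 : parallel p.1 (lift1 q1).1 by apply: par; [exact: in1|rewrite dotv_lift1].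
    have par2 : parallel p.1 (lift2 q2).1 by apply: par; [exact: in2|rewrite dotv_lift2].
    have [[q qF pE]|[q qF pE]] := HsP p pH; move: par1 par2; rewrite pE => par1 par2.
      exact: lift12_parallel (F1p _ qF) (F2p _ q2F) par2.
    exact: lift21_parallel (F2p _ qF) (F1p _ q1F) par1.
  have [[q qF pE]|[q qF pE]] := HsP p pH.
    have qx : dotv q.1 (lsubmx x) = q.2 by move: px; rewrite pE dotv_lift1.
    have O2 : Om2 (rsubmx x).
      apply: contrapT => nO; have : boundary Om2 (rsubmx x).
        by split => //; rewrite (iffLR (interior_id _) op2).
      by move=> /bF2[q2 q2F q2x]; exact: (n12 q q2).
    have B1 : boundary Om1 (lsubmx x).
      by have [//|/bF2[q2 q2F q2x]] := boundary_product op1 op2 bx; have := n12 q q2 qF q2F qx q2x.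
    have [|c nc] := local_half_space op1 lip1 F1p bF1 B1 qF qx.
      move=> q' q'F q'x; apply: lift1_parallel; rewrite -pE; apply: par; first exact: in1.
      by rewrite dotv_lift1.
    exists c; rewrite pE /= (_ : c *: row_mx q.1 0 = row_mx (c *: q.1) 0).
      exact: outward_normal_product1.
    by rewrite scale_row_mx scaler0.
  have qx : dotv q.1 (rsubmx x) = q.2 by move: px; rewrite pE dotv_lift2.
  have O1 : Om1 (lsubmx x).
    apply: contrapT => nO; have : boundary Om1 (lsubmx x).
      by split => //; rewrite (iffLR (interior_id _) op1).
    by move=> /bF1[q1 q1F q1x]; exact: (n12 q1 q).
  have B2 : boundary Om2 (rsubmx x).
    by have [/bF1[q1 q1F q1x]|//] := boundary_product op1 op2 bx; have := n12 q1 q q1F qF q1x qx.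
  have [|c nc] := local_half_space op2 lip2 F2p bF2 B2 qF qx.
    move=> q' q'F q'x; apply: lift2_parallel; rewrite -pE; apply: par; first exact: in2.
    by rewrite dotv_lift2.
  exists c; rewrite pE /= (_ : c *: row_mx 0 q.1 = row_mx 0 (c *: q.1)).
    exact: outward_normal_product2.
  by rewrite scale_row_mx scaler0.
- move=> h /allpairsP[[h1 h2] /= [h1M h2M ->]]; split.
    move=> x /product_cellP[c1 c2]; split.
      by case: m1 => /(_ h1 h1M)[_ s1] _ _; exact: s1.
    by case: m2 => /(_ h2 h2M)[_ s2] _ _; exact: s2.
  move=> p; rewrite mem_cat => /orP[] /mapP[q qh ->].
    rewrite lift1_neq0 => q0; apply: in1; rewrite mem_filter q0 mem_cat.
    by apply/orP; right; apply/flattenP; exists h1.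
  rewrite lift2_neq0 => q0; apply: in2; rewrite mem_filter q0 mem_cat.
  by apply/orP; right; apply/flattenP; exists h2.
- move=> x [lO rO] Hx.
  have [|h1 h1M c1] := mesh_cell (H := H1) m1 lO.
    by move=> [p pF px]; apply: Hx; exists (lift1 p); [exact: in1|rewrite dotv_lift1].
  have [|h2 h2M c2] := mesh_cell (H := H2) m2 rO.
    by move=> [p pF px]; apply: Hx; exists (lift2 p); [exact: in2|rewrite dotv_lift2].
  exists (product_cell h1 h2); first by apply/allpairsP; exists (h1, h2).
  exact/product_cellP.
Qed.

Section finite_element_functions.
Context (R : realType).

Lemma conforming_bm n (Om : set 'rV[R]_n.+1) (v : 'rV[R]_n.+1 -> R) : bounded_set Om ->
  {within closure Om, continuous v} -> (forall x, ~ closure Om x -> v x = 0) ->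
  bounded_measurable v.
Proof.
move=> bOm cv ov; have mC := measurable_closure_rV Om.
have vE : v = v \_ (closure Om).
  apply/funext => x; rewrite patchE; case: ifPn => // /negP cx.
  by apply: ov => ?; apply: cx; rewrite inE.
split.
  rewrite vE; apply: (iffLR (measurable_restrictT v mC)).
  move=> mD; apply: (measurability _ (RGenOpens.measurableE R)) mD.
  move=> _ [_ [a [b ->] <-]].
  have : open (v @^-1` `]a, b[%classic : set (subspace (closure Om))).
    by move/continuousP: cv; apply; exact: interval_open.
  move=> /open_subspaceP[V oV VE].
  have : measurable (V `&` closure Om).
    by apply: measurableI => //; exact: open_measurable_matrix.
  by rewrite VE setIC.
have [k Ok] := closure_box bOm.
have cC : compact (closure Om).
  by apply: bounded_closed_compact; [exact: box_bounded Ok|exact: closed_closure].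
have := compact_bounded (continuous_compact cv cC).
move=> [M [_ hM]]; exists (`|M| + 1) => x.
have M1 : M < `|M| + 1 by rewrite ltr_pwDr// ler_norm.
have [cx|/ov ->] := pselect (closure Om x); first by apply: (hM _ M1); exists x.
by rewrite normr0 addr_ge0.
Qed.

Lemma measurable_lsubmx n1 n2 : measurable_fun setT (@lsubmx R 1 n1 n2).
Proof.
apply: measurable_fun_matrix => i j; under eq_fun do rewrite mxE.
exact: measurable_coord.
Qed.

Lemma measurable_rsubmx n1 n2 : measurable_fun setT (@rsubmx R 1 n1 n2).
Proof.
apply: measurable_fun_matrix => i j; under eq_fun do rewrite mxE.
exact: measurable_coord.
Qed.

Lemma fe_function_tensor d (Om1 Om2 : set 'rV[R]_d.+1) M1 M2 k1 k2 a b :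
  bounded_set Om1 -> bounded_set Om2 ->
  conforming Om1 a -> piecewise_polynomial k1 M1 a ->
  conforming Om2 b -> piecewise_polynomial k2 M2 b ->
  fe_function (product_domain Om1 Om2) [seq product_cell h1 h2 | h1 <- M1, h2 <- M2]
    (fun x => a (lsubmx x) * b (rsubmx x)).
Proof.
move=> b1 b2 [_ ca oa] pa [_ cb ob] pb; split.
- apply: bmM.
    exact: (bm_comp (@measurable_lsubmx _ _) (conforming_bm b1 ca oa)).
  exact: (bm_comp (@measurable_rsubmx _ _) (conforming_bm b2 cb ob)).
- apply/subspace_continuousP => x /[dup] /closure_product[c1 c2] cx.
  have ca' : a (lsubmx y) @[y --> within (closure (product_domain Om1 Om2)) (nbhs x)] --> a (lsubmx x).
    move/subspace_continuousP: ca => /(_ _ c1); apply: cvg_trans => A /=.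
    rewrite !nbhs_simpl /within /= => nA.
    have := @continuous_lsubmx R d.+1 d.+1 x _ nA; rewrite nbhs_simpl /=.
    apply: filterS => y h cy; apply: h.
    exact: (iffLR (closure_product _ _ _) cy).1.
  have cb' : b (rsubmx y) @[y --> within (closure (product_domain Om1 Om2)) (nbhs x)] --> b (rsubmx x).
    move/subspace_continuousP: cb => /(_ _ c2); apply: cvg_trans => A /=.
    rewrite !nbhs_simpl /within /= => nA.
    have := @continuous_rsubmx R d.+1 d.+1 x _ nA; rewrite nbhs_simpl /=.
    apply: filterS => y h cy; apply: h.
    exact: (iffLR (closure_product _ _ _) cy).2.
  exact: cvgM.
- move=> x nx; have [c1|/oa ->] := pselect (closure Om1 (lsubmx x)); last by rewrite mul0r.
  have [c2|/ob ->] := pselect (closure Om2 (rsubmx x)); last by rewrite mulr0.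
  by case: nx; exact: (iffRL (closure_product _ _ _) (conj c1 c2)).
- move=> h /allpairsP[[h1 h2] /= [h1M h2M ->]].
  have [q1 /is_polynomial_polyfun pq1 aq] := pa h1 h1M.
  have [q2 /is_polynomial_polyfun pq2 bq] := pb h2 h2M.
  exists (fun x => q1 (lsubmx x) * q2 (rsubmx x)).
    by apply: polyfun_mul; [exact: polyfun_lsubmx|exact: polyfun_rsubmx].
  by move=> x /product_cellP[/aq -> /bq ->].
Qed.

Lemma fe_spaces_nested d (Om : set 'rV[R]_d) V l k :
  finite_element_spaces Om V -> (1 <= l)%N -> V l `<=` V (l + k)%N.
Proof.
move=> [_ [nest _]] l1; elim: k => [|k IH]; first by rewrite addn0.
rewrite addnS => v /IH; apply: nest.
by rewrite (leq_trans l1)// leq_addr.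
Qed.

(** In each tensor product both levels, [l] and [L + 1 - l], are at most [L]. By nestedness all
    summands are piecewise polynomial on the one product mesh of level [L]. *)
Lemma sparse_grid_fe_function d (Om1 Om2 : set 'rV[R]_d.+1) V1 V2 L :
  polyhedral_lipschitz_domain Om1 -> polyhedral_lipschitz_domain Om2 ->
  finite_element_spaces Om1 V1 -> finite_element_spaces Om2 V2 -> (1 <= L)%N ->
  exists Hs Cs, polyhedral_mesh (product_domain Om1 Om2) Hs Cs /\
    forall v, sparse_grid V1 V2 L v -> fe_function (product_domain Om1 Om2) Cs v.
Proof.
move=> P1 P2 F1 F2 L1.
have [[M1 [U1 [k1 C1]]] _] := F1; have [[M2 [U2 [k2 C2]]] _] := F2.
have m1 : is_mesh Om1 (M1 L) by case: U1 => + _ _; apply.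
have m2 : is_mesh Om2 (M2 L) by case: U2 => + _ _; apply.
have [Hs mesh] := product_polyhedral_mesh P1 P2 m1 m2.
exists Hs; eexists; split; first exact: mesh.
move=> v [w hw ->].
have -> : (fun x => \sum_(1 <= l < L.+1) w l x) =
    (fun x => \sum_(l <- [seq l <- index_iota 1 L.+1 | (1 <= l <= L)%N]) w l x).
  apply/funext => x; rewrite big_filter [LHS]big_nat_cond [RHS]big_nat_cond.
  by apply: eq_bigl => l; rewrite ltnS; case: (1 <= l <= L)%N.
have := filter_all (fun l => 1 <= l <= L)%N (index_iota 1 L.+1).
elim: [seq l <- index_iota 1 L.+1 | (1 <= l <= L)%N] => [_|l s IH /= /andP[lL als]].
  rewrite (_ : (fun _ => _) = fun=> 0); first exact: fe_function0.
  by apply/funext => x; rewrite big_nil.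
rewrite (_ : (fun _ => _) = fun x => w l x + \sum_(j <- s) w j x); last first.
  by apply/funext => x; rewrite big_cons.
apply: fe_functionD; last exact: IH.
have /andP[l1 lL'] := lL.
have [n [a [b [aV bV ->]]]] := hw l lL; apply: fe_function_sum => i.
have aVL : V1 L (a i).
  by have := @fe_spaces_nested _ _ _ l (L - l) F1 l1 _ (aV i); rewrite subnKC.
have l2 : (1 <= L.+1 - l)%N by rewrite subn_gt0.
have bVL : V2 L (b i).
  have := @fe_spaces_nested _ _ _ _ l.-1 F2 l2 _ (bV i).
  by rewrite subSn// addSnnS prednK// subnK.
have [ca pa] := C1 L _ L1 aVL; have [cb pb] := C2 L _ L1 bVL.
by apply: (fe_function_tensor (k1 := k1) (k2 := k2)) => //; [case: P1 => -[]|case: P2 => -[]].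
Qed.

End finite_element_functions.

(** * Finitely generated spaces of functions *)

Section finite_span.
Context (R : realType) (T : Type).
Implicit Types V W : set (T -> R).

(** Generators are used in place of a basis, as they carry over to sums and tensor products without
    any selection. The price is a possibly singular linear system, which [solvable_of_kernel]
    handles. *)
Definition finite_span V := exists (I : finType) (b : I -> T -> R),
  V = [set v | exists a : I -> R, v = fun x => \sum_i a i * b i x].

Lemma finite_spanP V : finite_span V ->
  [/\ V (fun=> 0), forall u v, V u -> V v -> V (fun x => u x + v x) &
      forall c u, V u -> V (fun x => c * u x)].
Proof.
move=> [I [b ->]]; split.
- by exists (fun=> 0); apply/funext => x; rewrite big1// => i _; rewrite mul0r.
- move=> u v [a ->] [a' ->]; exists (fun i => a i + a' i); apply/funext => x.
  by rewrite -big_split; apply: eq_bigr => i _; rewrite mulrDl.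
- move=> c u [a ->]; exists (fun i => c * a i); apply/funext => x.
  by rewrite mulr_sumr; apply: eq_bigr => i _; rewrite mulrA.
Qed.

Lemma finite_span_sum V I (s : seq I) (F : I -> T -> R) : finite_span V ->
  (forall i, V (F i)) -> V (fun x => \sum_(i <- s) F i x).
Proof.
move=> /finite_spanP[V0 VD _] VF; elim: s => [|i s IH].
  by under eq_fun do rewrite big_nil.
by under eq_fun do rewrite big_cons; exact: VD.
Qed.

Lemma finite_span0 : finite_span [set (fun=> 0 : R) : T -> R].
Proof.
exists void, (fun=> fun=> 0); apply/seteqP; split => v /=.
  by move=> ->; exists (fun=> 0); apply/funext => x; rewrite big1// => -[].
by move=> [a ->]; apply/funext => x; rewrite big1// => -[].
Qed.

Lemma finite_span_add V W : finite_span V -> finite_span W ->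
  finite_span [set v | exists u w, [/\ V u, W w & v = fun x => u x + w x]].
Proof.
move=> [I [b ->]] [J [c ->]].
exists (I + J)%type, (fun k => match k with inl i => b i | inr j => c j end).
apply/seteqP; split => v /=.
  move=> [u [w [[a ->] [a' ->] ->]]].
  exists (fun k => match k with inl i => a i | inr j => a' j end).
  by apply/funext => x; rewrite big_sumType.
move=> [a ->].
exists (fun x => \sum_i a (inl i) * b i x), (fun x => \sum_j a (inr j) * c j x).
split; [by exists (a \o inl)|by exists (a \o inr)|].
by apply/funext => x; rewrite big_sumType.
Qed.

Lemma finite_span_level_sum (E : nat -> set (T -> R)) K :
  (forall l, (1 <= l <= K)%N -> finite_span (E l)) ->
  finite_span [set v | exists2 w : nat -> T -> R,
    forall l, (1 <= l <= K)%N -> E l (w l) & v = fun x => \sum_(1 <= l < K.+1) w l x].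
Proof.
elim: K => [|K IH] EK.
  rewrite (_ : [set v | _] = [set (fun=> 0 : R) : T -> R]); first exact: finite_span0.
  apply/seteqP; split => v /=.
    by move=> [w _ ->]; apply/funext => x; rewrite big_geq.
  move=> ->; exists (fun=> fun=> 0); first by move=> l; case: l.
  by apply/funext => x; rewrite big_geq.
have := finite_span_add (IH _) (EK K.+1 _).
rewrite ltn0Sn leqnn => /(_ _ isT); case.
  by move=> l /andP[l1 lK]; apply: EK; rewrite l1 (leq_trans lK).
move=> I [b SE]; exists I, b; rewrite -SE; apply/seteqP; split => v /=.
  move=> [w hw ->]; exists (fun x => \sum_(1 <= l < K.+1) w l x), (w K.+1); split.
  - by exists w => // l /andP[l1 lK]; apply: hw; rewrite l1 (leq_trans lK).
  - by apply: hw; rewrite ltn0Sn leqnn.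
  - by apply/funext => x; rewrite big_nat_recr.
move=> [u [w' [[w hw ->] hw' ->]]].
exists (fun l => if l == K.+1 then w' else w l).
  move=> l /andP[l1 lK]; case: eqP => [->//|lK']; apply: hw.
  by rewrite l1 -ltnS ltn_neqAle lK andbT; exact/eqP.
apply/funext => x; rewrite [RHS]big_nat_recr// eqxx; congr (_ + _).
by apply: eq_big_nat => l /andP[_ lK]; rewrite ltn_eqF.
Qed.

End finite_span.

Lemma has_dim_finite_span (R : realType) d (V : set ('rV[R]_d -> R)) n :
  has_dim V n -> finite_span V.
Proof. by move=> [b [_ ->]]; exists 'I_n, b. Qed.

Lemma finite_span_tensor (R : realType) d (V W : set ('rV[R]_d -> R)) :
  finite_span V -> finite_span W -> finite_span (tensor_space V W).
Proof.
move=> [I [b VE]] [J [c WE]].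
exists (I * J)%type, (fun k x => b k.1 (lsubmx x) * c k.2 (rsubmx x)).
apply/seteqP; split => v.
  move=> [n [f [g [Vf Wg ->]]]].
  have /choice[al hal] : forall i, exists a : I -> R, f i = fun x => \sum_i a i * b i x.
    by move=> i; have := Vf i; rewrite VE.
  have /choice[ga hga] : forall i, exists a : J -> R, g i = fun x => \sum_i a i * c i x.
    by move=> i; have := Wg i; rewrite WE.
  exists (fun k => \sum_(i < n) al i k.1 * ga i k.2); apply/funext => x.
  under [RHS]eq_bigr do rewrite mulr_suml.
  rewrite exchange_big; apply: eq_bigr => i _.
  rewrite hal hga big_distrlr /= pair_big /=; apply: eq_bigr => k _.
  by rewrite mulrACA.
move=> [a ->].
exists #|I|, (fun k => b (enum_val k)),
  (fun k x => \sum_j a (enum_val k, j) * c j x); split.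
- move=> k; rewrite VE; exists (fun i => (i == enum_val k)%:R).
  apply/funext => x; rewrite (bigD1 (enum_val k))//= eqxx mul1r big1 ?addr0// => i ik.
  by rewrite (negPf ik) mul0r.
- by move=> k; rewrite WE; exists (fun j => a (enum_val k, j)).
apply/funext => x.
pose F i := b i (lsubmx x) * \sum_j a (i, j) * c j (rsubmx x).
transitivity (\sum_(i in I) F i); last by rewrite (big_enum_val F).
rewrite /F big_mkcond /=; under [RHS]eq_bigr do rewrite mulr_sumr.
rewrite pair_big /=; apply: eq_bigr => -[i j] _ /=.
by rewrite mulrCA.
Qed.

Lemma sparse_grid_finite_span (R : realType) d (Om1 Om2 : set 'rV[R]_d) V1 V2 L :
  finite_element_spaces Om1 V1 -> finite_element_spaces Om2 V2 ->
  finite_span (sparse_grid V1 V2 L).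
Proof.
move=> [_ [_ [n1 [D1 _]]]] [_ [_ [n2 [D2 _]]]].
apply: (@finite_span_level_sum R _ (fun l => tensor_space (V1 l) (V2 (L.+1 - l)%N))).
move=> l /andP[l1 lL]; apply: finite_span_tensor.
  exact: has_dim_finite_span (D1 l l1).
by apply: has_dim_finite_span (D2 _ _); rewrite subn_gt0.
Qed.

(** * Polynomials in time *)

Section time_polynomials.
Context (R : realType) d (T : measurableType d).

(** Pairs of a polynomial in time with bounded measurable coefficients and its time derivative.
    Carrying the derivative along avoids differentiation under the integral sign. *)
Inductive time_poly : (R -> T -> R) -> (R -> T -> R) -> Prop :=
| time_poly_cst f : bounded_measurable f -> time_poly (fun _ => f) (fun _ _ => 0)
| time_poly_t W W' : time_poly W W' ->
    time_poly (fun t x => t * W t x) (fun t x => W t x + t * W' t x)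
| time_poly_add W1 W1' W2 W2' : time_poly W1 W1' -> time_poly W2 W2' ->
    time_poly (fun t x => W1 t x + W2 t x) (fun t x => W1' t x + W2' t x).

Lemma time_poly_bm W W' t : time_poly W W' -> bounded_measurable (W t).
Proof.
elim=> [f //|W1 W1' _ IH|W1 W1' W2 W2' _ IH1 _ IH2]; first exact: bmZ.
exact: bmD.
Qed.

Lemma time_poly_deriv W W' : time_poly W W' -> exists W'', time_poly W' W''.
Proof.
elim=> [f bf|W1 W1' tW [W'' hW]|W1 W1' W2 W2' _ [V1 h1] _ [V2 h2]].
- by exists (fun _ _ => 0); apply: (@time_poly_cst (fun=> 0)); exact: bm_cst.
- eexists; exact: time_poly_add tW (time_poly_t hW).
- eexists; exact: time_poly_add h1 h2.
Qed.

Lemma time_poly_weight w W W' : bounded_measurable w -> time_poly W W' ->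
  time_poly (fun t x => w x * W t x) (fun t x => w x * W' t x).
Proof.
move=> bw; elim=> [f bf|W1 W1' _ IH|W1 W1' W2 W2' _ IH1 _ IH2].
- rewrite (_ : (fun _ _ => w _ * 0) = fun _ _ => 0).
    by apply: (@time_poly_cst (fun x => w x * f x)); exact: bmM.
  by apply/funext => t; apply/funext => x; rewrite mulr0.
- rewrite (_ : (fun t x => w x * (t * _)) = (fun t x => t * (w x * W1 t x))).
    rewrite (_ : (fun t x => w x * (_ + _)) =
      (fun t x => w x * W1 t x + t * (w x * W1' t x))); first exact: time_poly_t.
    by apply/funext => t; apply/funext => x; ring.
  by apply/funext => t; apply/funext => x; ring.
- rewrite (_ : (fun t x => w x * (W1 t x + _)) =
      (fun t x => w x * W1 t x + w x * W2 t x)).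
    rewrite (_ : (fun t x => w x * (W1' t x + _)) =
      (fun t x => w x * W1' t x + w x * W2' t x)); first exact: time_poly_add.
    by apply/funext => t; apply/funext => x; ring.
  by apply/funext => t; apply/funext => x; ring.
Qed.

Lemma time_polyZ c W W' : time_poly W W' ->
  time_poly (fun t x => c * W t x) (fun t x => c * W' t x).
Proof. by apply: (@time_poly_weight (fun=> c)); exact: bm_cst. Qed.

Lemma time_poly_sum I (s : seq I) (W W' : I -> R -> T -> R) :
  (forall i, time_poly (W i) (W' i)) ->
  time_poly (fun t x => \sum_(i <- s) W i t x) (fun t x => \sum_(i <- s) W' i t x).
Proof.
move=> h; elim: s => [|i s IH].
  have E (V : I -> R -> T -> R) : (fun t x => \sum_(i <- [::]) V i t x) = fun _ _ => 0.
    by apply/funext => t; apply/funext => x; rewrite big_nil.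
  rewrite !E.
  by apply: (@time_poly_cst (fun=> 0)); exact: bm_cst.
rewrite (_ : (fun t x => _) = fun t x => W i t x + \sum_(j <- s) W j t x); last first.
  by apply/funext => t; apply/funext => x; rewrite big_cons.
rewrite [X in time_poly _ X](_ : _ = fun t x => W' i t x + \sum_(j <- s) W' j t x); last first.
  by apply/funext => t; apply/funext => x; rewrite big_cons.
exact: time_poly_add.
Qed.

Lemma time_poly_monomial f k : bounded_measurable f ->
  time_poly (fun t x => t ^+ k * f x) (fun t x => k%:R * t ^+ k.-1 * f x).
Proof.
move=> bf; elim: k => [|k IH].
  rewrite (_ : (fun t x => t ^+ 0 * f x) = fun _ => f); last first.
    by apply/funext => t; apply/funext => x; rewrite expr0 mul1r.
  rewrite [X in time_poly _ X](_ : _ = fun _ _ => 0); first exact: time_poly_cst.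
  by apply/funext => t; apply/funext => x; rewrite !mul0r.
rewrite (_ : (fun t x => t ^+ k.+1 * f x) = fun t x => t * (t ^+ k * f x)); last first.
  by apply/funext => t; apply/funext => x; rewrite exprS mulrA.
rewrite [X in time_poly _ X](_ : _ =
   fun t x => t ^+ k * f x + t * (k%:R * t ^+ k.-1 * f x)); first exact: time_poly_t.
apply/funext => t; apply/funext => x /=; case: k {IH} => [|k] /=.
  by rewrite expr0 !mul0r mulr0 addr0 !mul1r.
by rewrite exprS -natr1; ring.
Qed.

Variables (nu : {measure set T -> \bar R}) (D : set T).
Hypotheses (mD : measurable D) (finD : (nu D < +oo)%E).

Let ip u v := \int[nu]_(x in D) (u x * v x).

(** Double induction on the two constructions: bilinearity of the integral reduces the product rule
    to the one for multiplication by [t]. As [nu] is arbitrary, the lemma serves the domain as well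
    as its boundary. *)
Lemma time_poly_inner W1 W1' W2 W2' : time_poly W1 W1' -> time_poly W2 W2' ->
  exists P : {poly R}, forall t, ip (W1 t) (W2 t) = P.[t] /\
    ip (W1' t) (W2 t) + ip (W1 t) (W2' t) = P^`().[t].
Proof.
have ipD u v w : bounded_measurable u -> bounded_measurable v -> bounded_measurable w ->
    ip (fun x => u x + v x) w = ip u w + ip v w.
  move=> bu bv bw; rewrite /ip -(bm_RintegralD mD finD); try exact: bmM.
  by apply: eq_Rintegral => x _; rewrite mulrDl.
have ipZ c u w : bounded_measurable u -> bounded_measurable w ->
    ip (fun x => c * u x) w = c * ip u w.
  move=> bu bw; rewrite /ip -(bm_RintegralZ mD finD); last exact: bmM.
  by apply: eq_Rintegral => x _; rewrite mulrA.
have ipC u w : ip u w = ip w u.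
  by apply: eq_Rintegral => x _; rewrite mulrC.
have ip0 w : ip (fun=> 0) w = 0.
  rewrite /ip; under eq_Rintegral do rewrite mul0r.
  by rewrite Rintegral_cst// mul0r.
move=> h1 h2; elim: h1 => {W1 W1'} [f bf|W1 W1' tW1 [P hP]|W1 W1' V1 V1' tW1 [P hP] tV1 [Q hQ]].
- elim: h2 => {W2 W2'} [g bg|W2 W2' tW2 [P hP]|W2 W2' V2 V2' tW2 [P hP] tV2 [Q hQ]].
  + exists (ip f g)%:P => t; rewrite hornerC derivC horner0; split => //.
    by rewrite ip0 (ipC f) ip0 addr0.
  + have [W2'' tW2'] := time_poly_deriv tW2.
    have b2 t := time_poly_bm t tW2; have b2' t := time_poly_bm t tW2'.
    exists ('X * P) => t; have [h1 h2] := hP t.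
    rewrite derivM derivX mul1r hornerD !hornerM hornerX -h1 -h2 !ip0 !add0r.
    rewrite (ipC f) ipZ// (ipC _ f); split => //.
    by rewrite (ipC f) ipD ?ipZ//; [rewrite !(ipC f)|exact: bmZ].
  + have [W2'' tW2'] := time_poly_deriv tW2; have [V2'' tV2'] := time_poly_deriv tV2.
    have b2 t := time_poly_bm t tW2; have b2' t := time_poly_bm t tW2'.
    have b3 t := time_poly_bm t tV2; have b3' t := time_poly_bm t tV2'.
    exists (P + Q) => t; have [h1 h2] := hP t; have [h3 h4] := hQ t.
    rewrite derivD !hornerD -h1 -h2 -h3 -h4 !ip0 !add0r; split.
      by rewrite (ipC f) ipD// !(ipC f).
    by rewrite (ipC f) ipD// !(ipC f).
- have [W1'' tW1'] := time_poly_deriv tW1; have [W2'' tW2'] := time_poly_deriv h2.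
  have b1 t := time_poly_bm t tW1; have b1' t := time_poly_bm t tW1'.
  have b2 t := time_poly_bm t h2; have b2' t := time_poly_bm t tW2'.
  exists ('X * P) => t; have [h3 h4] := hP t.
  rewrite derivM derivX mul1r hornerD !hornerM hornerX -h3 -h4 ipZ//; split => //.
  by rewrite ipD ?ipZ//; [ring|exact: bmZ].
- have [W1'' tW1'] := time_poly_deriv tW1; have [V1'' tV1'] := time_poly_deriv tV1.
  have [W2'' tW2'] := time_poly_deriv h2.
  have b1 t := time_poly_bm t tW1; have b1' t := time_poly_bm t tW1'.
  have b3 t := time_poly_bm t tV1; have b3' t := time_poly_bm t tV1'.
  have b2 t := time_poly_bm t h2; have b2' t := time_poly_bm t tW2'.
  exists (P + Q) => t; have [h3 h4] := hP t; have [h5 h6] := hQ t.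
  rewrite derivD !hornerD -h3 -h4 -h5 -h6 !ipD//; split => //.
  by ring.
Qed.

End time_polynomials.

Lemma poly_primitive (R : realType) (P : {poly R}) : exists Q : {poly R}, Q^`() = P.
Proof.
exists (\poly_(k < (size P).+1) (P`_k.-1 / k%:R)).
apply/polyP => k; rewrite coef_deriv coef_poly ltnS.
case: ltnP => kP; last by rewrite mul0rn nth_default.
have h : (k.+1%:R : R) != 0 by rewrite pnatr_eq0.
transitivity (P`_k / k.+1%:R * k.+1%:R); first by rewrite mulr_natr.
by rewrite divfK.
Qed.

(** * Integrals of polynomials over time slabs *)

Section slab_integrals.
Context (R : realType).

Definition polynomial_in_t (F : R -> R) := exists P : {poly R}, forall t, F t = P.[t].

Lemma polynomial_in_tD F G : polynomial_in_t F -> polynomial_in_t G ->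
  polynomial_in_t (fun t => F t + G t).
Proof. by move=> [P hP] [Q hQ]; exists (P + Q) => t; rewrite hornerD hP hQ. Qed.

Lemma polynomial_in_tZ c F : polynomial_in_t F -> polynomial_in_t (fun t => c * F t).
Proof. by move=> [P hP]; exists (c *: P) => t; rewrite hornerZ hP. Qed.

Lemma polynomial_in_tN F : polynomial_in_t F -> polynomial_in_t (fun t => - F t).
Proof. by move=> [P hP]; exists (- P) => t; rewrite hornerN hP. Qed.

Variables (tn : nat -> R) (j : nat).
Local Notation mu := (@lebesgue_measure R).

Lemma slabE : slab tn j = `]tn j.-1, tn j[%classic.
Proof. by apply/seteqP; split => t; rewrite /slab /= in_itv. Qed.

Lemma measurable_slab : measurable (slab tn j : set (measurableTypeR R)).
Proof. by rewrite slabE; exact: measurable_itv. Qed.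

Lemma integrable_slab F : polynomial_in_t F -> mu.-integrable (slab tn j) (EFin \o F).
Proof.
move=> [P hP]; rewrite slabE (_ : F = horner P); last exact/funext.
apply: integrableS (integrable_horner P (tn j.-1) (tn j)).
- exact: measurable_itv.
- exact: measurable_itv.
- exact: subset_itv_oo_cc.
Qed.

Lemma integral_slab_deriv P : tn j.-1 < tn j ->
  \int[mu]_(t in slab tn j) P^`().[t] = P.[tn j] - P.[tn j.-1].
Proof.
move=> tj; rewrite -integral_deriv_poly// slabE.
have iP := integrable_horner P^`() (tn j.-1) (tn j).
rewrite Rintegral_itv_obnd_cbnd; last first.
  by apply: integrableS iP => //; exact: subset_itv_oo_cc.
rewrite Rintegral_itv_bndo_bndc//.
by apply: integrableS iP => //; exact: subset_itv_co_cc.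
Qed.

Lemma integral_slab_cst c : tn j.-1 < tn j ->
  \int[mu]_(t in slab tn j) c = c * (tn j - tn j.-1).
Proof.
move=> tj; have := integral_slab_deriv (c *: 'X) tj.
rewrite derivZ derivX !hornerZ !hornerX -mulrBr => <-.
by apply: eq_Rintegral => t _; rewrite hornerZ hornerC mulr1.
Qed.

Lemma poly_zero_on_segment (P : {poly R}) a b : a < b ->
  (forall t, a <= t <= b -> P.[t] = 0) -> P = 0.
Proof.
move=> ab P0; apply/eqP/negPn/negP => Pn0.
pose rs := [seq a + (b - a) / k.+1%:R | k <- iota 0 (size P)].
have : (size rs < size P)%N.
  apply: max_poly_roots => //.
    apply/allP => _ /mapP[k _ ->]; apply/rootP; apply: P0.
    rewrite lerDl divr_ge0 ?subr_ge0 ?(ltW ab)//= -lerBrDl.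
    by rewrite ler_pdivrMr// ler_pMr ?subr_gt0// ler1n.
  rewrite map_inj_uniq ?iota_uniq// => k l /addrI /mulfI.
  rewrite subr_eq0 gt_eqF// => /(_ isT) /invr_inj /eqP.
  by rewrite eqr_nat => /eqP[].
by rewrite size_map size_iota ltnn.
Qed.

(** A primitive of [F] is nondecreasing with equal values at both ends of the slab, hence constant
    on the slab and so constant as a polynomial. This is why [F] vanishes at all times. *)
Lemma polynomial_integral_eq0 F : tn j.-1 < tn j -> polynomial_in_t F ->
  (forall t, 0 <= F t) -> \int[mu]_(t in slab tn j) F t = 0 -> forall t, F t = 0.
Proof.
move=> tj [P hP] F0 iF; set a := tn j.-1 in tj *; set b := tn j in tj *.
have [Q QP] := poly_primitive P.
have Qab : Q.[b] = Q.[a].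
  apply/eqP; rewrite -subr_eq0 -integral_slab_deriv// QP -iF; apply/eqP.
  by apply: eq_Rintegral => t _; rewrite hP.
have Qmono x y : x <= y -> Q.[x] <= Q.[y].
  rewrite le_eqVlt => /predU1P[->//|xy]; rewrite -subr_ge0 -integral_deriv_poly//.
  by apply: Rintegral_ge0 => t _; rewrite QP -hP.
have Q0 : Q - (Q.[a])%:P = 0.
  apply: (@poly_zero_on_segment _ a b) => // t /andP[at_ tb].
  rewrite hornerD hornerN hornerC; apply/eqP; rewrite subr_eq0 eq_le.
  by apply/andP; split; [rewrite -Qab|]; exact: Qmono.
move=> t; rewrite hP -QP; move/eqP: Q0; rewrite subr_eq0 => /eqP ->.
by rewrite derivC horner0.
Qed.

End slab_integrals.

(** * Energy estimates *)

(* What the energy estimates use of the discrete space V: dd is the weak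
   derivative in the direction beta, equal to the pointwise one off Nn. *)
Record energy_space (R : realType) m (Om : set 'rV[R]_m) (beta : 'rV[R]_m)
    (V : set ('rV[R]_m -> R)) (dd : ('rV[R]_m -> R) -> 'rV[R]_m -> R)
    (Nn : set 'rV[R]_m) : Prop := EnergySpace {
  es_span : finite_span V;
  es_bm : forall v, V v -> bounded_measurable v;
  es_dd_bm : forall v, V v -> bounded_measurable (dd v);
  es_ddD : forall u v x, V u -> V v -> dd (fun x => u x + v x) x = dd u x + dd v x;
  es_ddZ : forall c u x, V u -> dd (fun x => c * u x) x = c * dd u x;
  es_ddE : forall v x, V v -> Om x -> ~ Nn x -> 'D_beta v x = dd v x;
  es_mNn : measurable Nn;
  es_Nn0 : lebesgue_rV Nn = 0%E;
  es_green : forall u v, V u -> V v ->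
    inner Om (dd u) v + inner Om u (dd v) = bd_inner Om beta (boundary Om) u v;
  es_definite : forall v, V v -> norm2 Om v = 0 -> forall x, v x = 0;
  es_mOm : measurable Om;
  es_finOm : (lebesgue_rV Om < +oo)%E;
  es_normal : bounded_measurable (fun x => dotv beta (outward_normal Om x));
  es_mboundary : measurable (boundary Om);
  es_minflow : measurable (inflow Om beta);
  es_surface : (surface_measure Om setT < +oo)%E
}.

Section energy.
Context (R : realType) (m : nat) (Om : set 'rV[R]_m) (beta : 'rV[R]_m).
Context (V : set ('rV[R]_m -> R)) (dd : ('rV[R]_m -> R) -> 'rV[R]_m -> R).
Context (Nn : set 'rV[R]_m).
Hypothesis ES : energy_space Om beta V dd Nn.

Let mOm := es_mOm ES.
Let finOm := es_finOm ES.
Local Notation bm := bounded_measurable.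
Local Notation normal := (outward_normal Om).

Lemma es_fin_surface G : measurable G -> (surface_measure Om G < +oo)%E.
Proof.
move=> mG; apply: le_lt_trans (es_surface ES).
by apply: le_measure; rewrite ?inE.
Qed.

Lemma innerC u v : inner Om u v = inner Om v u.
Proof. by apply: eq_Rintegral => x _; rewrite mulrC. Qed.

Lemma innerDl u v w : bm u -> bm v -> bm w ->
  inner Om (fun x => u x + v x) w = inner Om u w + inner Om v w.
Proof.
move=> bu bv bw; rewrite /inner -(bm_RintegralD mOm finOm); try exact: bmM.
by apply: eq_Rintegral => x _; rewrite mulrDl.
Qed.

Lemma innerZl c u w : bm u -> bm w -> inner Om (fun x => c * u x) w = c * inner Om u w.
Proof.
move=> bu bw; rewrite /inner -(bm_RintegralZ mOm finOm); last exact: bmM.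
by apply: eq_Rintegral => x _; rewrite mulrA.
Qed.

Lemma innerDr u v w : bm u -> bm v -> bm w ->
  inner Om w (fun x => u x + v x) = inner Om w u + inner Om w v.
Proof. by move=> bu bv bw; rewrite innerC innerDl// !(innerC w). Qed.

Lemma innerZr c u w : bm u -> bm w -> inner Om w (fun x => c * u x) = c * inner Om w u.
Proof. by move=> bu bw; rewrite innerC innerZl// (innerC w). Qed.

Lemma innerBl u v w : bm u -> bm v -> bm w ->
  inner Om (fun x => u x - v x) w = inner Om u w - inner Om v w.
Proof.
move=> bu bv bw; rewrite innerDl//; last exact: bmN.
congr (_ + _); rewrite -mulN1r -innerZl//; congr inner.
by apply/funext => x; rewrite mulN1r.
Qed.

Lemma norm2_ge0 u : 0 <= norm2 Om u.
Proof. by apply: Rintegral_ge0 => x _; rewrite -expr2 sqr_ge0. Qed.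

Lemma norm2B u v : bm u -> bm v ->
  norm2 Om (fun x => u x - v x) = norm2 Om u - 2 * inner Om u v + norm2 Om v.
Proof.
move=> bu bv; rewrite /norm2 innerBl//; last exact: bmB.
rewrite !(innerC _ (fun x => u x - v x)) !innerBl// (innerC v u); ring.
Qed.

Lemma inner_young u v e : bm u -> bm v -> 0 < e ->
  2 * inner Om u v <= e * norm2 Om u + e^-1 * norm2 Om v.
Proof.
move=> bu bv e0; rewrite -innerZl// /norm2 -[e * _]innerZl// -[e^-1 * _]innerZl//.
rewrite /inner -(bm_RintegralD mOm finOm); try by apply: bmM => //; exact: bmZ.
apply: (bm_le_Rintegral mOm finOm).
- by apply: bmM => //; exact: bmZ.
- by apply: bmD; apply: bmM => //; exact: bmZ.
move=> x _; rewrite -subr_ge0.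
rewrite (_ : _ - _ = e^-1 * (e * u x - v x) ^+ 2); last first.
  by field; rewrite gt_eqF.
by rewrite mulr_ge0 ?sqr_ge0// invr_ge0 ltW.
Qed.

Lemma bd_norm2_ge0 G u : 0 <= bd_norm2 Om beta G u.
Proof. by apply: Rintegral_ge0 => x _; rewrite mulr_ge0// sqr_ge0. Qed.

(* The inflow part is subtracted twice from the flux through the boundary. *)
Lemma bd_inner_flux u : bm u ->
  bd_inner Om beta (boundary Om) u u - 2 * bd_inner Om beta (inflow Om beta) u u =
  bd_norm2 Om beta (boundary Om) u.
Proof.
move=> bu; have bn := es_normal ES.
have mb := es_mboundary ES; have mi := es_minflow ES.
have fb := es_fin_surface mb; have fi := es_fin_surface mi.
pose I := [set x | dotv beta (normal x) < 0].
have mI : measurable I.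
  rewrite (_ : I = setT `&` (fun x => dotv beta (normal x)) @^-1` `]-oo, 0[%classic).
    by apply: bn.1 => //; exact: measurable_itv.
  by rewrite setTI; apply/seteqP; split => x; rewrite /I /= in_itv.
pose f x := dotv beta (normal x) * u x * u x.
have bf : bm f by apply: bmM => //; exact: bmM.
have bg : bm (fun x => \1_I x * f x) by apply: bmM => //; exact: bm_indic.
have E : bd_inner Om beta (inflow Om beta) u u =
    \int[surface_measure Om]_(x in boundary Om) (\1_I x * f x).
  rewrite /bd_inner [LHS](Rintegral_mkcondr _ (boundary Om) I f).
  apply: eq_Rintegral => x _; rewrite patchE indicE.
  by case: ifP; rewrite ?mul1r ?mul0r.
rewrite E; have := bm_RintegralZ mb fb 2 bg => <-.
have := bm_RintegralB mb fb bf (bmZ 2 bg) => <-.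
apply: eq_Rintegral => x _; rewrite indicE /f.
have [xI|xI] := ltP (dotv beta (normal x)) 0.
  by rewrite mem_set//= mul1r ltr0_norm// expr2; ring.
rewrite memNset; last by rewrite /I /=; apply/negP; rewrite -leNgt.
by rewrite /= mul0r mulr0 subr0 ger0_norm// expr2; ring.
Qed.

Section representation.
Variables (r : nat) (sigma delta : R).
Implicit Types (c e : 'I_r.+1 -> 'rV[R]_m -> R) (C E : nat -> 'I_r.+1 -> 'rV[R]_m -> R).

Definition rep c (t : R) (x : 'rV[R]_m) : R := \sum_(k < r.+1) t ^+ k * c k x.

(** For [k = 0] the exponent [k.-1] is harmless, since the factor [k%:R] is 0. *)
Definition drep c (t : R) (x : 'rV[R]_m) : R := \sum_(k < r.+1) k%:R * t ^+ k.-1 * c k x.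

(** Material derivative of [rep c], with the coefficients differentiated one by one so that it is
    visibly a polynomial in time. *)
Definition mrep c (t : R) (x : 'rV[R]_m) : R :=
  drep c t x + \sum_(k < r.+1) t ^+ k * dd (c k) x.

Lemma V_rep c t : (forall k, V (c k)) -> V (rep c t).
Proof.
move=> Vc; apply: finite_span_sum (es_span ES) _ => k.
by have [_ _ VZ] := finite_spanP (es_span ES); exact: VZ.
Qed.

Lemma dd_sum I (s : seq I) (F : I -> 'rV[R]_m -> R) x : (forall i, V (F i)) ->
  dd (fun x => \sum_(i <- s) F i x) x = \sum_(i <- s) dd (F i) x.
Proof.
move=> VF; have [V0 VD VZ] := finite_spanP (es_span ES).
elim: s => [|i s IH].
  rewrite big_nil (_ : (fun _ => _) = fun x => 0 * (fun=> 0) x).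
    by rewrite (es_ddZ ES)// mul0r.
  by apply/funext => y; rewrite big_nil mul0r.
rewrite big_cons -IH -(es_ddD ES)//.
  by congr dd; apply/funext => y; rewrite big_cons.
exact: finite_span_sum (es_span ES) _.
Qed.

Lemma dd_rep c t x : (forall k, V (c k)) ->
  dd (rep c t) x = \sum_(k < r.+1) t ^+ k * dd (c k) x.
Proof.
move=> Vc; have [_ _ VZ] := finite_spanP (es_span ES).
rewrite /rep dd_sum; last by move=> k; exact: VZ.
by apply: eq_bigr => k _; rewrite (es_ddZ ES).
Qed.

Lemma rep_time_poly c : (forall k, bm (c k)) -> time_poly (rep c) (drep c).
Proof. by move=> bc; apply: time_poly_sum => k; exact: time_poly_monomial. Qed.

Lemma mrepE c t : (forall k, V (c k)) ->
  mrep c t = fun x => drep c t x + dd (rep c t) x.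
Proof. by move=> Vc; apply/funext => x; rewrite dd_rep. Qed.

Lemma mrep_time_poly c : (forall k, V (c k)) -> exists W', time_poly (mrep c) W'.
Proof.
move=> Vc; have [W1 h1] := time_poly_deriv (rep_time_poly (fun k => es_bm ES (Vc k))).
eexists; apply: time_poly_add; first exact: h1.
by apply: time_poly_sum => k; apply: time_poly_monomial; exact: (es_dd_bm ES).
Qed.

Lemma bm_rep c t : (forall k, V (c k)) -> bm (rep c t).
Proof. by move=> Vc; apply: (es_bm ES); exact: V_rep. Qed.

Lemma bm_mrep c t : (forall k, V (c k)) -> bm (mrep c t).
Proof. by move=> /mrep_time_poly[W' h]; exact: time_poly_bm h. Qed.

Lemma bm_drep c t : (forall k, V (c k)) -> bm (drep c t).
Proof.
move=> Vc; have [W1 h1] := time_poly_deriv (rep_time_poly (fun k => es_bm ES (Vc k))).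
exact: time_poly_bm h1.
Qed.

Lemma inner_polynomial W1 W1' W2 W2' : time_poly W1 W1' -> time_poly W2 W2' ->
  polynomial_in_t (fun t => inner Om (W1 t) (W2 t)).
Proof.
move=> h1 h2; have [P hP] := time_poly_inner mOm finOm h1 h2.
by exists P => t; have [] := hP t.
Qed.

Lemma bd_inner_polynomial G W1 W1' W2 W2' : measurable G ->
  time_poly W1 W1' -> time_poly W2 W2' ->
  polynomial_in_t (fun t => bd_inner Om beta G (W1 t) (W2 t)).
Proof.
move=> mG h1 h2.
have [P hP] := time_poly_inner mG (es_fin_surface mG) (time_poly_weight (es_normal ES) h1) h2.
by exists P => t; have [] := hP t.
Qed.

Lemma bd_norm2_polynomial G W W' : measurable G -> time_poly W W' ->
  polynomial_in_t (fun t => bd_norm2 Om beta G (W t)).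
Proof.
move=> mG h.
have [P hP] := time_poly_inner mG (es_fin_surface mG)
  (time_poly_weight (bm_norm (es_normal ES)) h) h.
exists P => t; have [<- _] := hP t.
by apply: eq_Rintegral => x _; rewrite expr2 mulrA.
Qed.

Definition bil_density c e t :=
  inner Om (fun x => mrep c t x + sigma * rep c t x)
           (fun x => rep e t x + delta * mrep e t x)
  - bd_inner Om beta (inflow Om beta) (rep c t) (rep e t).

Definition sd_density c t := sigma * norm2 Om (rep c t) + delta * norm2 Om (mrep c t)
    + bd_norm2 Om beta (boundary Om) (rep c t).

Lemma bil_density_polynomial c e : (forall k, V (c k)) -> (forall k, V (e k)) ->
  polynomial_in_t (bil_density c e).
Proof.
move=> Vc Ve.
have hc := rep_time_poly (fun k => es_bm ES (Vc k)); have [mc hmc] := mrep_time_poly Vc.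
have he := rep_time_poly (fun k => es_bm ES (Ve k)); have [me hme] := mrep_time_poly Ve.
apply: polynomial_in_tD.
  exact: (inner_polynomial (time_poly_add hmc (time_polyZ sigma hc))
                           (time_poly_add he (time_polyZ delta hme))).
by apply: polynomial_in_tN; apply: bd_inner_polynomial hc he; exact: es_minflow ES.
Qed.

Lemma sd_density_polynomial c : (forall k, V (c k)) -> polynomial_in_t (sd_density c).
Proof.
move=> Vc; have hc := rep_time_poly (fun k => es_bm ES (Vc k)).
have [mc hmc] := mrep_time_poly Vc.
apply: polynomial_in_tD; last exact: bd_norm2_polynomial (es_mboundary ES) hc.
apply: polynomial_in_tD; apply: polynomial_in_tZ.
  exact: (inner_polynomial hc hc).
exact: (inner_polynomial hmc hmc).
Qed.

Hypotheses (sigma0 : 0 <= sigma) (delta0 : 0 < delta).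
Hypothesis sigma_delta : sigma * delta <= 1.

Lemma green_rep c t : (forall k, V (c k)) ->
  2 * inner Om (mrep c t) (rep c t) =
  2 * inner Om (drep c t) (rep c t) + bd_inner Om beta (boundary Om) (rep c t) (rep c t).
Proof.
move=> Vc; have Vr := V_rep t Vc.
rewrite mrepE// innerDl; [|exact: bm_drep|exact: (es_dd_bm ES)|exact: bm_rep].
rewrite -(es_green ES Vr Vr) (innerC (rep c t) (dd _)); ring.
Qed.

(** By [green_rep] the transport part of twice the form is the time derivative of the energy plus
    the boundary flux, which [bd_inner_flux] combines with the inflow term to the boundary norm. Of
    the doubled terms with [sigma] and [delta] one copy survives; the other pays for the mixed
    term. *)
Lemma density_coercive c t : (forall k, V (c k)) ->
  2 * inner Om (drep c t) (rep c t) + sd_density c t <= 2 * bil_density c c t.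
Proof.
move=> Vc; have br := bm_rep t Vc; have bmr := bm_mrep t Vc.
rewrite /bil_density /sd_density.
rewrite innerDl; [|by []|exact: bmZ|by apply: bmD => //; exact: bmZ].
rewrite !innerDr//; try exact: bmZ.
rewrite !innerZr ?innerZl//; try exact: bmZ.
have G := green_rep t Vc; have F := bd_inner_flux br.
rewrite -!/(norm2 Om _).
have := norm2_ge0 (mrep c t); have := norm2_ge0 (rep c t).
(* Young's inequality with weight [delta^-1], multiplied by [sigma * delta]. The coefficient of the
   drift becomes [sigma * delta * delta], at most [delta]. *)
have Y : - (2 * inner Om (rep c t) (mrep c t)) * (sigma * delta) <=
    sigma * norm2 Om (rep c t) + delta * norm2 Om (mrep c t).
  have [->|s0] := eqVneq sigma 0.
    by rewrite !mul0r mulr0 add0r mulr_ge0 ?norm2_ge0// ltW.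
  have sp : 0 < sigma by rewrite lt_neqAle eq_sym s0.
  have := inner_young (bmN br) bmr (e := delta^-1); rewrite invr_gt0 invrK => /(_ delta0).
  have nN : norm2 Om (fun x => - rep c t x) = norm2 Om (rep c t).
    by apply: eq_Rintegral => x _; rewrite mulrNN.
  have iN : inner Om (fun x => - rep c t x) (mrep c t) = - inner Om (rep c t) (mrep c t).
    rewrite -mulN1r -innerZl//; congr inner; apply/funext => x.
    by rewrite mulN1r.
  rewrite nN iN => h.
  have sd0 : 0 < sigma * delta by rewrite mulr_gt0.
  have h1 := ler_wpM2l (ltW sd0) h.
  have h2 : sigma * delta * (delta^-1 * norm2 Om (rep c t)) = sigma * norm2 Om (rep c t).
    by rewrite mulrA mulfK ?gt_eqF.
  have h3 : sigma * delta * (delta * norm2 Om (mrep c t)) <= delta * norm2 Om (mrep c t).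
    by rewrite ler_piMl// mulr_ge0 ?norm2_ge0// ltW.
  move: h1; rewrite mulrDr h2; lra.
rewrite (innerC (mrep c t) (rep c t)) in G *.
set A := inner Om (rep c t) (mrep c t) in G Y *.
nra.
Qed.

End representation.
End energy.

Section primitives.
Context (R : realType).

Lemma poly_deriv_ge0_le (P : {poly R}) a b : a <= b ->
  (forall t, a < t < b -> 0 <= P^`().[t]) -> P.[a] <= P.[b].
Proof.
rewrite le_eqVlt => /predU1P[->//|ab] h; rewrite -subr_ge0 -integral_deriv_poly//.
have iP := integrable_horner P^`() a b.
rewrite -Rintegral_itv_bndo_bndc; last first.
  by apply: integrableS iP => //; exact: subset_itv_co_cc.
rewrite -Rintegral_itv_obnd_cbnd; last first.
  by apply: integrableS iP => //; exact: subset_itv_oo_cc.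
by apply: Rintegral_ge0 => t; rewrite /= in_itv; exact: h.
Qed.

End primitives.

(** * Energy on one slab and on the first [n] slabs *)

Section energy_estimates.
Context (R : realType) (m : nat) (Om : set 'rV[R]_m) (beta : 'rV[R]_m).
Context (V : set ('rV[R]_m -> R)) (dd : ('rV[R]_m -> R) -> 'rV[R]_m -> R).
Context (Nn : set 'rV[R]_m).
Hypothesis ES : energy_space Om beta V dd Nn.
Variables (r N : nat) (tn : nat -> R) (sigma delta : R).
Hypothesis grid : forall j, (j < N)%N -> tn j < tn j.+1.
Hypotheses (sigma0 : 0 <= sigma) (delta0 : 0 < delta).
Hypothesis sigma_delta : sigma * delta <= 1.
Implicit Types (c e : 'I_r.+1 -> 'rV[R]_m -> R) (C E : nat -> 'I_r.+1 -> 'rV[R]_m -> R).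

Let mOm := es_mOm ES.
Let finOm := es_finOm ES.
Local Notation bm := bounded_measurable.
Local Notation mu := (@lebesgue_measure R).
Local Notation mrep := (mrep dd).
Local Notation bil_density := (bil_density Om beta dd sigma delta).
Local Notation sd_density := (sd_density Om beta dd sigma delta).

Definition rep_jump C j x := rep (C j.+1) (tn j) x - rep (C j) (tn j) x.

Definition discrete_bil n C E : R :=
  \sum_(1 <= j < n.+1) \int[mu]_(t in slab tn j) bil_density (C j) (E j) t
  + \sum_(1 <= j < n) inner Om (rep_jump C j) (rep (E j.+1) (tn j))
  + inner Om (rep (C 1%N) (tn 0)) (rep (E 1%N) (tn 0)).

Definition discrete_sd n C : R :=
  \sum_(1 <= j < n.+1) \int[mu]_(t in slab tn j) sd_density (C j) t
  + \sum_(1 <= j < n) norm2 Om (rep_jump C j)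
  + norm2 Om (rep (C 1%N) (tn 0)) + norm2 Om (rep (C n) (tn n)).

Definition V_coefficients n C := forall j k, (1 <= j <= n)%N -> V (C j k).

Let grid1 j : (1 <= j <= N)%N -> tn j.-1 < tn j.
Proof. by case: j => // j /= jN; exact: grid. Qed.

Lemma norm2_rep_polynomial c : (forall k, V (c k)) -> exists P : {poly R},
  forall t, norm2 Om (rep c t) = P.[t] /\ 2 * inner Om (drep c t) (rep c t) = P^`().[t].
Proof.
move=> Vc; have h := rep_time_poly (fun k => es_bm ES (Vc k)).
have [P hP] := time_poly_inner mOm finOm h h.
exists P => t; have [h1 h2] := hP t; split => //.
by rewrite -h2 mulrDl mul1r [X in _ + X]innerC.
Qed.

Lemma slab_coercive c j : (1 <= j <= N)%N -> (forall k, V (c k)) ->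
  norm2 Om (rep c (tn j)) - norm2 Om (rep c (tn j.-1))
    + \int[mu]_(t in slab tn j) sd_density c t
  <= 2 * \int[mu]_(t in slab tn j) bil_density c c t.
Proof.
move=> jN Vc; have tj := grid1 jN.
have [P hP] := norm2_rep_polynomial Vc.
have pb := bil_density_polynomial ES sigma delta Vc Vc.
have ps := sd_density_polynomial ES sigma delta Vc.
have pP : polynomial_in_t (horner P^`()) by exists P^`().
rewrite (hP (tn j)).1 (hP (tn j.-1)).1 -integral_slab_deriv//.
have mS := measurable_slab tn j.
rewrite -(RintegralD mS (integrable_slab tn j pP) (integrable_slab tn j ps)).
rewrite -(RintegralZl _ mS (integrable_slab tn j pb)).
apply: (le_Rintegral mS).
- exact: (integrable_slab tn j (polynomial_in_tD pP ps)).
- exact: (integrable_slab tn j (polynomial_in_tZ 2 pb)).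
move=> t _; rewrite -(hP t).2.
exact: (density_coercive ES).
Qed.

Lemma discrete_coercive n C : (1 <= n <= N)%N -> V_coefficients n C ->
  discrete_sd n C <= 2 * discrete_bil n C C.
Proof.
have arith (s1 s2 s3 s4 b1 b2 b3 x z p p' q : R) : p' - p + q <= 2 * x ->
    s1 + s2 + s3 + s4 <= 2 * (b1 + b2 + b3) ->
  s1 + q + (s2 + (2 * z - p + s4)) + s3 + p' <= 2 * (b1 + x + (b2 + z) + b3).
  by move=> *; lra.
case/andP; case: n => // n _; elim: n => [|n IH] nN VC.
  have VC1 k : V (C 1%N k) by exact: VC.
  have := slab_coercive (j := 1) nN VC1.
  rewrite /discrete_sd /discrete_bil !big_nat1 !big_geq// /= -/(norm2 Om _); lra.
have {}IH : discrete_sd n.+1 C <= 2 * discrete_bil n.+1 C C.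
  apply: IH; first exact: ltnW.
  by move=> j k /andP[j1 jn]; apply: VC; rewrite j1 (leq_trans jn).
have VC1 k : V (C n.+1 k) by apply: VC; rewrite /= leqnSn.
have VC2 k : V (C n.+2 k) by apply: VC; rewrite /= leqnn.
have nN2 : (1 <= n.+2 <= N)%N by rewrite nN.
have SC := slab_coercive nN2 VC2.
have b1 := bm_rep ES (tn n.+1) VC1; have b2 := bm_rep ES (tn n.+1) VC2.
(* The identity trades the doubled jump term of the form for the norm of the jump and the difference
   of the energies on both sides of the grid point, so that the end terms of consecutive slabs
   cancel. *)
have J : norm2 Om (rep_jump C n.+1) =
    2 * inner Om (rep_jump C n.+1) (rep (C n.+2) (tn n.+1))
    - norm2 Om (rep (C n.+2) (tn n.+1)) + norm2 Om (rep (C n.+1) (tn n.+1)).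
  rewrite /rep_jump (norm2B ES b2 b1) (innerBl ES b2 b1 b2) -/(norm2 Om _).
  by rewrite (innerC _ (rep (C n.+1) _) (rep (C n.+2) _)); ring.
move: IH; rewrite /discrete_sd /discrete_bil.
rewrite !(@big_nat_recr _ _ _ n.+2 1)//= !(@big_nat_recr _ _ _ n.+1 1)//= J.
exact: (arith _ _ _ _ _ _ _ _ _ _ _ _ SC).
Qed.

Lemma bd_inner_le u : bm u ->
  bd_inner Om beta (boundary Om) u u <= bd_norm2 Om beta (boundary Om) u.
Proof.
move=> bu; have mb := es_mboundary ES.
apply: (bm_le_Rintegral mb (es_fin_surface ES mb)).
- by apply: bmM => //; apply: bmM => //; exact: (es_normal ES).
- apply: bmM; first exact: bm_norm (es_normal ES).
  by under eq_fun do rewrite expr2; exact: bmM.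
by move=> x _; rewrite -mulrA expr2 ler_wpM2r ?ler_norm// -expr2 sqr_ge0.
Qed.

(** The energy is followed backwards from the end of the slab: [2 (D v, v)] is the sum of its
    derivative and the flux, and Young's inequality with weight [2 h], [h] the length of the slab,
    bounds its decrease by drift, flux and [(2 h)^-1] times the energy. Integrated once more over
    the slab, the last term is half of the left-hand side and is absorbed. The bound does not
    involve [sigma], so it also covers [sigma = 0]. *)
Lemma slab_norm2_bound c j : (1 <= j <= N)%N -> (forall k, V (c k)) ->
  \int[mu]_(t in slab tn j) norm2 Om (rep c t) <=
  2 * (tn j - tn j.-1) * (norm2 Om (rep c (tn j)) +
      \int[mu]_(t in slab tn j) bd_norm2 Om beta (boundary Om) (rep c t))
  + 4 * (tn j - tn j.-1) ^+ 2 * \int[mu]_(t in slab tn j) norm2 Om (mrep c t).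
Proof.
move=> jN Vc; have tj := grid1 jN; set h := tn j - tn j.-1.
have h0 : 0 < h by rewrite subr_gt0.
have [P hP] := norm2_rep_polynomial Vc.
have hc := rep_time_poly (fun k => es_bm ES (Vc k)).
have [mc hmc] := mrep_time_poly ES Vc.
have [B hB] := bd_norm2_polynomial ES (es_mboundary ES) hc.
have [D hD] := inner_polynomial ES hmc hmc.
have [PP PPE] := poly_primitive P; have [BB BBE] := poly_primitive B.
have [DD DDE] := poly_primitive D.
have int F Q QQ : (forall t, F t = Q.[t]) -> QQ^`() = Q ->
    \int[mu]_(t in slab tn j) F t = QQ.[tn j] - QQ.[tn j.-1].
  move=> FQ QE; rewrite -integral_slab_deriv// QE.
  by apply: eq_Rintegral => t _; rewrite FQ.
rewrite (int _ _ _ (fun t => (hP t).1) PPE) (int _ _ _ hB BBE) (int _ _ _ hD DDE).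
set M := PP.[tn j] - _; set BI := BB.[tn j] - _; set DI := DD.[tn j] - _.
(* A primitive of the bound for the decrease: [P + H] is nondecreasing, so [P] at any time of the
   slab is at most its end value plus the increment of [H]. *)
pose H := (2 * h) *: DD + (2 * h)^-1 *: PP + BB.
have HE t : H^`().[t] = 2 * h * norm2 Om (mrep c t) + (2 * h)^-1 * norm2 Om (rep c t)
    + bd_norm2 Om beta (boundary Om) (rep c t).
  rewrite /H !derivD !derivZ !hornerD !hornerZ DDE PPE BBE -hB.
  by rewrite -(hP t).1 -hD.
have H0 t : 0 <= H^`().[t].
  rewrite HE !addr_ge0 ?mulr_ge0 ?norm2_ge0 ?bd_norm2_ge0 ?invr_ge0 ?mulr_ge0//; exact: ltW.
have PH t : 0 <= (P + H)^`().[t].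
  rewrite derivD hornerD HE -(hP t).2.
  have := green_rep ES t Vc.
  have := bd_inner_le (bm_rep ES t Vc).
  have h20 : 0 < 2 * h by rewrite mulr_gt0.
  have := inner_young ES (bmN (bm_mrep ES t Vc)) (bm_rep ES t Vc) h20.
  have -> : norm2 Om (fun x => - mrep c t x) = norm2 Om (mrep c t).
    by apply: eq_Rintegral => x _; rewrite mulrNN.
  have -> : inner Om (fun x => - mrep c t x) (rep c t) = - inner Om (mrep c t) (rep c t).
    rewrite -mulN1r -(innerZl ES); [|exact: (bm_mrep ES)|exact: (bm_rep ES)].
    by congr inner; apply/funext => x; rewrite mulN1r.
  lra.
have Pt t : tn j.-1 <= t <= tn j -> P.[t] <= P.[tn j] + (H.[tn j] - H.[tn j.-1]).
  move=> /andP[at_ tb].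
  have := poly_deriv_ge0_le tb (fun s _ => PH s); rewrite (hornerD P H t) (hornerD P H (tn j)).
  have := poly_deriv_ge0_le at_ (fun s _ => H0 s); lra.
set K := P.[tn j] + _ in Pt.
have MK : M <= K * h.
  have := @poly_deriv_ge0_le _ (K *: 'X - PP) _ _ (ltW tj).
  rewrite !hornerD !hornerN !hornerZ !hornerX => /(_ _) Q.
  have : K * tn j.-1 - PP.[tn j.-1] <= K * tn j - PP.[tn j].
    apply: Q => t /andP[at_ tb].
    rewrite derivD derivN derivZ derivX hornerD hornerN hornerZ hornerC mulr1 PPE.
    by rewrite subr_ge0 Pt// !ltW.
  rewrite /M /h mulrBr; lra.
have KE : K = P.[tn j] + (2 * h * DI + (2 * h)^-1 * M + BI).
  by rewrite /K /H !hornerD !hornerZ /DI /M /BI; ring.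
have hM : h * ((2 * h)^-1 * M) = M / 2 by field; rewrite gt_eqF.
have E2 : K * h = h * P.[tn j] + 2 * h ^+ 2 * DI + h * ((2 * h)^-1 * M) + h * BI.
  by rewrite KE expr2; ring.
have -> : 2 * h * (norm2 Om (rep c (tn j)) + BI) + 4 * h ^+ 2 * DI =
    2 * (h * P.[tn j] + h * BI + 2 * h ^+ 2 * DI) by rewrite (hP (tn j)).1; ring.
move: MK; rewrite E2 hM.
set X1 := h * P.[tn j]; set X2 := 2 * h ^+ 2 * DI; set X3 := h * BI; lra.
Qed.

Lemma sd_density_ge0 c t : 0 <= sd_density c t.
Proof.
by rewrite !addr_ge0 ?mulr_ge0 ?norm2_ge0 ?bd_norm2_ge0// ltW.
Qed.

Lemma discrete_sd_definite C : (1 <= N)%N -> V_coefficients N C -> discrete_sd N C <= 0 ->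
  forall j t x, (1 <= j <= N)%N -> rep (C j) t x = 0.
Proof.
move=> N1 VC.
have sum0 (a b c e : R) : 0 <= a -> 0 <= b -> 0 <= c -> 0 <= e -> a + b + c + e <= 0 ->
    [/\ a <= 0, b <= 0 & e <= 0] by move=> *; split; lra.
rewrite /discrete_sd => sd0.
have S1 : 0 <= \sum_(1 <= j < N.+1) \int[mu]_(t in slab tn j) sd_density (C j) t.
  by apply: sumr_ge0 => j _; apply: Rintegral_ge0 => t _; exact: sd_density_ge0.
have S2 : 0 <= \sum_(1 <= j < N) norm2 Om (rep_jump C j).
  by apply: sumr_ge0 => j _; exact: norm2_ge0.
have n1 := norm2_ge0 Om (rep (C 1%N) (tn 0)).
have n2 := norm2_ge0 Om (rep (C N) (tn N)).
have [S1' S2' n2'] := sum0 _ _ _ _ S1 S2 n1 n2 sd0.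
have nN : norm2 Om (rep (C N) (tn N)) = 0 by apply/eqP; rewrite eq_le n2 n2'.
have jump0 j : (1 <= j < N)%N -> norm2 Om (rep_jump C j) = 0.
  move=> jN; apply/eqP; rewrite eq_le norm2_ge0 andbT.
  apply: le_trans S2'; rewrite (big_rem j) ?mem_index_iota//= lerDl.
  by apply: sumr_ge0 => i _; exact: norm2_ge0.
have slab0 j : (1 <= j <= N)%N -> \int[mu]_(t in slab tn j) sd_density (C j) t = 0.
  move=> jN; apply/eqP; rewrite eq_le; apply/andP; split; last first.
    by apply: Rintegral_ge0 => t _; exact: sd_density_ge0.
  apply: le_trans S1'; rewrite (big_rem j) ?mem_index_iota//= lerDl.
  by apply: sumr_ge0 => i _; apply: Rintegral_ge0 => t _; exact: sd_density_ge0.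
have step j : (1 <= j <= N)%N -> norm2 Om (rep (C j) (tn j)) = 0 ->
    forall t x, rep (C j) t x = 0.
  move=> jN e0; have VCj k : V (C j k) by exact: VC.
  have tj := grid1 jN.
  have z := polynomial_integral_eq0 tj (sd_density_polynomial ES sigma delta VCj)
    (sd_density_ge0 (C j)) (slab0 j jN).
  have md0 t : norm2 Om (mrep (C j) t) = 0.
    apply/eqP; rewrite eq_le norm2_ge0 andbT -(pmulr_rle0 _ delta0) -(z t).
    by rewrite /sd_density addrAC lerDr addr_ge0 ?mulr_ge0 ?norm2_ge0 ?bd_norm2_ge0.
  have bd0 t : bd_norm2 Om beta (boundary Om) (rep (C j) t) = 0.
    apply/eqP; rewrite eq_le bd_norm2_ge0 andbT -(z t).
    by rewrite /sd_density lerDr addr_ge0 ?mulr_ge0 ?norm2_ge0// ltW.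
  have hc := rep_time_poly (fun k => es_bm ES (VCj k)).
  (* As [sigma] may be 0, the density controls only drift and flux. With these and the end value
     equal to 0, the bound forces [v] itself to vanish. *)
  have := slab_norm2_bound jN VCj.
  have i0 F : (forall t, F t = 0) -> \int[mu]_(t in slab tn j) F t = 0.
    move=> F0; transitivity (\int[mu]_(t in slab tn j) (0 : R)).
      by apply: eq_Rintegral => t _; exact: F0.
    by rewrite (integral_slab_cst 0 tj) mul0r.
  rewrite (i0 _ bd0) (i0 _ md0) e0 addr0 !mulr0 addr0 => M0 t x.
  apply: (es_definite ES (V_rep ES t VCj)).
  apply: (polynomial_integral_eq0 tj (inner_polynomial ES hc hc)).
    by move=> s; exact: norm2_ge0.
  apply/eqP; rewrite eq_le M0; apply: Rintegral_ge0 => s _; exact: norm2_ge0.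
have all i j : (1 <= j)%N -> (j + i = N)%N -> norm2 Om (rep (C j) (tn j)) = 0.
  elim: i j => [|i IH] j j1 ji; first by rewrite -ji addn0 in nN.
  have jN : (1 <= j < N)%N by rewrite j1 -ji addnS ltnS leq_addr.
  have {}IH : norm2 Om (rep (C j.+1) (tn j.+1)) = 0 by apply: IH; rewrite // addSnnS.
  have jN' : (1 <= j.+1 <= N)%N by case/andP: jN.
  have z := step j.+1 jN' IH.
  rewrite -(jump0 j jN); apply: eq_Rintegral => x _.
  by rewrite /rep_jump z sub0r mulrNN.
move=> j t x jN; apply: step => //; case/andP: jN => j1 jN.
by apply: (all (N - j)%N) => //; rewrite subnKC.
Qed.

End energy_estimates.

Lemma sparse_grid_energy_space (R : realType) d (Om1 Om2 : set 'rV[R]_d)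
    (V1 V2 : nat -> set ('rV[R]_d -> R)) L (beta : 'rV[R]_(d + d)) :
  (1 <= d)%N ->
  polyhedral_lipschitz_domain Om1 -> polyhedral_lipschitz_domain Om2 ->
  finite_element_spaces Om1 V1 -> finite_element_spaces Om2 V2 -> (1 <= L)%N ->
  exists dd Nn, energy_space (product_domain Om1 Om2) beta (sparse_grid V1 V2 L) dd Nn.
Proof.
case: d Om1 Om2 V1 V2 beta => // d Om1 Om2 V1 V2 beta _ P1 P2 F1 F2 L1.
have [Hs [Cs [mesh fe]]] := sparse_grid_fe_function P1 P2 F1 F2 L1.
set Om := product_domain Om1 Om2 in mesh fe *.
have [oOm bOm pH bH] : [/\ open Om, bounded_set Om, proper_planes Hs &
    boundary Om `<=` on_planes Hs] by case: mesh => -[].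
exists (cell_derivative Om Hs beta), (on_planes Hs); split.
- exact: (sparse_grid_finite_span L F1 F2).
- by move=> v /fe[].
- by move=> v /fe hv; exact: (bm_cell_derivative mesh beta hv).
- by move=> u v x /fe hu /fe hv; exact: (cell_derivativeD mesh beta x hu hv).
- by move=> c u x /fe hu; exact: (cell_derivativeZ mesh beta c x hu).
- move=> v x _ Ox nx; symmetry.
  exact: (cell_derivativeE beta v Ox nx).
- exact: measurable_on_planes.
- exact: on_planes_null.
- by move=> u v /fe hu /fe hv; exact: (green_identity mesh beta hu hv).
- by move=> v /fe hv; exact: (fe_function_definite mesh hv).
- exact: (measurable_Om mesh).
- exact: (finite_Om mesh).
- exact: (bm_dotv_outward_normal oOm pH bH beta).
- exact: (measurable_boundary Om).
- exact: (measurable_inflow oOm pH bH beta).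
- exact: (surface_measure_lty oOm bOm pH bH).
Qed.

(** * Space-time functions, their coefficients and the forms *)

Section coefficients.
Context (R : realType) (m : nat) (Om : set 'rV[R]_m) (beta : 'rV[R]_m).
Context (V : set ('rV[R]_m -> R)) (dd : ('rV[R]_m -> R) -> 'rV[R]_m -> R).
Context (Nn : set 'rV[R]_m).
Hypothesis ES : energy_space Om beta V dd Nn.
Variables (r N : nat) (tn : nat -> R) (sigma delta : R).
Hypothesis grid : forall j, (j < N)%N -> tn j < tn j.+1.
Implicit Types (c e : 'I_r.+1 -> 'rV[R]_m -> R) (C E : nat -> 'I_r.+1 -> 'rV[R]_m -> R).
Implicit Types (U W : R -> 'rV[R]_m -> R).

Local Notation mu := (@lebesgue_measure R).
Local Notation mrep := (mrep dd).
Local Notation sd_density := (sd_density Om beta dd sigma delta).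

Let grid1 j : (1 <= j <= N)%N -> tn j.-1 < tn j.
Proof. by case: j => // j /= jN; exact: grid. Qed.

Definition represents C W := forall j t, (1 <= j <= N)%N -> slab tn j t -> W t = rep (C j) t.

Lemma space_time_coefficients W : space_time V r N tn W ->
  exists2 C, V_coefficients V N C & represents C W.
Proof.
move=> XW.
have h j : exists c, (1 <= j <= N)%N ->
    (forall k, V (c k)) /\ forall t, slab tn j t -> W t = rep c t.
  have [jN|jN] := boolP (1 <= j <= N)%N; last by exists (fun _ _ => 0).
  by have [c Vc hc] := XW j jN; exists c.
have [C hC] := choice h.
exists C; first by move=> j k jN; have [] := hC j jN.
by move=> j t jN; have [_] := hC j jN; exact.
Qed.

(** A function with prescribed coefficients on each slab; it is 0 at all other times, where the
    values are immaterial. *)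
Definition space_time_of E t x := \sum_(1 <= j < N.+1) \1_(slab tn j) t * rep (E j) t x.

Lemma grid_le i j : (i <= j <= N)%N -> tn i <= tn j.
Proof.
elim: j => [|j IH]; first by rewrite leqn0 => /andP[/eqP ->].
rewrite leq_eqVlt => /andP[/predU1P[->//|ij] jN].
by apply: le_trans (IH _) (ltW (grid jN)); rewrite -ltnS ij ltnW.
Qed.

Lemma slab_disjoint i j t : (1 <= i <= N)%N -> (1 <= j <= N)%N ->
  slab tn i t -> slab tn j t -> i = j.
Proof.
wlog ij : i j / (i <= j)%N => [H iN jN ti tj|/andP[i1 iN] /andP[j1 jN]].
  by case/orP: (leq_total i j) => ij; [exact: H|apply/esym; exact: H].
move=> /andP[_ ti] /andP[tj _]; apply/eqP; rewrite eqn_leq ij leqNgt.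
apply/negP => lij; have := lt_trans tj ti; rewrite ltNge grid_le//.
by case: j j1 jN lij {ij tj} => // j _ jN; rewrite ltnS => -> /=; exact: ltnW.
Qed.

Lemma space_time_of_represents E : represents E (space_time_of E).
Proof.
move=> j t jN tj; apply/funext => x; rewrite /space_time_of.
have jI : j \in index_iota 1 N.+1 by rewrite mem_index_iota.
rewrite (bigD1_seq j jI (iota_uniq _ _)) /= indicE (mem_set tj) mul1r.
rewrite big_seq_cond big1 ?addr0// => i /andP[]; rewrite mem_index_iota => iN ij.
rewrite indicE memNset ?mul0r// => ti.
by move: ij; rewrite (slab_disjoint iN jN ti tj) eqxx.
Qed.

Lemma represents_space_time E W : V_coefficients V N E -> represents E W ->
  space_time V r N tn W.
Proof.
move=> VE rW j jN; exists (E j); first by move=> k; exact: VE.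
by move=> t tj; exact: rW tj.
Qed.

Lemma rep_point c x : exists P : {poly R},
  forall t, rep c t x = P.[t] /\ drep c t x = P^`().[t].
Proof.
exists (\sum_(k < r.+1) c k x *: 'X^k) => t; split.
  rewrite horner_sum; apply: eq_bigr => k _.
  by rewrite hornerZ hornerXn [RHS]mulrC.
rewrite raddf_sum horner_sum; apply: eq_bigr => k _ /=.
by rewrite derivZ derivXn hornerZ hornerMn hornerXn mulrC mulr_natl.
Qed.

(** The slab is open, so [W] coincides near [t] with its polynomial and has the same time
    derivative; the space derivative agrees with [dd] off [Nn]. *)
Lemma material_derivative_rep C W j t x : V_coefficients V N C -> represents C W ->
  (1 <= j <= N)%N -> slab tn j t -> Om x -> ~ Nn x ->
  material_derivative beta W t x = mrep (C j) t x.
Proof.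
move=> VC rW jN tj Ox nx; have VCj k : V (C j k) by exact: VC.
rewrite /material_derivative (rW j t jN tj) (mrepE ES)//.
rewrite (es_ddE ES)//; last exact: (V_rep ES).
congr (_ + _); have [P hP] := rep_point (C j) x.
rewrite (hP t).2 derivE !derive1E; apply: near_eq_derive.
have tj' : t \in `]tn j.-1, tn j[ by rewrite in_itv.
near=> s; have sj : s \in `]tn j.-1, tn j[ by near: s; exact: near_in_itvoo.
by rewrite (rW j s jN) ?(hP s).1//; move: sj; rewrite in_itv.
Unshelve. all: by end_near.
Qed.

Lemma trace_right_rep C W j : represents C W -> (1 <= j <= N)%N ->
  trace_right W (tn j.-1) = rep (C j) (tn j.-1).
Proof.
move=> rW jN; apply/funext => x; have tj := grid1 jN.
have [P hP] := rep_point (C j) x.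
apply: cvg_lim => //; rewrite (hP _).1.
have cP : P.[s] @[s --> (tn j.-1)^'+] --> P.[tn j.-1].
  by apply: cvg_at_right_filter; exact: continuous_horner.
apply: cvg_trans (near_eq_cvg _) cP.
near=> s; rewrite -(hP s).1 (rW j s jN)//; apply/andP; split.
- near: s; exact: nbhs_right_gt.
- near: s; exact: nbhs_right_lt.
Unshelve. all: by end_near.
Qed.

Lemma trace_left_rep C W j : represents C W -> (1 <= j <= N)%N ->
  trace_left W (tn j) = rep (C j) (tn j).
Proof.
move=> rW jN; apply/funext => x; have tj := grid1 jN.
have [P hP] := rep_point (C j) x.
apply: cvg_lim => //; rewrite (hP _).1.
have cP : P.[s] @[s --> (tn j)^'-] --> P.[tn j].
  by apply: cvg_at_left_filter; exact: continuous_horner.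
apply: cvg_trans (near_eq_cvg _) cP.
near=> s; rewrite -(hP s).1 (rW j s jN)//; apply/andP; split.
- near: s; exact: nbhs_left_gt.
- near: s; exact: nbhs_left_lt.
Unshelve. all: by end_near.
Qed.

Lemma jump_rep C W j : represents C W -> (1 <= j < N)%N ->
  jump W (tn j) = rep_jump tn C j.
Proof.
move=> rW /andP[j1 jN]; apply/funext => x.
rewrite /jump (trace_right_rep (j := j.+1) rW)// (trace_left_rep (j := j) rW)//.
by rewrite j1 ltnW.
Qed.

Lemma inner_off_null u u' v v' :
  (forall x, Om x -> ~ Nn x -> u x = u' x) -> (forall x, Om x -> ~ Nn x -> v x = v' x) ->
  inner Om u v = inner Om u' v'.
Proof.
move=> uu vv; apply: (eq_Rintegral_off_null (es_mNn ES) (es_Nn0 ES)) => x Ox nx.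
by rewrite uu ?vv.
Qed.

Lemma bilinear_form_rep C E U W : (1 <= N)%N ->
  V_coefficients V N C -> represents C U -> V_coefficients V N E -> represents E W ->
  bilinear_form Om beta sigma delta N tn U W =
  discrete_bil Om beta dd tn sigma delta N C E.
Proof.
move=> N1 VC rU VE rW; have N1' : (1 <= 1 <= N)%N by [].
rewrite /bilinear_form /discrete_bil.
apply: (f_equal2 +%R (f_equal2 +%R _ _) _).
- apply: eq_big_nat => j jN; apply: eq_Rintegral => t /set_mem tj.
  apply: (f_equal2 (fun a b => a - b)); last by rewrite (rU _ _ jN tj) (rW _ _ jN tj).
  apply: inner_off_null => x Ox nx.
    by rewrite (material_derivative_rep VC rU jN tj Ox nx) (rU _ _ jN tj).
  by rewrite (material_derivative_rep VE rW jN tj Ox nx) (rW _ _ jN tj).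
- apply: eq_big_nat => j jN; rewrite (jump_rep rU jN).
  have jN' : (1 <= j.+1 <= N)%N by case/andP: jN.
  by have /= -> := trace_right_rep rW jN'.
- by have /= -> := trace_right_rep rU N1'; have /= -> := trace_right_rep rW N1'.
Qed.

Lemma sd_norm2_rep C U : (1 <= N)%N -> V_coefficients V N C -> represents C U ->
  sd_norm2 Om beta sigma delta N tn U = discrete_sd Om beta dd tn sigma delta N C.
Proof.
move=> N1 VC rU; have N1' : (1 <= 1 <= N)%N by [].
have NN : (1 <= N <= N)%N by rewrite N1 /=.
rewrite /sd_norm2 /discrete_sd.
apply: (f_equal2 +%R (f_equal2 +%R (f_equal2 +%R _ _) _) _).
- apply: eq_big_nat => j jN; apply: eq_Rintegral => t /set_mem tj.
  rewrite (rU _ _ jN tj) /sd_density -/(norm2 Om).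
  rewrite [norm2 Om (material_derivative _ _ _)](_ : _ = norm2 Om (mrep (C j) t))//.
  by apply: inner_off_null => x Ox nx; exact: (material_derivative_rep VC rU jN tj Ox nx).
- by apply: eq_big_nat => j jN; rewrite (jump_rep rU jN).
- by have /= -> := trace_right_rep rU N1'.
- by have /= -> := trace_left_rep rU NN.
Qed.

Definition lin_density (f g : R * 'rV[R]_m -> R) e t : R :=
  inner Om (fun x => f (t, x)) (fun x => rep e t x + delta * mrep e t x)
  - bd_inner Om beta (inflow Om beta) (fun x => g (t, x)) (rep e t).

Definition discrete_lin u0 f g n E : R :=
  \sum_(1 <= j < n.+1) \int[mu]_(t in slab tn j) lin_density f g (E j) t
  + inner Om u0 (rep (E 1%N) (tn 0)).

Lemma linear_form_rep u0 f g E W : (1 <= N)%N ->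
  V_coefficients V N E -> represents E W ->
  linear_form Om beta delta N tn u0 f g W = discrete_lin u0 f g N E.
Proof.
move=> N1 VE rW; have N1' : (1 <= 1 <= N)%N by [].
rewrite /linear_form /discrete_lin.
apply: (f_equal2 +%R); last by have /= -> := trace_right_rep rW N1'.
apply: eq_big_nat => j jN; apply: eq_Rintegral => t /set_mem tj.
apply: (f_equal2 (fun a b => a - b)); last by rewrite (rW _ _ jN tj).
apply: inner_off_null => x Ox nx; first by [].
by rewrite (material_derivative_rep VE rW jN tj Ox nx) (rW _ _ jN tj).
Qed.

End coefficients.

(** * Square integrable data *)

Section square_integrable_functions.
Context d (T : measurableType d) (R : realType) (nu : {measure set T -> \bar R}).
Variable D : set T.
Hypotheses (mD : measurable D) (finD : (nu D < +oo)%E).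
Implicit Types (u v w phi : T -> R).
Local Notation bm := bounded_measurable.
Local Notation sq := (square_integrable nu D).

Lemma le_sqr_norm (x : R) : `|x| <= 1 + x ^+ 2.
Proof.
rewrite -(real_normK (num_real x)) -subr_ge0.
have := sqr_ge0 (`|x| - 2^-1); set y := `|x|; nra.
Qed.

Lemma sq_integrable u : sq u -> nu.-integrable D (EFin \o (fun x => u x ^+ 2)).
Proof.
move=> [mu' iu]; apply/integrableP; split.
  by apply/measurable_EFinP; exact: measurable_funX.
rewrite (eq_integral (fun x => (u x ^+ 2)%:E))//.
by move=> x _ /=; rewrite ger0_norm// sqr_ge0.
Qed.

Lemma sq_le_integrable u v (M : R) : sq u -> measurable_fun D v ->
  (forall x, D x -> `|v x| <= M * (1 + u x ^+ 2)) -> nu.-integrable D (EFin \o v).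
Proof.
move=> hu mv vM.
have i1 : nu.-integrable D (EFin \o (fun x => M * (1 + u x ^+ 2))).
  rewrite (_ : EFin \o _ = (fun x => M%:E * ((1%:E) + (u x ^+ 2)%:E))%E)//.
  apply: integrableZl => //; apply: integrableD => //; last exact: sq_integrable.
  by apply: (@bm_integrable _ _ _ _ _ mD finD (fun=> 1)); exact: bm_cst.
apply: le_integrable i1 => //; first exact/measurable_EFinP.
move=> x Dx /=; rewrite lee_fin (le_trans (vM x Dx))//.
by rewrite ler_norm.
Qed.

Lemma sq_bm_integrable u phi : sq u -> bm phi ->
  nu.-integrable D (EFin \o (fun x => u x * phi x)).
Proof.
move=> hu [mphi [M hM]]; apply: (sq_le_integrable (M := M) hu).
  by apply: measurable_funM; [exact: hu.1|exact: measurable_funTS].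
move=> x Dx; rewrite normrM mulrC ler_pM ?le_sqr_norm//.
Qed.

Lemma sq2_bm_integrable u phi : sq u -> bm phi ->
  nu.-integrable D (EFin \o (fun x => u x ^+ 2 * phi x)).
Proof.
move=> hu [mphi [M hM]]; apply: (sq_le_integrable (M := M) hu).
  apply: measurable_funM; last exact: measurable_funTS.
  by apply: measurable_funX; exact: hu.1.
move=> x Dx; rewrite normrM mulrC ler_pM// ger0_norm ?sqr_ge0//.
by rewrite lerDr.
Qed.

Lemma sq_young w u phi e : sq u -> bm w -> bm phi -> 0 < e ->
  2 * \int[nu]_(x in D) (w x * u x * phi x) <=
  e * \int[nu]_(x in D) (`|w x| * u x ^+ 2)
  + e^-1 * \int[nu]_(x in D) (`|w x| * phi x ^+ 2).
Proof.
move=> hu bw bphi e0.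
have i1 : nu.-integrable D (EFin \o (fun x => w x * u x * phi x)).
  rewrite (_ : (fun x => _) = fun x => u x * (w x * phi x)).
    by apply: sq_bm_integrable => //; exact: bmM.
  by apply/funext => x; ring.
have i2 : nu.-integrable D (EFin \o (fun x => `|w x| * u x ^+ 2)).
  rewrite (_ : (fun x => _) = fun x => u x ^+ 2 * `|w x|).
    by apply: sq2_bm_integrable => //; exact: bm_norm.
  by apply/funext => x; ring.
have i3 : nu.-integrable D (EFin \o (fun x => `|w x| * phi x ^+ 2)).
  apply: bm_integrable => //; apply: bmM; first exact: bm_norm.
  by under eq_fun do rewrite expr2; exact: bmM.
rewrite -(RintegralZl 2 mD i1) -(RintegralZl e mD i2) -(RintegralZl e^-1 mD i3).
have j2 : nu.-integrable D (EFin \o (fun x => e * (`|w x| * u x ^+ 2))).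
  exact: (integrableZl mD e i2).
have j3 : nu.-integrable D (EFin \o (fun x => e^-1 * (`|w x| * phi x ^+ 2))).
  exact: (integrableZl mD e^-1 i3).
rewrite -(RintegralD mD j2 j3).
apply: (le_Rintegral mD); first exact: (integrableZl mD 2 i1).
  exact: (integrableD mD j2 j3).
move=> x _; apply: (@le_trans _ _ (`|w x| * (2 * (`|u x| * `|phi x|)))).
  rewrite (le_trans (ler_norm _))// !normrM (ger0_norm (ler0n _ 2)).
  by rewrite le_eqVlt; apply/orP; left; apply/eqP; ring.
have := sqr_ge0 (e * `|u x| - `|phi x|).
have ei : 0 < e^-1 by rewrite invr_gt0.
move=> /(mulr_ge0 (ltW ei)) /(mulr_ge0 (normr_ge0 (w x))).
rewrite -!(real_normK (num_real (u x))) -!(real_normK (num_real (phi x))).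
rewrite (_ : `|w x| * (e^-1 * _) = e * (`|w x| * `|u x| ^+ 2) +
  e^-1 * (`|w x| * `|phi x| ^+ 2) - `|w x| * (2 * (`|u x| * `|phi x|))) ?subr_ge0//.
by field; rewrite gt_eqF.
Qed.

Local Notation mu := (@lebesgue_measure R).

(** Square integrability on a product controls the sections at almost every [t] only. The estimates
    are carried out at each fixed [t] and then integrated, hence the requirement for all [t] and the
    integrability in [t] against fixed test functions. *)
Definition regular_data (h : R * T -> R) := (forall t, sq (fun x => h (t, x))) /\
  forall phi, bm phi ->
    mu.-integrable setT (EFin \o (fun t => \int[nu]_(x in D) (h (t, x) * phi x))) /\
    mu.-integrable setT (EFin \o (fun t => \int[nu]_(x in D) (h (t, x) ^+ 2 * phi x))).

End square_integrable_functions.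

Section regular_data.
Context (R : realType) d (T : measurableType d).
Variable nu : {sigma_finite_measure set T -> \bar R}.
Variable D : set T.
Hypotheses (mD : measurable D) (finD : (nu D < +oo)%E).
Local Notation bm := bounded_measurable.
Local Notation mu := (@lebesgue_measure R).
Implicit Types h : R * T -> R.

(** [Rintegral] replaces an infinite integral of a section by 0, which can only decrease the
    absolute value. *)
Lemma integrable_section_Rintegral (K : measurableTypeR R * T -> R) :
  (mu \x nu)%E.-integrable setT (EFin \o K) ->
  mu.-integrable setT (EFin \o (fun t => \int[nu]_x K (t, x))).
Proof.
move=> iK; have iF := integrable_fubini_F iK.
apply: le_integrable iF => //.
  apply/measurable_EFinP; apply: measurableT_comp => //.
  exact: (measurable_fubini_F iK).
move=> t _; rewrite /= /Rintegral /fubini_F /=.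
by case: (\int[nu]_x (K (t, x))%:E)%E => [s| |] //=; rewrite ?normr0 ?leey.
Qed.

(** By Tonelli the times at which the section is not square integrable lie in a null set [B]. The
    representative is [h] cut off outside [A] times [D] and set to 0 on [B]. *)
Lemma regular_representative (A : set (measurableTypeR R)) h : measurable A -> (mu A < +oo)%E ->
  square_integrable (mu \x nu)%E (A `*` D) h ->
  exists2 h', regular_data nu D h' &
    exists B : set (measurableTypeR R), [/\ measurable B, mu B = 0%E &
      forall t x, A t -> ~ B t -> D x -> h' (t, x) = h (t, x)].
Proof.
move=> mA finA [mh ih].
have mAD : measurable (A `*` D) by exact: measurableX.
pose H0 : measurableTypeR R * T -> R := h \_ (A `*` D).
have mH0 : measurable_fun setT H0.
  by apply/(measurable_restrict h mAD measurableT); rewrite setTI.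
have mH02 : measurable_fun setT (fun p => ((H0 p) ^+ 2)%:E).
  by apply/measurable_EFinP; exact: measurable_funX.
have H02 p : (0 <= ((H0 p) ^+ 2)%:E)%E by rewrite lee_fin sqr_ge0.
have iH0 : (\int[mu \x nu]_p ((H0 p) ^+ 2)%:E < +oo)%E.
  apply: le_lt_trans ih; rewrite [leRHS]integral_mkcond.
  rewrite le_eqVlt; apply/orP; left; apply/eqP; apply: eq_integral => p _.
  by rewrite /H0 !patchE; case: ifP => //; rewrite expr0n.
pose S := fubini_F nu (fun p => ((H0 p) ^+ 2)%:E).
have mS : measurable_fun setT S by exact: measurable_fun_fubini_tonelli_F.
have S0 t : (0 <= S t)%E by apply: integral_ge0 => x _; exact: H02.
have iS : mu.-integrable setT S.
  apply/integrableP; split => //.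
  rewrite (eq_integral S); last by move=> t _; rewrite gee0_abs.
  by rewrite /S -(fubini_tonelli1 _ mH02 H02).
have [B [mB B0 hB]] := integrable_ae measurableT iS.
pose H p := \1_(~` B) p.1 * H0 p.
have mH : measurable_fun setT H.
  apply: measurable_funM => //.
  have m1 : measurable_fun setT (\1_(~` B) : measurableTypeR R -> R).
    by apply: measurable_indic; exact: measurableC.
  exact: (measurableT_comp m1 measurable_fst).
have HD t x : ~ D x -> H (t, x) = 0.
  move=> nD; rewrite /H /H0 patchE memNset ?mulr0// => -[_ /=]; exact: nD.
have HA t x : ~ A t -> H (t, x) = 0.
  move=> nA; rewrite /H /H0 patchE memNset ?mulr0// => -[/= ?]; contradiction.
have H_H0 p : H p ^+ 2 <= H0 p ^+ 2.
  rewrite /H exprMn indicE; case: (_ \in _); rewrite /= ?expr1n ?mul1r//.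
  by rewrite expr0n /= mul0r sqr_ge0.
have sqH : square_integrable (mu \x nu)%E setT H.
  split => //; apply: le_lt_trans iH0; apply: ge0_le_integral => //.
  - by move=> p _; rewrite lee_fin sqr_ge0.
  - by apply/measurable_EFinP; exact: measurable_funX.
  - by move=> p _; rewrite lee_fin.
have sqHAD : square_integrable (mu \x nu)%E (A `*` D) H.
  split; first exact: measurable_funTS.
  apply: le_lt_trans sqH.2; apply: ge0_subset_integral => //.
  - by apply/measurable_EFinP; exact: measurable_funX.
  - by move=> p _; rewrite lee_fin sqr_ge0.
have finAD : ((mu \x nu)%E (A `*` D) < +oo)%E.
  by rewrite product_measure1E// lte_mul_pinfty// ge0_fin_numE.
have int_setT (K : measurableTypeR R * T -> R) :
    (mu \x nu)%E.-integrable (A `*` D) (EFin \o K) ->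
    (forall t x, ~ A t -> K (t, x) = 0) -> (forall t x, ~ D x -> K (t, x) = 0) ->
    mu.-integrable setT (EFin \o (fun t => \int[nu]_(x in D) K (t, x))).
  move=> iK KA KD.
  have -> : (fun t => \int[nu]_(x in D) K (t, x)) = fun t => \int[nu]_x K (t, x).
    apply/funext => t; rewrite Rintegral_mkcond; apply: eq_Rintegral => x _.
    by rewrite patchE; case: ifPn => // /negP nD; rewrite KD// => /mem_set.
  apply: integrable_section_Rintegral.
  rewrite (_ : EFin \o K = (EFin \o K) \_ (A `*` D)).
    exact/(integrable_mkcond _ mAD).
  apply/funext => -[t x]; rewrite patchE; case: ifPn => // /negP nAD /=.
  have [At|nA] := pselect (A t); last by rewrite KA.
  by rewrite KD// => Dx; apply: nAD; exact: mem_set.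
have bm_snd (phi : T -> R) : bm phi -> bm (fun p : measurableTypeR R * T => phi p.2).
  by move=> bphi; exact: (bm_comp measurable_snd bphi).
exists H; last first.
  exists B; split => // t x At nBt Dx.
  rewrite /H /H0 /= patchE !mem_set// indicE mem_set//= mul1r//.
split.
  move=> t; split.
    by apply: measurable_funTS; exact: (measurable_fun_pair2 _ mH).
  have [Bt|nBt] := pselect (B t).
    rewrite (eq_integral (fun=> 0%E)) ?integral0 ?ltry// => x _.
    rewrite /H indicE memNset ?mul0r ?expr0n//; exact.
  have : (S t < +oo)%E.
    rewrite -ge0_fin_numE//; apply: contrapT => nS; apply: nBt; apply: hB => /=.
    by move=> h1; apply: nS; exact: h1.
  apply: le_lt_trans; rewrite /S /fubini_F.
  have -> : (\int[nu]_(x in D) (H (t, x) ^+ 2)%:E = \int[nu]_x (H (t, x) ^+ 2)%:E)%E.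
    rewrite integral_mkcond; apply: eq_integral => x _.
    rewrite patchE; case: ifPn => // /negP nD.
    by rewrite HD ?expr0n// => /mem_set.
  have mHt : measurable_fun setT (fun x => H (t, x)) by exact: (measurable_fun_pair2 _ mH).
  have mH0t : measurable_fun setT (fun x => H0 (t, x)) by exact: (measurable_fun_pair2 _ mH0).
  apply: ge0_le_integral => //.
  - by move=> x _; rewrite lee_fin sqr_ge0.
  - by apply/measurable_EFinP; exact: measurable_funX.
  - by apply/measurable_EFinP; exact: measurable_funX.
  - by move=> x _; rewrite lee_fin.
move=> phi bphi; split.
- apply: (int_setT (fun p => H p * phi p.2)).
  + exact: (sq_bm_integrable mAD finAD sqHAD (bm_snd _ bphi)).
  + by move=> t x nA; rewrite HA// mul0r.
  + by move=> t x nD; rewrite HD// mul0r.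
- apply: (int_setT (fun p => H p ^+ 2 * phi p.2)).
  + exact: (sq2_bm_integrable mAD finAD sqHAD (bm_snd _ bphi)).
  + by move=> t x nA; rewrite HA// expr0n mul0r.
  + by move=> t x nD; rewrite HD// expr0n mul0r.
Qed.

End regular_data.

Lemma regular_representative_surface (R : realType) m (Om D : set 'rV[R]_m)
    (A : set (measurableTypeR R)) h :
  (surface_measure Om setT < +oo)%E -> measurable D ->
  measurable A -> (lebesgue_measure A < +oo)%E ->
  square_integrable (lebesgue_measure \x surface_measure Om)%E (A `*` D) h ->
  exists2 h', regular_data (surface_measure Om) D h' &
    exists B : set (measurableTypeR R), [/\ measurable B, lebesgue_measure B = 0%E &
      forall t x, A t -> ~ B t -> D x -> h' (t, x) = h (t, x)].
Proof.
move=> nuT mD mA finA.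
have sf : sigma_finite setT (surface_measure Om).
  by exists (fun=> setT); [rewrite bigcup_const|move=> i; split].
pose S := Measure_isSigmaFinite.Build _ _ _ (surface_measure Om) sf.
pose nu : {sigma_finite_measure set 'rV[R]_m -> \bar R} := HB.pack (surface_measure Om) S.
have finD : (nu D < +oo)%E by apply: le_lt_trans nuT; apply: le_measure; rewrite ?inE.
exact: (regular_representative (nu := nu) mD finD mA finA).
Qed.

(** * Bounds for the linear form *)

Section data_estimates.
Context (R : realType) (m : nat) (Om : set 'rV[R]_m) (beta : 'rV[R]_m).
Context (V : set ('rV[R]_m -> R)) (dd : ('rV[R]_m -> R) -> 'rV[R]_m -> R).
Context (Nn : set 'rV[R]_m).
Hypothesis ES : energy_space Om beta V dd Nn.
Variables (r : nat) (tn : nat -> R) (delta : R).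
Hypothesis delta0 : 0 < delta.
Implicit Types (c e : 'I_r.+1 -> 'rV[R]_m -> R) (C E : nat -> 'I_r.+1 -> 'rV[R]_m -> R).
Implicit Types (f g : R * 'rV[R]_m -> R) (u v phi : 'rV[R]_m -> R).

Let mOm := es_mOm ES.
Let finOm := es_finOm ES.
Let mi := es_minflow ES.
Let fi := es_fin_surface ES mi.
Let bn := es_normal ES.
Local Notation bm := bounded_measurable.
Local Notation mu := (@lebesgue_measure R).
Local Notation mrep := (mrep dd).
Local Notation inflow := (inflow Om beta).
Local Notation normal := (outward_normal Om).
Local Notation sq := (square_integrable lebesgue_rV Om).
Local Notation lin_density := (lin_density Om beta dd delta).

Lemma inner_sq_young u phi (k : R) : sq u -> bm phi -> 0 < k ->
  2 * inner Om u phi <= k * norm2 Om u + k^-1 * norm2 Om phi.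
Proof.
move=> hu bphi k0; have := sq_young mOm finOm hu (@bm_cst _ _ R 1) bphi k0.
have E1 : \int[lebesgue_rV]_(x in Om) (1 * u x * phi x) = inner Om u phi.
  by apply: eq_Rintegral => x _; rewrite mul1r.
have E2 v : \int[lebesgue_rV]_(x in Om) (`|1| * v x ^+ 2) = norm2 Om v.
  by apply: eq_Rintegral => x _; rewrite normr1 mul1r expr2.
by rewrite E1 !E2.
Qed.

Lemma bd_inner_young u phi (k : R) : square_integrable (surface_measure Om) inflow u ->
  bm phi -> 0 < k ->
  - (2 * bd_inner Om beta inflow u phi) <=
  k * bd_norm2 Om beta inflow u + k^-1 * bd_norm2 Om beta inflow phi.
Proof.
move=> hu bphi k0; have := sq_young mi fi hu bn (bmN bphi) k0.
have -> : \int[surface_measure Om]_(x in inflow) (dotv beta (normal x) * u x * - phi x) =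
    - bd_inner Om beta inflow u phi.
  rewrite -mulN1r /bd_inner -RintegralZl//; first by apply: eq_Rintegral => x _; ring.
  rewrite (_ : (fun x => _) = fun x => u x * (dotv beta (normal x) * phi x)).
    by apply: (sq_bm_integrable mi fi hu); exact: bmM.
  by apply/funext => x; ring.
have -> : \int[surface_measure Om]_(x in inflow) (`|dotv beta (normal x)| * (- phi x) ^+ 2) =
    bd_norm2 Om beta inflow phi.
  by apply: eq_Rintegral => x _; rewrite sqrrN.
by rewrite mulrN.
Qed.

Lemma bd_norm2_inflow_le u : bm u ->
  bd_norm2 Om beta inflow u <= bd_norm2 Om beta (boundary Om) u.
Proof.
move=> bu; have mb := es_mboundary ES; have fb := es_fin_surface ES mb.
pose w x := `|dotv beta (normal x)| * u x ^+ 2.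
have bw : bm w.
  by apply: bmM; [exact: bm_norm|under eq_fun do rewrite expr2; exact: bmM].
have n1 := integrable_fin_num mi (bm_integrable mi fi bw).
have n2 := integrable_fin_num mb (bm_integrable mb fb bw).
apply: (fine_le n1 n2); apply: ge0_subset_integral => //.
- by apply/measurable_EFinP; apply: measurable_funTS; exact: bw.1.
- by move=> x _; rewrite lee_fin mulr_ge0 ?sqr_ge0.
- by move=> x [].
Qed.

Definition data_density f g t :=
  norm2 Om (fun x => f (t, x)) + bd_norm2 Om beta inflow (fun x => g (t, x)).

Lemma data_density_ge0 f g t : 0 <= data_density f g t.
Proof. by rewrite addr_ge0 ?norm2_ge0 ?bd_norm2_ge0. Qed.

Section regular.
Variables f g : R * 'rV[R]_m -> R.
Hypothesis rf : regular_data lebesgue_rV Om f.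
Hypothesis rg : regular_data (surface_measure Om) inflow g.

Lemma innerDr_sq t u v a : bm u -> bm v ->
  inner Om (fun x => f (t, x)) (fun x => u x + a * v x) =
  inner Om (fun x => f (t, x)) u + a * inner Om (fun x => f (t, x)) v.
Proof.
move=> bu bv; have hf := rf.1 t.
have iu := sq_bm_integrable mOm finOm hf bu.
have iv := sq_bm_integrable mOm finOm hf bv.
rewrite /inner -(RintegralZl a mOm iv).
have iv' := sq_bm_integrable mOm finOm hf (bmZ a bv).
have iv2 : lebesgue_rV.-integrable Om (EFin \o (fun x => a * (f (t, x) * v x))).
  exact: (integrableZl mOm a iv).
rewrite -(RintegralD mOm iu iv2).
by apply: eq_Rintegral => x _; ring.
Qed.

(** Young's inequality with weight 2 in the drift and inflow terms leaves only half of the drift and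
    of the flux to be absorbed. The weight [a] of the remaining term is kept free, because the two
    stability estimates absorb [norm2 Om (rep c t)] differently. *)
Lemma lin_density_bound a c t : 0 < a -> (forall k, V (c k)) ->
  2 * lin_density f g c t <= (a^-1 + 2 * delta + 2) * data_density f g t
    + a * norm2 Om (rep c t)
    + 2^-1 * (delta * norm2 Om (mrep c t) + bd_norm2 Om beta (boundary Om) (rep c t)).
Proof.
have arith (i1 i2 b bi bb F G aF aG dF dG an dn : R) : bi <= bb ->
    - (2 * b) <= 2 * G + 2^-1 * bi -> 2 * i1 <= aF + an -> 0 <= aG -> 0 <= dG ->
    2 * i2 <= 2 * dF + 2^-1 * dn -> 0 <= F ->
    2 * (i1 + i2 - b) <= aF + aG + 2 * dF + 2 * dG + 2 * F + 2 * G + an + 2^-1 * (dn + bb).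
  by move=> *; lra.
move=> a0 Vc; have br := bm_rep ES t Vc; have bmr := bm_mrep ES t Vc.
rewrite /lin_density /data_density innerDr_sq//.
have ai : 0 < a^-1 by rewrite invr_gt0.
have two : (0 : R) < 2 by [].
have := inner_sq_young (rf.1 t) br ai; rewrite invrK.
have := inner_sq_young (rf.1 t) bmr two.
have := bd_inner_young (rg.1 t) br two.
have := bd_norm2_inflow_le br.
have := norm2_ge0 Om (fun x => f (t, x)).
have := bd_norm2_ge0 Om beta inflow (fun x => g (t, x)).
set F := norm2 Om (fun x => f (t, x)); set G := bd_norm2 _ _ inflow (fun x => g (t, x)).
set i1 := inner Om _ (rep c t); set i2 := inner Om _ (mrep c t).
set b := bd_inner _ _ _ _ _; set n1 := norm2 Om (rep c t); set n2 := norm2 Om (mrep c t).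
set bi := bd_norm2 _ _ inflow (rep c t); set bb := bd_norm2 _ _ (boundary Om) (rep c t).
move=> G0 F0 h1 h2 h3 h4.
have {}h4 : 2 * i1 <= a^-1 * F + a * n1 by exact: h4.
have aG : 0 <= a^-1 * G by rewrite mulr_ge0// ltW.
have dG : 0 <= delta * G by rewrite mulr_ge0// ltW.
have h5 := ler_wpM2l (ltW delta0) h3.
rewrite (_ : delta * (2 * i2) = 2 * (delta * i2)) in h5; last by ring.
rewrite (_ : delta * (2 * F + 2^-1 * n2) = 2 * (delta * F) + 2^-1 * (delta * n2)) in h5;
  last by ring.
have -> : (a^-1 + 2 * delta + 2) * (F + G) =
  a^-1 * F + a^-1 * G + 2 * (delta * F) + 2 * (delta * G) + 2 * F + 2 * G by ring.
exact: arith h1 h2 h4 aG dG h5 F0.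
Qed.

Let slab_integrable j F := mu.-integrable (slab tn j) (EFin \o F : measurableTypeR R -> \bar R).

Lemma slab_integrable_mul_t j F : slab_integrable j F ->
  slab_integrable j (fun t => t * F t).
Proof.
move=> iF; apply: (@integrableMr _ _ _ _ _ (measurable_slab tn j) (fun t => t)) iF.
  exact: measurable_id.
exists (`|tn j.-1| + `|tn j|); split; first exact: num_real.
move=> M hM t /andP[t1 t2]; apply: le_trans (ltW hM).
rewrite /= ler_norml; apply/andP; split.
  rewrite (le_trans _ (ltW t1))// lerNl (le_trans (ler_norm _))// normrN lerDl//.
by rewrite (le_trans (ltW t2))// (le_trans (ler_norm _))// lerDr.
Qed.

(** [regular_data] speaks of test functions independent of time. Induction on the polynomial extends
    it, as multiplication by [t] is bounded on a slab. *)
Lemma regular_time_poly (nu : {measure set 'rV[R]_m -> \bar R}) D h j W W' :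
  measurable D -> (nu D < +oo)%E -> regular_data nu D h -> time_poly W W' ->
  slab_integrable j (fun t => \int[nu]_(x in D) (h (t, x) * W t x)).
Proof.
move=> mD finD [hs hi]; elim=> [phi bphi|W1 W1' tW IH|W1 W1' W2 W2' tW1 IH1 tW2 IH2].
- have [h1 _] := hi _ bphi; apply: integrableS h1 => //; exact: measurable_slab.
- have := slab_integrable_mul_t IH; rewrite /slab_integrable.
  rewrite (_ : (fun t => t * _) = fun t => \int[nu]_(x in D) (h (t, x) * (t * W1 t x)))//.
  apply/funext => t; have i1 := sq_bm_integrable mD finD (hs t) (time_poly_bm t tW).
  by rewrite -(RintegralZl t mD i1); apply: eq_Rintegral => x _; ring.
- have := integrableD (measurable_slab tn j) IH1 IH2; rewrite /slab_integrable.
  rewrite (_ : ((EFin \o _) \+ _)%E =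
    EFin \o (fun t => \int[nu]_(x in D) (h (t, x) * (W1 t x + W2 t x))))//.
  apply/funext => t; have i1 := sq_bm_integrable mD finD (hs t) (time_poly_bm t tW1).
  have i2 := sq_bm_integrable mD finD (hs t) (time_poly_bm t tW2).
  rewrite /= -EFinD -(RintegralD mD i1 i2); congr EFin.
  by apply: eq_Rintegral => x _; ring.
Qed.

Lemma lin_density_integrable j c : (forall k, V (c k)) ->
  slab_integrable j (lin_density f g c).
Proof.
move=> Vc; have hc := rep_time_poly (fun k => es_bm ES (Vc k)).
have [mc hmc] := mrep_time_poly ES Vc.
have i1 := regular_time_poly j mOm finOm rf (time_poly_add hc (time_polyZ delta hmc)).
have i2 := regular_time_poly j mi fi rg (time_poly_weight bn hc).
have := integrableB (measurable_slab tn j) i1 i2; rewrite /slab_integrable.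
rewrite (_ : ((EFin \o _) \- _)%E = EFin \o lin_density f g c)//.
apply/funext => t; rewrite /= -EFinB; congr (_ - _)%:E.
by apply: eq_Rintegral => x _; ring.
Qed.

Lemma data_density_integrable j : slab_integrable j (data_density f g).
Proof.
have mS := measurable_slab tn j.
have [_ i1] := rf.2 _ (@bm_cst _ _ R 1); have [_ i2] := rg.2 _ (bm_norm bn).
have {}i1 := integrableS measurableT mS (@subsetT _ _) i1.
have {}i2 := integrableS measurableT mS (@subsetT _ _) i2.
have := integrableD mS i1 i2; rewrite /slab_integrable.
rewrite (_ : ((EFin \o _) \+ _)%E = EFin \o data_density f g)//.
apply/funext => t; rewrite /= -EFinD; congr (_ + _)%:E.
  by apply: eq_Rintegral => x _; rewrite mulr1 expr2.
by apply: eq_Rintegral => x _; rewrite mulrC.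
Qed.

Lemma slab_lin_bound a c j : 0 < a -> (forall k, V (c k)) ->
  2 * \int[mu]_(t in slab tn j) lin_density f g c t <=
  (a^-1 + 2 * delta + 2) * \int[mu]_(t in slab tn j) data_density f g t
  + a * \int[mu]_(t in slab tn j) norm2 Om (rep c t)
  + 2^-1 * (delta * \int[mu]_(t in slab tn j) norm2 Om (mrep c t)
            + \int[mu]_(t in slab tn j) bd_norm2 Om beta (boundary Om) (rep c t)).
Proof.
move=> a0 Vc; have mS := measurable_slab tn j.
have hc := rep_time_poly (fun k => es_bm ES (Vc k)).
have [mc hmc] := mrep_time_poly ES Vc.
have p1 := integrable_slab tn j (inner_polynomial ES hc hc).
have p2 := integrable_slab tn j (inner_polynomial ES hmc hmc).
have p3 := integrable_slab tn j (bd_norm2_polynomial ES (es_mboundary ES) hc).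
have p2' := integrableZl mS delta p2.
have p4 := integrableD mS p2' p3.
have p5 := integrableZl mS 2^-1 p4.
have p6 := integrableZl mS a p1.
have p7 := integrableZl mS (a^-1 + 2 * delta + 2) (data_density_integrable j).
have p8 := integrableD mS p7 p6.
have p9 := integrableD mS p8 p5.
have l1 := lin_density_integrable j Vc.
rewrite -(RintegralZl 2 mS l1) -(RintegralZl delta mS p2) -(RintegralD mS p2' p3).
rewrite -(RintegralZl 2^-1 mS p4) -(RintegralZl a mS p1).
rewrite -(RintegralZl _ mS (data_density_integrable j)).
rewrite -(RintegralD mS p7 p6) -(RintegralD mS p8 p5).
apply: (le_Rintegral mS) p9 _; first exact: (integrableZl mS 2 l1).
by move=> t _; exact: lin_density_bound.
Qed.

End regular.

End data_estimates.

(** * Stability in terms of coefficients *)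

Section stability.
Context (R : realType) (m : nat) (Om : set 'rV[R]_m) (beta : 'rV[R]_m).
Context (V : set ('rV[R]_m -> R)) (dd : ('rV[R]_m -> R) -> 'rV[R]_m -> R).
Context (Nn : set 'rV[R]_m).
Hypothesis ES : energy_space Om beta V dd Nn.
Variables (r N : nat) (tn : nat -> R) (sigma delta : R).
Hypothesis grid : forall j, (j < N)%N -> tn j < tn j.+1.
Hypotheses (sigma0 : 0 <= sigma) (delta0 : 0 < delta).
Hypothesis sigma_delta : sigma * delta <= 1.
Implicit Types (C : nat -> 'I_r.+1 -> 'rV[R]_m -> R).

Local Notation mu := (@lebesgue_measure R).
Local Notation mrep := (mrep dd).
Local Notation inflow := (inflow Om beta).
Local Notation discrete_lin := (discrete_lin Om beta dd tn delta).
Local Notation discrete_bil := (discrete_bil Om beta dd tn sigma delta).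
Local Notation discrete_sd := (discrete_sd Om beta dd tn sigma delta).
Local Notation data_density := (data_density Om beta).

Let grid1 j : (1 <= j <= N)%N -> tn j.-1 < tn j.
Proof. by case: j => // j /= jN; exact: grid. Qed.

Definition slab_norm2 C j := \int[mu]_(t in slab tn j) norm2 Om (rep (C j) t).

Definition slab_drift C j := \int[mu]_(t in slab tn j) norm2 Om (mrep (C j) t).

Definition slab_flux C j :=
  \int[mu]_(t in slab tn j) bd_norm2 Om beta (boundary Om) (rep (C j) t).

Definition slab_data f g j := \int[mu]_(t in slab tn j) data_density f g t.

Lemma slab_norm2_ge0 C j : 0 <= slab_norm2 C j.
Proof. by apply: Rintegral_ge0 => t _; exact: norm2_ge0. Qed.

Lemma slab_drift_ge0 C j : 0 <= slab_drift C j.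
Proof. by apply: Rintegral_ge0 => t _; exact: norm2_ge0. Qed.

Lemma slab_flux_ge0 C j : 0 <= slab_flux C j.
Proof. by apply: Rintegral_ge0 => t _; exact: bd_norm2_ge0. Qed.

Lemma slab_data_ge0 f g j : 0 <= slab_data f g j.
Proof. by apply: Rintegral_ge0 => t _; exact: data_density_ge0. Qed.

Lemma discrete_sdE n C : V_coefficients V n C -> discrete_sd n C =
  \sum_(1 <= j < n.+1) (sigma * slab_norm2 C j + delta * slab_drift C j + slab_flux C j)
  + \sum_(1 <= j < n) norm2 Om (rep_jump tn C j)
  + norm2 Om (rep (C 1%N) (tn 0)) + norm2 Om (rep (C n) (tn n)).
Proof.
move=> VC; rewrite /discrete_sd; apply: (f_equal2 +%R (f_equal2 +%R (f_equal2 +%R _ _) _) _) => //.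
apply: eq_big_nat => j jn; have Vc k : V (C j k) by exact: VC.
have mS := measurable_slab tn j.
have hc := rep_time_poly (fun k => es_bm ES (Vc k)).
have [mc hmc] := mrep_time_poly ES Vc.
have p1 := integrable_slab tn j (inner_polynomial ES hc hc).
have p2 := integrable_slab tn j (inner_polynomial ES hmc hmc).
have p3 := integrable_slab tn j (bd_norm2_polynomial ES (es_mboundary ES) hc).
have p1' := integrableZl mS sigma p1.
have p2' := integrableZl mS delta p2.
have p4 := integrableD mS p1' p2'.
rewrite /slab_norm2 /slab_drift /slab_flux.
rewrite -(RintegralZl sigma mS p1) -(RintegralZl delta mS p2).
by rewrite -(RintegralD mS p1' p2') -(RintegralD mS p4 p3).
Qed.

Variables (u0 : 'rV[R]_m -> R) (f g : R * 'rV[R]_m -> R).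
Hypothesis ru : square_integrable lebesgue_rV Om u0.
Hypothesis rf : regular_data lebesgue_rV Om f.
Hypothesis rg : regular_data (surface_measure Om) inflow g.

Definition discrete_data n := \sum_(1 <= j < n.+1) slab_data f g j + norm2 Om u0.

Lemma discrete_data_le n : (n <= N)%N -> discrete_data n <= discrete_data N.
Proof.
move=> nN; rewrite lerD2r (@big_cat_nat _ _ _ n.+1 1 N.+1)//= lerDl.
by apply: sumr_ge0 => j _; exact: slab_data_ge0.
Qed.

Lemma discrete_data_ge0 n : 0 <= discrete_data n.
Proof. by rewrite addr_ge0 ?norm2_ge0// sumr_ge0// => j _; exact: slab_data_ge0. Qed.

(** The initial datum is treated with weight 2 as well, so half of the initial term of the norm is
    left for absorption. *)
Lemma discrete_lin_bound a n C : 0 < a -> (1 <= n <= N)%N -> V_coefficients V n C ->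
  2 * discrete_lin u0 f g n C <= (a^-1 + 2 * delta + 2) * discrete_data n
  + a * \sum_(1 <= j < n.+1) slab_norm2 C j
  + 2^-1 * \sum_(1 <= j < n.+1) (delta * slab_drift C j + slab_flux C j)
  + 2^-1 * norm2 Om (rep (C 1%N) (tn 0)).
Proof.
move=> a0 /andP[n1 nN] VC; rewrite /discrete_lin /discrete_data.
set S := \sum_(1 <= j < n.+1) \int[mu]_(t in _) _.
have K0 : 0 <= a^-1 + 2 * delta.
  by rewrite addr_ge0 ?mulr_ge0 ?invr_ge0// ltW.
have Vc1 k : V (C 1%N k) by exact: VC.
have U := inner_sq_young ES ru (bm_rep ES (tn 0) Vc1) (ltr0n R 2).
have HS : 2 * S <= (a^-1 + 2 * delta + 2) * \sum_(1 <= j < n.+1) slab_data f g j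
    + a * \sum_(1 <= j < n.+1) slab_norm2 C j
    + 2^-1 * \sum_(1 <= j < n.+1) (delta * slab_drift C j + slab_flux C j).
  rewrite /S !mulr_sumr -!big_split /=; apply: ler_sum_nat => j /andP[j1 jn].
  by apply: (slab_lin_bound ES tn delta0 rf rg j a0) => k; apply: VC; rewrite j1.
have Q := mulr_ge0 K0 (norm2_ge0 Om u0).
have arith (k s i d0 d1 q b z : R) : 2 * s <= (k + 2) * d1 + q + b ->
    2 * i <= 2 * d0 + z -> 0 <= k * d0 -> 2 * (s + i) <= (k + 2) * (d1 + d0) + q + b + z.
  by rewrite !mulrDr !mulrDl; lra.
exact: arith HS U Q.
Qed.

Lemma discrete_stable_pos C : 0 < sigma -> (1 <= N)%N -> V_coefficients V N C ->
  discrete_bil N C C = discrete_lin u0 f g N C ->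
  discrete_sd N C <= (8 / sigma + 4) * discrete_data N.
Proof.
move=> s0 N1 VC BL; have NN : (1 <= N <= N)%N by rewrite N1 /=.
(* With [a = sigma / 2] half of the left-hand side absorbs all discrete terms on the right. As
   [delta <= 1 / sigma], the data constant [2 / sigma + 2 * delta + 2] is at most [4 / sigma + 2],
   and it is doubled in the end. *)
have s20 : 0 < sigma / 2 by rewrite divr_gt0.
have := discrete_lin_bound s20 NN VC; rewrite -BL => L.
have H := le_trans (discrete_coercive ES grid sigma0 delta0 sigma_delta NN VC) L.
have D0 := discrete_data_ge0 N.
have ds : delta <= sigma^-1 by rewrite -[leRHS]mul1r ler_pdivlMr// mulrC.
have K : ((sigma / 2)^-1 + 2 * delta + 2) * discrete_data N <=
    (4 / sigma + 2) * discrete_data N.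
  rewrite ler_wpM2r// invf_div (_ : 4 / sigma = 2 / sigma + 2 * sigma^-1); last by ring.
  by rewrite lerD2r lerD2l ler_pM2l.
have J0 : 0 <= \sum_(1 <= j < N) norm2 Om (rep_jump tn C j).
  by apply: sumr_ge0 => j _; exact: norm2_ge0.
have n0 := norm2_ge0 Om (rep (C 1%N) (tn 0)).
have nN := norm2_ge0 Om (rep (C N) (tn N)).
move: H; rewrite discrete_sdE// => H.
have E : \sum_(1 <= j < N.+1)
      (sigma * slab_norm2 C j + delta * slab_drift C j + slab_flux C j) =
    sigma * \sum_(1 <= j < N.+1) slab_norm2 C j +
    \sum_(1 <= j < N.+1) (delta * slab_drift C j + slab_flux C j).
  rewrite mulr_sumr -big_split; apply: eq_bigr => j _.
  by rewrite /= addrA.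
rewrite E in H *.
have arith (k d s q w j a b : R) : k <= (4 / s + 2) * d -> 0 <= j -> 0 <= a -> 0 <= b ->
    s * q + w + j + a + b <= k + s / 2 * q + 2^-1 * w + 2^-1 * a ->
    s * q + w + j + a + b <= (8 / s + 4) * d.
  rewrite (_ : (8 / s + 4) * d = 2 * ((4 / s + 2) * d)); last by ring.
  rewrite (_ : s / 2 * q = 2^-1 * (s * q)); last by ring.
  by move=> *; lra.
exact: arith K J0 n0 nN H.
Qed.

Lemma ex_max_nat (E : nat -> R) n : (1 <= n)%N ->
  exists2 k, (1 <= k <= n)%N & forall j, (1 <= j <= n)%N -> E j <= E k.
Proof.
elim: n => // -[_ _|n /(_ isT)[k kn hk] _].
  by exists 1%N => // j; rewrite -eqn_leq => /eqP <-.
have [Ek|Ek] := leP (E k) (E n.+2).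
  exists n.+2; first by rewrite /= leqnn.
  move=> j /andP[j1]; rewrite leq_eqVlt => /predU1P[->//|jn].
  by apply: le_trans Ek; apply: hk; rewrite j1.
exists k; first by case/andP: kn => -> kn; exact: leqW.
move=> j /andP[j1]; rewrite leq_eqVlt => /predU1P[->|jn]; first exact: ltW.
by apply: hk; rewrite j1.
Qed.

(* Without reaction the L2 norm on a slab is controlled by the energy at its
   end and by the drift; the energy at every grid point is bounded by testing
   with the truncated solution. *)
Lemma discrete_stable_truncated C T : tn 0 = 0 -> tn N = T -> (1 <= N)%N ->
  V_coefficients V N C ->
  (forall n, (1 <= n <= N)%N -> discrete_bil n C C = discrete_lin u0 f g n C) ->
  discrete_sd N C <= 4 * (4 * (T * (2 + 4 * T / delta)) + 2 * delta + 2) * discrete_data N.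
Proof.
have arith1 (S J a b c x y : R) : 0 <= S -> 0 <= J -> 0 <= a -> 0 <= b -> 0 <= c ->
    0 <= x -> 0 <= y ->
    x + c <= S + (a + b + c) + J + y + x /\ b <= S + (a + b + c) + J + y + x.
  by move=> *; split; lra.
have arith2 (s s' j x y : R) : s <= s' -> 0 <= j -> 0 <= y -> s + x <= s' + j + x + y.
  by move=> *; lra.
have arith3 (x y q h1 h2 e : R) : x <= y -> q <= 4^-1 * e -> h1 + h2 <= 2^-1 * e ->
    e <= x + q + h1 + h2 -> e <= 4 * y by move=> *; lra.
move=> t0 tN N1 VC BL; have NN : (1 <= N <= N)%N by rewrite N1 /=.
have VCn n : (n <= N)%N -> V_coefficients V n C.
  by move=> nN j k /andP[j1 jn]; apply: VC; rewrite j1 (leq_trans jn).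
have T0 : 0 < T.
  rewrite -tN -t0; have N0 : (1 <= 1 <= N)%N by rewrite N1.
  by apply: lt_le_trans (grid1 N0) _; apply: (grid_le grid); rewrite N1 leqnn.
pose h j := tn j - tn j.-1.
have h0 j : (1 <= j <= N)%N -> 0 <= h j by move=> jN; rewrite subr_ge0 ltW// grid1.
have hT j : (1 <= j <= N)%N -> h j <= T.
  move=> /andP[j1 jN]; rewrite /h -tN lerBlDr -[leLHS]addr0 lerD//.
    by apply: (grid_le grid); rewrite jN leqnn.
  rewrite -t0; apply: (grid_le grid); rewrite leq0n /=.
  exact: leq_trans (leq_pred j) jN.
(* [k] is the grid point with the largest truncated energy [M]. This [M] bounds end values, drifts
   and fluxes on all slabs, and it is itself the left-hand side of the estimate up to [k]. *)
have [k kN hk] := ex_max_nat (discrete_sd ^~ C) N1.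
set M := discrete_sd k C in hk.
have part n : (1 <= n <= N)%N ->
    norm2 Om (rep (C n) (tn n)) + slab_flux C n <= discrete_sd n C /\
    delta * slab_drift C n <= discrete_sd n C.
  move=> /andP[n1 nN]; rewrite discrete_sdE; last exact: VCn.
  rewrite (@big_nat_recr _ _ _ n 1)//=.
  have S0 : 0 <= \sum_(1 <= j < n)
      (sigma * slab_norm2 C j + delta * slab_drift C j + slab_flux C j).
    apply: sumr_ge0 => j _.
    exact: (addr_ge0 (addr_ge0 (mulr_ge0 sigma0 (slab_norm2_ge0 C j))
      (mulr_ge0 (ltW delta0) (slab_drift_ge0 C j))) (slab_flux_ge0 C j)).
  have J0 : 0 <= \sum_(1 <= j < n) norm2 Om (rep_jump tn C j).
    by apply: sumr_ge0 => j _; exact: norm2_ge0.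
  exact: (arith1 _ _ _ _ _ _ _ S0 J0 (mulr_ge0 sigma0 (slab_norm2_ge0 C n))
    (mulr_ge0 (ltW delta0) (slab_drift_ge0 C n)) (slab_flux_ge0 C n)
    (norm2_ge0 _ _) (norm2_ge0 _ _)).
have M0 : 0 <= M.
  have [h1 _] := part k kN; apply: le_trans h1.
  exact: addr_ge0 (norm2_ge0 _ _) (slab_flux_ge0 _ _).
(* By [slab_norm2_bound] and [h j <= T], slab [j] contributes at most [(2 + 4 T / delta) M h j], and
   the lengths add up to at most [T]. *)
pose kap := T * (2 + 4 * T / delta).
have kap0 : 0 < kap by rewrite mulr_gt0// addr_gt0// divr_gt0// mulr_gt0.
have slabM j : (1 <= j <= N)%N -> slab_norm2 C j <= (2 + 4 * T / delta) * M * h j.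
  move=> jN; have Vc i : V (C j i) by exact: VC.
  apply: le_trans (slab_norm2_bound ES grid jN Vc) _.
  rewrite -/(slab_flux C j) -/(slab_drift C j) -/(h j).
  have [h1 h2] := part j jN; have {}h1 := le_trans h1 (hk j jN).
  have {}h2 := le_trans h2 (hk j jN).
  have hj := h0 j jN; have hjT := hT j jN.
  have A1 := ler_wpM2l (mulr_ge0 (ler0n R 2) hj) h1.
  have A2 : h j ^+ 2 * slab_drift C j <= h j * (T / delta * M).
    rewrite expr2 -mulrA ler_wpM2l//.
    apply: (le_trans (ler_wpM2r (slab_drift_ge0 C j) hjT)).
    rewrite -mulrA ler_pM2l// mulrC ler_pdivlMr// mulrC.
    exact: h2.
  rewrite (_ : (2 + 4 * T / delta) * M * h j =
    2 * h j * M + 4 * (h j * (T / delta * M))); last by field; rewrite gt_eqF.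
  by apply: lerD; [exact: A1|rewrite -mulrA ler_pM2l].
have QM : \sum_(1 <= j < k.+1) slab_norm2 C j <= kap * M.
  case/andP: kN => k1 kN.
  apply: (@le_trans _ _ (\sum_(1 <= j < k.+1) (2 + 4 * T / delta) * M * h j)).
    apply: ler_sum_nat => j /andP[j1 jk]; apply: slabM.
    by rewrite j1 (leq_trans _ kN).
  rewrite -mulr_sumr /kap -[X in _ <= X]mulrA [X in _ <= X]mulrC ler_wpM2l//.
    by rewrite mulr_ge0// addr_ge0// divr_ge0 ?mulr_ge0// ltW.
  rewrite big_add1 /= telescope_sumr// t0 subr0 -tN.
  by apply: (grid_le grid); rewrite kN leqnn.
(* With this weight the energy integrals cost [M / 4] and the halved drift, flux and initial terms
   [M / 2]. The quarter of [M] that is left gives the final factor 4. *)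
pose eta := (4 * kap)^-1.
have eta0 : 0 < eta by rewrite invr_gt0 mulr_gt0.
case/andP: (kN) => k1 kN'.
have := discrete_lin_bound eta0 kN (VCn k kN'); rewrite -BL// => L.
have H := le_trans (discrete_coercive ES grid sigma0 delta0 sigma_delta kN (VCn k kN')) L.
have D1 := discrete_data_le kN'.
have half : 2^-1 * (\sum_(1 <= j < k.+1) (delta * slab_drift C j + slab_flux C j))
    + 2^-1 * norm2 Om (rep (C 1%N) (tn 0)) <= 2^-1 * M.
  rewrite -mulrDr ler_pM2l// /M discrete_sdE; last exact: VCn.
  have J0 : 0 <= \sum_(1 <= j < k) norm2 Om (rep_jump tn C j).
    by apply: sumr_ge0 => j _; exact: norm2_ge0.
  have S1 : \sum_(1 <= j < k.+1) (delta * slab_drift C j + slab_flux C j) <=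
      \sum_(1 <= j < k.+1) (sigma * slab_norm2 C j + delta * slab_drift C j + slab_flux C j).
    apply: ler_sum_nat => j _; rewrite -addrA lerDr mulr_ge0//.
    exact: slab_norm2_ge0.
  exact: arith2 S1 J0 (norm2_ge0 _ _).
have etaQ : eta * \sum_(1 <= j < k.+1) slab_norm2 C j <= 4^-1 * M.
  apply: le_trans (ler_wpM2l (ltW eta0) QM) _.
  by rewrite mulrA /eta invfM divfK ?gt_eqF.
have etaV : eta^-1 = 4 * kap by rewrite /eta invrK.
apply: le_trans (hk N NN) _.
have K0 : 0 <= 4 * kap + 2 * delta + 2.
  exact: (addr_ge0 (addr_ge0 (mulr_ge0 (ler0n _ 4) (ltW kap0))
    (mulr_ge0 (ler0n _ 2) (ltW delta0))) (ler0n _ 2)).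
have {}D1 := ler_wpM2l K0 D1.
rewrite etaV -/M in H; rewrite -/kap -mulrA.
exact: arith3 D1 etaQ half H.
Qed.

End stability.

(** * Existence and uniqueness *)

(** The indices will run through a generating family, so [G] may be singular although the form is
    definite on functions. A right-hand side that kills the kernel still lies in the row space, by
    [cokermx]. *)
Lemma solvable_of_kernel (K : fieldType) (J : finType) (G : J -> J -> K) (F : J -> K) :
  (forall z, (forall q, \sum_p G q p * z p = 0) -> \sum_p F p * z p = 0) ->
  exists x, forall p, \sum_q x q * G q p = F p.
Proof.
move=> kerF; have sumE (f : J -> K) : \sum_(i < #|J|) f (enum_val i) = \sum_q f q.
  by rewrite [RHS](reindex (@enum_val J J)) //; apply: onW_bij; exact: enum_val_bij.
pose M : 'M[K]_(#|J|) := \matrix_(i, j) G (enum_val i) (enum_val j).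
pose v : 'rV[K]_(#|J|) := \row_j F (enum_val j).
have /submxP[x vx] : (v <= M)%MS.
  rewrite submxE; apply/eqP/matrixP => i j; rewrite ord1 [LHS]mxE [RHS]mxE.
  pose z p := cokermx M (enum_rank p) j.
  transitivity (\sum_p F p * z p).
    by rewrite -(sumE (fun p => F p * z p)); apply: eq_bigr => k _; rewrite mxE /z enum_valK.
  apply: kerF => q; rewrite -(sumE (fun p => G q p * z p)).
  have := congr1 (fun A : 'M[K]_(#|J|) => A (enum_rank q) j) (mulmx_coker M).
  rewrite !mxE => H; apply: etrans H; apply: eq_bigr => k _.
  by rewrite mxE /z enum_valK enum_rankK.
exists (fun q => x ord0 (enum_rank q)) => p; rewrite -(sumE (fun q => _ * G q p)).
have := congr1 (fun A : 'rV[K]_(#|J|) => A ord0 (enum_rank p)) vx.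
rewrite !mxE enum_rankK => ->; apply: eq_bigr => k _.
by rewrite mxE enum_valK enum_rankK.
Qed.

Section linearity.
Context (R : realType) (m : nat) (Om : set 'rV[R]_m) (beta : 'rV[R]_m).
Context (V : set ('rV[R]_m -> R)) (dd : ('rV[R]_m -> R) -> 'rV[R]_m -> R).
Context (Nn : set 'rV[R]_m).
Hypothesis ES : energy_space Om beta V dd Nn.
Variables (r N : nat) (tn : nat -> R) (sigma delta : R).
Implicit Types (c e : 'I_r.+1 -> 'rV[R]_m -> R) (C E : nat -> 'I_r.+1 -> 'rV[R]_m -> R).
Implicit Types (u v w : 'rV[R]_m -> R).

Let mOm := es_mOm ES.
Let finOm := es_finOm ES.
Let mi := es_minflow ES.
Let fi := es_fin_surface ES mi.
Let bn := es_normal ES.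
Local Notation bm := bounded_measurable.
Local Notation mrep := (mrep dd).
Local Notation inflow := (inflow Om beta).
Local Notation bil_density := (bil_density Om beta dd sigma delta).
Local Notation discrete_bil := (discrete_bil Om beta dd tn sigma delta).
Local Notation discrete_lin := (discrete_lin Om beta dd tn delta).
Local Notation lin_density := (lin_density Om beta dd delta).
Local Notation VC := (V_coefficients V N).

Definition lin1 a c e k x : R := a * c k x + e k x.

Definition lin_coef a C E j : 'I_r.+1 -> 'rV[R]_m -> R := lin1 a (C j) (E j).

Lemma V_lin1 a c e : (forall k, V (c k)) -> (forall k, V (e k)) ->
  forall k, V (lin1 a c e k).
Proof.
by move=> Vc Ve k; have [_ VD VZ] := finite_spanP (es_span ES); apply: VD => //; exact: VZ.
Qed.

Lemma V_lin_coef a C E : VC C -> VC E -> VC (lin_coef a C E).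
Proof. by move=> HC HE j k jN; apply: V_lin1 => i; [exact: HC|exact: HE]. Qed.

Lemma rep_lin a c e t : rep (lin1 a c e) t = fun x => a * rep c t x + rep e t x.
Proof.
apply/funext => x; rewrite /rep mulr_sumr -big_split /=.
by apply: eq_bigr => k _; rewrite /lin1; ring.
Qed.

Lemma mrep_lin a c e t : (forall k, V (c k)) -> (forall k, V (e k)) ->
  mrep (lin1 a c e) t = fun x => a * mrep c t x + mrep e t x.
Proof.
move=> Vc Ve; have [_ VD VZ] := finite_spanP (es_span ES); apply/funext => x.
have drepE : drep (lin1 a c e) t x = a * drep c t x + drep e t x.
  rewrite /drep mulr_sumr -big_split /=.
  by apply: eq_bigr => k _; rewrite /lin1; ring.
have ddE k : dd (lin1 a c e k) x = a * dd (c k) x + dd (e k) x.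
  rewrite -(es_ddZ ES a x (Vc k)) -(es_ddD ES)//; exact: VZ.
rewrite /mrep drepE mulrDr addrACA; congr (_ + _).
rewrite mulr_sumr -big_split /=; apply: eq_bigr => k _; rewrite ddE; ring.
Qed.

Lemma inner_lin_l a u v w : bm u -> bm v -> bm w ->
  inner Om (fun x => a * u x + v x) w = a * inner Om u w + inner Om v w.
Proof. by move=> bu bv bw; rewrite (innerDl ES) ?(innerZl ES)//; exact: bmZ. Qed.

Lemma inner_lin_r a u v w : bm u -> bm v -> bm w ->
  inner Om w (fun x => a * u x + v x) = a * inner Om w u + inner Om w v.
Proof. by move=> bu bv bw; rewrite innerC inner_lin_l// !(innerC Om w). Qed.

Lemma bd_inner_lin_l a u v w : bm u -> bm v -> bm w ->
  bd_inner Om beta inflow (fun x => a * u x + v x) w =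
  a * bd_inner Om beta inflow u w + bd_inner Om beta inflow v w.
Proof.
move=> bu bv bw; have b1 := bmM (bmM bn bu) bw; have b2 := bmM (bmM bn bv) bw.
rewrite /bd_inner -(bm_RintegralZ mi fi a b1) -(bm_RintegralD mi fi (bmZ a b1) b2).
by apply: eq_Rintegral => x _; ring.
Qed.

Lemma bd_inner_lin_r a u v w : bm u -> bm v -> bm w ->
  bd_inner Om beta inflow w (fun x => a * u x + v x) =
  a * bd_inner Om beta inflow w u + bd_inner Om beta inflow w v.
Proof.
move=> bu bv bw; have b1 := bmM (bmM bn bw) bu; have b2 := bmM (bmM bn bw) bv.
rewrite /bd_inner -(bm_RintegralZ mi fi a b1) -(bm_RintegralD mi fi (bmZ a b1) b2).
by apply: eq_Rintegral => x _; ring.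
Qed.

Lemma bil_density_lin_l a c1 c2 e t : (forall k, V (c1 k)) -> (forall k, V (c2 k)) ->
  (forall k, V (e k)) ->
  bil_density (lin1 a c1 c2) e t = a * bil_density c1 e t + bil_density c2 e t.
Proof.
move=> V1 V2 Ve; rewrite /bil_density rep_lin mrep_lin//.
have r1 := bm_rep ES t V1; have r2 := bm_rep ES t V2; have re := bm_rep ES t Ve.
have m1 := bm_mrep ES t V1; have m2 := bm_mrep ES t V2; have me := bm_mrep ES t Ve.
rewrite bd_inner_lin_l// mulrBr opprD addrACA; apply: (f_equal2 +%R _ erefl).
rewrite -inner_lin_l; [|exact: bmD m1 (bmZ _ r1)|exact: bmD m2 (bmZ _ r2)|exact: bmD re (bmZ _ me)].
by apply: eq_Rintegral => x _; ring.
Qed.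

Lemma bil_density_lin_r a c e1 e2 t : (forall k, V (c k)) -> (forall k, V (e1 k)) ->
  (forall k, V (e2 k)) ->
  bil_density c (lin1 a e1 e2) t = a * bil_density c e1 t + bil_density c e2 t.
Proof.
move=> Vc V1 V2; rewrite /bil_density rep_lin mrep_lin//.
have r1 := bm_rep ES t V1; have r2 := bm_rep ES t V2; have rc := bm_rep ES t Vc.
have m1 := bm_mrep ES t V1; have m2 := bm_mrep ES t V2; have mc := bm_mrep ES t Vc.
rewrite bd_inner_lin_r// mulrBr opprD addrACA; apply: (f_equal2 +%R _ erefl).
rewrite -inner_lin_r; [|exact: bmD r1 (bmZ _ m1)|exact: bmD r2 (bmZ _ m2)|exact: bmD mc (bmZ _ rc)].
by apply: eq_Rintegral => x _; ring.
Qed.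

Lemma lin_density_lin f g a e1 e2 t :
  regular_data lebesgue_rV Om f -> regular_data (surface_measure Om) inflow g ->
  (forall k, V (e1 k)) -> (forall k, V (e2 k)) ->
  lin_density f g (lin1 a e1 e2) t = a * lin_density f g e1 t + lin_density f g e2 t.
Proof.
move=> rf rg V1 V2; rewrite /lin_density rep_lin mrep_lin//.
have r1 := bm_rep ES t V1; have r2 := bm_rep ES t V2.
have m1 := bm_mrep ES t V1; have m2 := bm_mrep ES t V2.
rewrite mulrBr addrACA -opprD; apply: (f_equal2 (fun y z : R => y - z)).
  have i1 := sq_bm_integrable mOm finOm (rf.1 t) (bmD r1 (bmZ delta m1)).
  have i2 := sq_bm_integrable mOm finOm (rf.1 t) (bmD r2 (bmZ delta m2)).
  rewrite /inner -(RintegralZl a mOm i1) -(RintegralD mOm (integrableZl mOm a i1) i2).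
  by apply: eq_Rintegral => x _; ring.
have i1 := sq_bm_integrable mi fi (rg.1 t) (bmM bn r1).
have i2 := sq_bm_integrable mi fi (rg.1 t) (bmM bn r2).
have E e : bd_inner Om beta inflow (fun x => g (t, x)) (rep e t) =
    \int[surface_measure Om]_(x in inflow)
      (g (t, x) * (dotv beta (outward_normal Om x) * rep e t x)).
  by apply: eq_Rintegral => x _; ring.
rewrite !E -(RintegralZl a mi i1) -(RintegralD mi (integrableZl mi a i1) i2).
by apply: eq_Rintegral => x _; ring.
Qed.

Definition linear_on (L : (nat -> 'I_r.+1 -> 'rV[R]_m -> R) -> R) :=
  forall a C E, VC C -> VC E -> L (lin_coef a C E) = a * L C + L E.

Lemma linear_onD L1 L2 : linear_on L1 -> linear_on L2 -> linear_on (fun C => L1 C + L2 C).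
Proof. by move=> h1 h2 a C E VC1 VC2; rewrite h1// h2//; ring. Qed.

Lemma linear_on_sum (s : seq nat) L : (forall j, j \in s -> linear_on (L j)) ->
  linear_on (fun C => \sum_(j <- s) L j C).
Proof.
move=> h a C E VC1 VC2; rewrite mulr_sumr -big_split /=.
by apply: eq_big_seq => j js; exact: h.
Qed.

Lemma discrete_bil_lin_l E : (1 <= N)%N -> VC E -> linear_on (discrete_bil N ^~ E).
Proof.
move=> N1 VE; apply: linear_onD; first apply: linear_onD.
- apply: linear_on_sum => j; rewrite mem_index_iota => jN a C1 C2 VC1 VC2.
  have V1 k : V (C1 j k) by exact: VC1.
  have V2 k : V (C2 j k) by exact: VC2.
  have Ve k : V (E j k) by exact: VE.
  have mS := measurable_slab tn j.
  have p1 := integrable_slab tn j (bil_density_polynomial ES sigma delta V1 Ve).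
  have p2 := integrable_slab tn j (bil_density_polynomial ES sigma delta V2 Ve).
  rewrite -(RintegralZl a mS p1) -(RintegralD mS (integrableZl mS a p1) p2).
  by apply: eq_Rintegral => t _; exact: bil_density_lin_l.
- apply: linear_on_sum => j; rewrite mem_index_iota => jN a C1 C2 VC1 VC2.
  have jN1 : (1 <= j <= N)%N by case/andP: jN => -> /ltnW.
  have jN2 : (1 <= j.+1 <= N)%N by case/andP: jN.
  have b (C : nat -> 'I_r.+1 -> 'rV[R]_m -> R) : VC C -> bm (rep_jump tn C j).
    by move=> H; apply: bmB; apply: (bm_rep ES) => k; exact: H.
  have be : bm (rep (E j.+1) (tn j)) by apply: (bm_rep ES) => k; exact: VE.
  rewrite -(inner_lin_l a (b _ VC1) (b _ VC2) be); congr inner.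
  by apply/funext => x; rewrite /rep_jump /lin_coef !rep_lin; ring.
- move=> a C1 C2 VC1 VC2; have N11 : (1 <= 1 <= N)%N by rewrite N1.
  rewrite /lin_coef rep_lin inner_lin_l//; apply: (bm_rep ES) => k;
    by [exact: VC1|exact: VC2|exact: VE].
Qed.

Lemma discrete_bil_lin_r C : (1 <= N)%N -> VC C -> linear_on (discrete_bil N C).
Proof.
move=> N1 VC0; apply: linear_onD; first apply: linear_onD.
- apply: linear_on_sum => j; rewrite mem_index_iota => jN a C1 C2 VC1 VC2.
  have V1 k : V (C1 j k) by exact: VC1.
  have V2 k : V (C2 j k) by exact: VC2.
  have Ve k : V (C j k) by exact: VC0.
  have mS := measurable_slab tn j.
  have p1 := integrable_slab tn j (bil_density_polynomial ES sigma delta Ve V1).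
  have p2 := integrable_slab tn j (bil_density_polynomial ES sigma delta Ve V2).
  rewrite -(RintegralZl a mS p1) -(RintegralD mS (integrableZl mS a p1) p2).
  by apply: eq_Rintegral => t _; exact: bil_density_lin_r.
- apply: linear_on_sum => j; rewrite mem_index_iota => jN a C1 C2 VC1 VC2.
  have jN1 : (1 <= j <= N)%N by case/andP: jN => -> /ltnW.
  have jN2 : (1 <= j.+1 <= N)%N by case/andP: jN.
  have bj : bm (rep_jump tn C j).
    by apply: bmB; apply: (bm_rep ES) => k; exact: VC0.
  rewrite /lin_coef rep_lin inner_lin_r//; apply: (bm_rep ES) => k;
    by [exact: VC1|exact: VC2].
- move=> a C1 C2 VC1 VC2; have N11 : (1 <= 1 <= N)%N by rewrite N1.
  rewrite /lin_coef rep_lin inner_lin_r//; apply: (bm_rep ES) => k;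
    by [exact: VC1|exact: VC2|exact: VC0].
Qed.

Lemma discrete_lin_lin u0 f g : (1 <= N)%N -> square_integrable lebesgue_rV Om u0 ->
  regular_data lebesgue_rV Om f -> regular_data (surface_measure Om) inflow g ->
  linear_on (discrete_lin u0 f g N).
Proof.
move=> N1 ru rf rg; apply: linear_onD.
- apply: linear_on_sum => j; rewrite mem_index_iota => jN a C1 C2 VC1 VC2.
  have V1 k : V (C1 j k) by exact: VC1.
  have V2 k : V (C2 j k) by exact: VC2.
  have mS := measurable_slab tn j.
  have p1 := lin_density_integrable ES tn delta rf rg j V1.
  have p2 := lin_density_integrable ES tn delta rf rg j V2.
  rewrite -(RintegralZl a mS p1) -(RintegralD mS (integrableZl mS a p1) p2).
  by apply: eq_Rintegral => t _; exact: lin_density_lin.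
- move=> a C1 C2 VC1 VC2; have N11 : (1 <= 1 <= N)%N by rewrite N1.
  have b1 : bm (rep (C1 1%N) (tn 0)) by apply: (bm_rep ES) => k; exact: VC1.
  have b2 : bm (rep (C2 1%N) (tn 0)) by apply: (bm_rep ES) => k; exact: VC2.
  have i1 := sq_bm_integrable mOm finOm ru b1.
  have i2 := sq_bm_integrable mOm finOm ru b2.
  rewrite /lin_coef rep_lin /inner -(RintegralZl a mOm i1).
  rewrite -(RintegralD mOm (integrableZl mOm a i1) i2).
  by apply: eq_Rintegral => x _; ring.
Qed.

Definition combination (J : Type) (s : seq J) (z : J -> R)
    (B : J -> nat -> 'I_r.+1 -> 'rV[R]_m -> R) j k x :=
  \sum_(q <- s) z q * B q j k x.

Lemma V_combination J (s : seq J) z B : (forall q, VC (B q)) -> VC (combination s z B).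
Proof.
move=> VB j k jN; apply: finite_span_sum (es_span ES) _ => q.
by have [_ _ VZ] := finite_spanP (es_span ES); apply: VZ; exact: VB.
Qed.

Lemma linear_on_combination L J (s : seq J) z B : linear_on L -> (forall q, VC (B q)) ->
  L (combination s z B) = \sum_(q <- s) z q * L (B q).
Proof.
move=> hL VB; elim: s => [|q s IH].
  have V0 : VC (combination [::] z B) by exact: V_combination.
  (* For the empty combination, [linear_on] with [a = -1] applied to 0 and 0 gives the value 0. *)
  have := hL (-1) _ _ V0 V0.
  rewrite (_ : lin_coef _ _ _ = combination [::] z B).
    by rewrite big_nil mulN1r addNr.
  apply/funext => j; apply/funext => k; apply/funext => x.
  by rewrite /lin_coef /lin1 mulN1r addNr /combination big_nil.
rewrite big_cons -IH -hL//; last exact: V_combination.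
congr L; apply/funext => j; apply/funext => k; apply/funext => x.
by rewrite /combination big_cons.
Qed.

End linearity.

Lemma Rintegral_eq0 d (T : measurableType d) (R : realType) (nu : {measure set T -> \bar R})
    D (F : T -> R) : (forall x, F x = 0) -> \int[nu]_(x in D) F x = 0.
Proof. by move=> F0; rewrite (_ : F = fun=> 0) /Rintegral ?integral0//; exact/funext. Qed.

Lemma inner0r (R : realType) m (Om : set 'rV[R]_m) u v :
  (forall x, v x = 0) -> inner Om u v = 0.
Proof. by move=> v0; apply: Rintegral_eq0 => x; rewrite v0 mulr0. Qed.

Lemma bd_inner0r (R : realType) m (Om : set 'rV[R]_m) beta G u v :
  (forall x, v x = 0) -> bd_inner Om beta G u v = 0.
Proof. by move=> v0; apply: Rintegral_eq0 => x; rewrite v0 mulr0. Qed.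

Section well_posedness.
Context (R : realType) (m : nat) (Om : set 'rV[R]_m) (beta : 'rV[R]_m).
Context (V : set ('rV[R]_m -> R)) (dd : ('rV[R]_m -> R) -> 'rV[R]_m -> R).
Context (Nn : set 'rV[R]_m).
Hypothesis ES : energy_space Om beta V dd Nn.
Variables (r N : nat) (tn : nat -> R) (T : R).
Hypotheses (T0 : 0 < T) (grid : time_grid T N tn).
Implicit Types (C E : nat -> 'I_r.+1 -> 'rV[R]_m -> R).

Local Notation mu := (@lebesgue_measure R).
Local Notation inflow := (inflow Om beta).
Local Notation X := (space_time V r N tn).
Local Notation VC := (V_coefficients V N).

Let gridlt : forall j, (j < N)%N -> tn j < tn j.+1. Proof. by case: grid. Qed.
Let t0 : tn 0 = 0. Proof. by case: grid. Qed.
Let tN : tn N = T. Proof. by case: grid. Qed.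
Let N1 : (1 <= N)%N.
Proof. by rewrite lt0n; apply/eqP => N0; move: T0; rewrite -tN N0 t0 ltxx. Qed.

Lemma slab_sub j : (1 <= j <= N)%N -> slab tn j `<=` `]0, T[%classic.
Proof.
move=> /andP[j1 jN] t /andP[ta tb]; rewrite /= in_itv /=; apply/andP; split.
  apply: le_lt_trans ta; rewrite -t0; apply: (grid_le gridlt).
  by rewrite leq0n (leq_trans (leq_pred j)).
by apply: lt_le_trans tb _; rewrite -tN; apply: (grid_le gridlt); rewrite jN leqnn.
Qed.

(** Data enter only through integrals over the slabs, which ignore the null set of times where the
    regular representatives differ from them. *)
Lemma admissible_regular u0 f g : admissible_data Om beta T u0 f g ->
  exists f' g', [/\ regular_data lebesgue_rV Om f',
    regular_data (surface_measure Om) inflow g',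
    forall delta n E, (n <= N)%N ->
      discrete_lin Om beta dd tn delta u0 f g n E = discrete_lin Om beta dd tn delta u0 f' g' n E &
    data_norm2 Om beta N tn u0 f g = discrete_data Om beta tn u0 f' g' N].
Proof.
move=> [_ hf hg].
have mA : measurable (`]0, T[%classic : set (measurableTypeR R)) by exact: measurable_itv.
have finA : (mu (`]0%R, T[%classic : set (measurableTypeR R)) < +oo)%E.
  have H := lebesgue_measure_itv `]0%R, T[.
  apply: (@eq_ind_r _ _ (fun x => (x < +oo)%E) _ _ H) => /=.
  by case: ifP => _; rewrite ?ltry// -EFinB ltry.
have [f' rf [B1 [mB1 B10 ff]]] :=
  regular_representative (nu := lebesgue_rV) (es_mOm ES) (es_finOm ES) mA finA hf.
have [g' rg [B2 [mB2 B20 gg]]] :=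
  regular_representative_surface (es_surface ES) (es_minflow ES) mA finA hg.
have mB : measurable (B1 `|` B2) by exact: measurableU.
have B0 : mu (B1 `|` B2) = 0%E by exact: null_set_setU.
exists f', g'; split; [exact: rf|exact: rg| |].
- move=> delta n E nN; rewrite /discrete_lin; apply: (f_equal2 +%R _ erefl).
  apply: eq_big_nat => j /andP[j1 jn].
  have jN : (1 <= j <= N)%N by rewrite j1 (leq_trans _ nN).
  apply: (eq_Rintegral_off_null mB B0) => t tj /not_orP[nB1 nB2].
  have At := slab_sub jN tj.
  apply: (f_equal2 (fun y z : R => y - z)).
    by apply: eq_Rintegral => x /set_mem Ox; rewrite ff.
  by apply: eq_Rintegral => x /set_mem Ox; rewrite gg.
- rewrite /data_norm2 /discrete_data; apply: (f_equal2 +%R _ erefl).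
  apply: eq_big_nat => j jN.
  apply: (eq_Rintegral_off_null mB B0) => t tj /not_orP[nB1 nB2].
  have At := slab_sub jN tj.
  apply: (f_equal2 +%R).
    by apply: eq_Rintegral => x /set_mem Ox; rewrite ff.
  by apply: eq_Rintegral => x /set_mem Ox; rewrite gg.
Qed.

Lemma space_time_basis : exists (J : finType) (B : J -> nat -> 'I_r.+1 -> 'rV[R]_m -> R),
  (forall q, VC (B q)) /\
  forall E, VC E -> exists z, forall j k x, (1 <= j <= N)%N ->
    E j k x = combination (index_enum J) z B j k x.
Proof.
have [I [b VE]] := es_span ES.
have Vb i : V (b i).
  rewrite VE; exists (fun i' => (i' == i)%:R); apply/funext => x.
  rewrite (bigD1 i)//= eqxx mul1r big1 ?addr0// => i' /negPf ->.
  by rewrite mul0r.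
have [_ _ VZ] := finite_spanP (es_span ES).
(* One generator for each slab, power of [t] and generator of [V]. The elements of ['I_N] start at 0
   and the slabs at 1, hence the successor. *)
exists (('I_N * 'I_r.+1) * I)%type,
  (fun (q : ('I_N * 'I_r.+1) * I) j k x => ((q.1.1.+1 == j) && (q.1.2 == k))%:R * b q.2 x).
split; first by move=> q j k _; exact: VZ.
move=> E VCE.
have h (p : 'I_N * 'I_r.+1) : exists a : I -> R,
    E p.1.+1 p.2 = fun x => \sum_i a i * b i x.
  have : V (E p.1.+1 p.2) by apply: VCE; rewrite /= ltn_ord.
  by rewrite {1}VE => -[a ->]; exists a.
have [a ha] := choice h.
exists (fun q => a q.1 q.2) => j k x /andP[j1 jN].
have jlt : (j.-1 < N)%N by rewrite prednK.
pose p0 : 'I_N * 'I_r.+1 := (Ordinal jlt, k).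
have jE : j = p0.1.+1 by rewrite /= prednK.
rewrite /combination.
rewrite -(pair_bigA _ (fun p i => a p i * (((p.1.+1 == j) && (p.2 == k))%:R * b i x))) /=.
rewrite (bigD1 p0)//= [X in _ + X]big1 ?addr0; last first.
  move=> p pp0; apply: big1 => i _; case: eqP => [pj|_] /=; last by rewrite mul0r mulr0.
  case: eqP => [pk|_] /=; last by rewrite mul0r mulr0.
  case/eqP: pp0; case: p pj pk => p1 p2 /= pj ->; congr (_, _).
  by apply: val_inj; rewrite /= -pj.
rewrite prednK// !eqxx /=; have := ha p0; rewrite /= prednK// => ->.
by apply: eq_bigr => i _; rewrite mul1r.
Qed.

Variables (sigma delta : R).
Hypotheses (sigma0 : 0 <= sigma) (delta0 : 0 < delta).
Hypothesis sigma_delta : sigma * delta <= 1.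

Local Notation discrete_bil := (discrete_bil Om beta dd tn sigma delta).
Local Notation discrete_lin := (discrete_lin Om beta dd tn delta).
Local Notation solution := (sd_solution Om beta sigma delta N tn X).

Let NN : (1 <= N <= N)%N. Proof. by rewrite N1 leqnn. Qed.

Lemma discrete_bil_definite C : VC C -> discrete_bil N C C = 0 ->
  forall j t x, (1 <= j <= N)%N -> rep (C j) t x = 0.
Proof.
move=> VCC B0; have := discrete_coercive ES gridlt sigma0 delta0 sigma_delta NN VCC.
rewrite B0 mulr0; exact: (discrete_sd_definite ES gridlt sigma0 delta0 N1 VCC).
Qed.

(** Definiteness of the form yields a vanishing function, not vanishing weights in the generating
    family. This lemma passes from the function to the linear form, as the solvability criterion
    requires. *)
Lemma discrete_lin_rep0 u0 f g C : VC C ->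
  (forall j t x, (1 <= j <= N)%N -> rep (C j) t x = 0) -> discrete_lin u0 f g N C = 0.
Proof.
move=> VCC C0; have [_ _ VZ] := finite_spanP (es_span ES).
have mrep0 j t x : (1 <= j <= N)%N -> mrep dd (C j) t x = 0.
  move=> jN; have Vc k : V (C j k) by exact: VCC.
  rewrite (mrepE ES)//; have [P hP] := rep_point (C j) x.
  have P0 : P = 0.
    apply: (@poly_zero_on_segment R P 0 1) => // s _.
    by rewrite -(hP s).1 C0.
  rewrite (hP t).2 P0 derivC horner0 add0r.
  have -> : rep (C j) t = fun x => 0 * rep (C j) t x.
    by apply/funext => y; rewrite mul0r C0.
  by rewrite (es_ddZ ES) ?mul0r//; exact: (V_rep ES).
have N11 : (1 <= 1 <= N)%N by rewrite N1.
rewrite /discrete_lin inner0r ?addr0; last by move=> x; exact: C0.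
rewrite big_nat big1// => j jN; apply: Rintegral_eq0 => t.
rewrite /lin_density inner0r ?bd_inner0r ?subr0//; first by move=> x; exact: C0.
by move=> x; rewrite mrep0// C0// mulr0 addr0.
Qed.

Lemma solution_discrete u0 f g C U E : VC C -> represents N tn C U -> VC E ->
  solution u0 f g U -> discrete_bil N C E = discrete_lin u0 f g N E.
Proof.
move=> VCC rU VCE [_ sol].
have rW := space_time_of_represents gridlt E.
have XW := represents_space_time VCE rW.
have := sol _ XW.
by rewrite (bilinear_form_rep ES sigma delta gridlt N1 VCC rU VCE rW)
  (linear_form_rep ES delta gridlt u0 f g N1 VCE rW).
Qed.

Lemma solution_unique u0 f g U U' : solution u0 f g U -> solution u0 f g U' ->
  forall j t, (1 <= j <= N)%N -> slab tn j t -> U' t = U t.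
Proof.
move=> sU sU' j t jN tj.
have [C VCC rU] := space_time_coefficients sU.1.
have [C' VCC' rU'] := space_time_coefficients sU'.1.
pose D := lin_coef (-1) C C'.
have VD : VC D by exact: (V_lin_coef ES).
have B0 : discrete_bil N D D = 0.
  rewrite (discrete_bil_lin_l ES tn sigma delta N1 VD)//.
  rewrite (solution_discrete VCC rU VD sU) (solution_discrete VCC' rU' VD sU').
  by rewrite mulN1r addNr.
rewrite (rU' _ _ jN tj) (rU _ _ jN tj); apply/funext => x; apply/eqP.
rewrite -subr_eq0 -(discrete_bil_definite VD B0 t x jN) /D /lin_coef rep_lin.
by rewrite mulN1r addrC.
Qed.

Lemma solution_exists u0 f g : admissible_data Om beta T u0 f g ->
  exists U, solution u0 f g U.
Proof.
move=> adm; have [hu _ _] := adm.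
have [f' [g' [rf rg linE _]]] := admissible_regular adm.
have [J [B [VB span]]] := space_time_basis.
have linL := discrete_lin_lin ES (r := r) tn delta N1 hu rf rg.
have repE (E E' : nat -> 'I_r.+1 -> 'rV[R]_m -> R) W :
    (forall j k x, (1 <= j <= N)%N -> E j k x = E' j k x) ->
    represents N tn E W -> represents N tn E' W.
  move=> EE rW j t jN tj; rewrite (rW j t jN tj).
  by apply/funext => x; apply: eq_bigr => k _; rewrite EE.
have Vcomb z : VC (combination (index_enum J) z B) by exact: (V_combination ES).
have [x hx] : exists x, forall p,
    \sum_q x q * discrete_bil N (B q) (B p) = discrete_lin u0 f' g' N (B p).
  apply: solvable_of_kernel.
  (* Weights [z] in the kernel combine to a [Z] with [discrete_bil N Z Z = 0], so [Z] vanishes as a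
     function and the linear form vanishes on it. *)
  move=> z Gz; set Z := combination (index_enum J) z B.
  have VZ : VC Z by exact: Vcomb.
  have Z0 : discrete_bil N Z Z = 0.
    rewrite {1}/Z (linear_on_combination ES _ z (discrete_bil_lin_l ES tn sigma delta N1 VZ) VB).
    apply: big1 => q _; rewrite /Z.
    rewrite (linear_on_combination ES _ z (discrete_bil_lin_r ES tn sigma delta N1 (VB q)) VB).
    under eq_bigr do rewrite mulrC.
    by rewrite Gz mulr0.
  have L0 : discrete_lin u0 f' g' N Z = 0.
    by apply: (discrete_lin_rep0 _ _ _ VZ) => j t y jN; exact: (discrete_bil_definite VZ Z0).
  rewrite -[RHS]L0 /Z (linear_on_combination ES _ z linL VB).
  by apply: eq_bigr => p _; rewrite mulrC.
pose C := combination (index_enum J) x B.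
have rU := space_time_of_represents gridlt C.
exists (space_time_of N tn C); split; first exact: represents_space_time (Vcomb x) rU.
move=> W XW; have [E VE rW] := space_time_coefficients XW.
have [z hz] := span E VE.
have rW' := repE _ _ _ hz rW.
rewrite (bilinear_form_rep ES sigma delta gridlt N1 (Vcomb x) rU (Vcomb z) rW').
rewrite (linear_form_rep ES delta gridlt u0 f g N1 (Vcomb z) rW') linE//.
rewrite (linear_on_combination ES _ z (discrete_bil_lin_r ES tn sigma delta N1 (Vcomb x)) VB).
rewrite (linear_on_combination ES _ z linL VB); apply: eq_bigr => p _; apply: (f_equal2 *%R erefl).
rewrite -hx.
by rewrite (linear_on_combination ES _ x (discrete_bil_lin_l ES tn sigma delta N1 (VB p)) VB).
Qed.

(** Elements of the discrete space may jump in time, so cutting off after slab [n] gives an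
    admissible test function; tested with it, the equation becomes the one on the first [n]
    slabs. *)
Definition truncate n C j : 'I_r.+1 -> 'rV[R]_m -> R :=
  if (j <= n)%N then C j else fun _ _ => 0.

Lemma V_truncate n C : VC C -> VC (truncate n C).
Proof.
move=> VCC j k jN; rewrite /truncate; case: ifP => _; first exact: VCC.
by have [] := finite_spanP (es_span ES).
Qed.

Let rep0 t x : rep (fun _ : 'I_r.+1 => fun _ : 'rV[R]_m => 0) t x = 0.
Proof. by rewrite /rep big1// => k _; rewrite mulr0. Qed.

Let mrep0 t x : mrep dd (fun _ : 'I_r.+1 => fun _ => 0) t x = 0.
Proof.
have [V0 _ _] := finite_spanP (es_span ES).
rewrite /mrep /drep !big1 ?addr0// => k _; last by rewrite mulr0.
have -> : (fun _ : 'rV[R]_m => 0 : R) = fun x => 0 * (fun=> 0) x.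
  by apply/funext => y; rewrite mul0r.
by rewrite (es_ddZ ES)// mul0r mulr0.
Qed.

Lemma sum_truncate (F G : nat -> R) n n' : (1 <= n <= n')%N ->
  (forall j, (1 <= j < n)%N -> F j = G j) -> (forall j, (n <= j)%N -> F j = 0) ->
  \sum_(1 <= j < n') F j = \sum_(1 <= j < n) G j.
Proof.
move=> /andP[n1 nn'] FG F0; rewrite (@big_cat_nat _ _ _ n)//= [X in _ + X]big_nat.
rewrite [X in _ + X]big1 ?addr0; first exact: eq_big_nat.
by move=> j /andP[nj _]; exact: F0.
Qed.

Lemma discrete_bil_truncate n C : (1 <= n <= N)%N ->
  discrete_bil N C (truncate n C) = discrete_bil n C C.
Proof.
move=> /andP[n1 nN]; apply: (f_equal2 +%R (f_equal2 +%R _ _) _).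
- apply: sum_truncate => [|j /andP[j1 jn]|j nj]; first exact: nN.
    by rewrite /truncate -ltnS jn.
  apply: Rintegral_eq0 => t; rewrite /truncate leqNgt nj /bil_density /=.
  rewrite inner0r ?bd_inner0r ?subr0// => x; by rewrite rep0 ?mrep0 ?mulr0 ?addr0.
(* The jump at [tn j] is paired with the trace from slab [j + 1], which is 0 from [j = n] on, so the
   jump at [tn n] drops out. *)
- apply: sum_truncate => [|j /andP[j1 jn]|j nj]; first by rewrite n1.
    by rewrite /truncate jn.
  by rewrite /truncate leqNgt ltnS nj inner0r// => x; exact: rep0.
- by rewrite /truncate n1.
Qed.

Lemma discrete_lin_truncate u0 f g n C : (1 <= n <= N)%N ->
  discrete_lin u0 f g N (truncate n C) = discrete_lin u0 f g n C.
Proof.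
move=> /andP[n1 nN]; apply: (f_equal2 +%R _ _).
- apply: sum_truncate => [|j /andP[j1 jn]|j nj]; first exact: nN.
    by rewrite /truncate -ltnS jn.
  apply: Rintegral_eq0 => t; rewrite /truncate leqNgt nj /lin_density /=.
  rewrite inner0r ?bd_inner0r ?subr0// => x; by rewrite rep0 ?mrep0 ?mulr0 ?addr0.
- by rewrite /truncate n1.
Qed.

Lemma solution_stable_pos u0 f g U : 0 < sigma -> admissible_data Om beta T u0 f g ->
  solution u0 f g U ->
  sd_norm2 Om beta sigma delta N tn U <= (8 / sigma + 4) * data_norm2 Om beta N tn u0 f g.
Proof.
move=> s0 adm sU; have [hu _ _] := adm.
have [f' [g' [rf rg linE ->]]] := admissible_regular adm.
have [C VCC rU] := space_time_coefficients sU.1.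
rewrite (sd_norm2_rep ES sigma delta gridlt N1 VCC rU).
apply: (discrete_stable_pos ES gridlt sigma0 delta0 sigma_delta hu rf rg s0 N1 VCC).
by rewrite (solution_discrete VCC rU VCC sU) linE.
Qed.

Lemma solution_stable u0 f g U : admissible_data Om beta T u0 f g ->
  solution u0 f g U ->
  sd_norm2 Om beta sigma delta N tn U <=
  4 * (4 * (T * (2 + 4 * T / delta)) + 2 * delta + 2) * data_norm2 Om beta N tn u0 f g.
Proof.
move=> adm sU; have [hu _ _] := adm.
have [f' [g' [rf rg linE ->]]] := admissible_regular adm.
have [C VCC rU] := space_time_coefficients sU.1.
rewrite (sd_norm2_rep ES sigma delta gridlt N1 VCC rU).
apply: (discrete_stable_truncated ES gridlt sigma0 delta0 sigma_delta hu rf rg t0 tN N1 VCC).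
move=> n nN; rewrite -(discrete_bil_truncate _ nN) -(linE delta n C); last by case/andP: nN.
rewrite -(discrete_lin_truncate _ _ _ _ nN).
exact: solution_discrete VCC rU (V_truncate n VCC) sU.
Qed.

Lemma data_norm2_ge0 u0 f g : 0 <= data_norm2 Om beta N tn u0 f g.
Proof.
rewrite addr_ge0 ?norm2_ge0// sumr_ge0// => j _; apply: Rintegral_ge0 => t _.
by rewrite addr_ge0 ?norm2_ge0 ?bd_norm2_ge0.
Qed.

End well_posedness.

Theorem theorem2 (R : realType) (d : nat) (Om1 Om2 : set 'rV[R]_d)
    (V1 V2 : nat -> set ('rV[R]_d -> R)) (r : nat)
    (beta : 'rV[R]_(d + d)) (sigma : R) :
  (1 <= d <= 3)%N ->
  polyhedral_lipschitz_domain Om1 -> polyhedral_lipschitz_domain Om2 ->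
  finite_element_spaces Om1 V1 -> finite_element_spaces Om2 V2 ->
  0 <= sigma ->
  let Om := product_domain Om1 Om2 in
  let X L N tn := space_time (sparse_grid V1 V2 L) r N tn in
  [/\ (* existence and uniqueness *)
      forall (delta T : R) (N : nat) (tn : nat -> R) (L : nat) u0 f g,
        0 < delta -> (0 < sigma -> delta < 1 / sigma) ->
        0 < T -> time_grid T N tn -> (1 <= L)%N ->
        admissible_data Om beta T u0 f g ->
        exists U, sd_solution Om beta sigma delta N tn (X L N tn) u0 f g U /\
          forall U', sd_solution Om beta sigma delta N tn (X L N tn) u0 f g U' ->
            forall j t, (1 <= j <= N)%N -> slab tn j t -> U' t = U t,
      (* stability *)
      0 < sigma ->
        exists C : R, 0 < C /\
        forall (delta T : R) (N : nat) (tn : nat -> R) (L : nat) u0 f g U,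
          0 < delta -> delta < 1 / sigma ->
          0 < T -> time_grid T N tn -> (1 <= L)%N ->
          admissible_data Om beta T u0 f g ->
          sd_solution Om beta sigma delta N tn (X L N tn) u0 f g U ->
          sd_norm2 Om beta sigma delta N tn U
            <= C * data_norm2 Om beta N tn u0 f g &
      (* exponential dependence on the final time *)
      sigma = 0 ->
        forall delta : R, 0 < delta ->
        exists C c : R, [/\ 0 < C, 0 < c &
        forall (T : R) (N : nat) (tn : nat -> R) (L : nat) u0 f g U,
          0 < T -> time_grid T N tn -> (1 <= L)%N ->
          admissible_data Om beta T u0 f g ->
          sd_solution Om beta sigma delta N tn (X L N tn) u0 f g U ->
          sd_norm2 Om beta sigma delta N tn U
            <= C * expR (c * T) * data_norm2 Om beta N tn u0 f g]].
Proof.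
move=> /andP[d1 _] P1 P2 F1 F2 sigma0 Om X.
have pos_sd (delta : R) : 0 < delta -> (0 < sigma -> delta < 1 / sigma) -> sigma * delta <= 1.
  move=> delta0 ds; have [->|s0] := eqVneq sigma 0; first by rewrite mul0r.
  have sp : 0 < sigma by rewrite lt_neqAle eq_sym s0.
  by have := ltW (ds sp); rewrite ler_pdivlMr// mulrC.
split.
- move=> delta T N tn L u0 f g delta0 ds T0 grid L1 adm.
  have [dd [Nn ES]] := sparse_grid_energy_space beta d1 P1 P2 F1 F2 L1.
  have sd := pos_sd _ delta0 ds.
  have [U sU] := solution_exists ES r T0 grid sigma0 delta0 sd adm.
  by exists U; split => // U' sU'; exact: (solution_unique ES T0 grid sigma0 delta0 sd sU sU').
(* The constant depends on [sigma] alone: not on the level, the time grid, [T] or [delta]. *)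
- move=> s0; exists (8 / sigma + 4); split; first by rewrite addr_gt0// divr_gt0.
  move=> delta T N tn L u0 f g U delta0 ds T0 grid L1 adm sU.
  have [dd [Nn ES]] := sparse_grid_energy_space beta d1 P1 P2 F1 F2 L1.
  have sd := pos_sd _ delta0 (fun=> ds).
  exact: (solution_stable_pos ES T0 grid sigma0 delta0 sd s0 adm sU).
- move=> sigma00 delta delta0.
  (* The bound to be dominated is [32 T + 64 T^2 / delta + 8 delta + 8]. Since [exp (2 T)] is at
     least 1, [T] and [T^2], the coefficients may simply be added up, with [40 = 32 + 8]. *)
  exists (40 + 64 / delta + 8 * delta), 2; split => //.
    by rewrite addr_gt0 ?mulr_gt0// addr_gt0// divr_gt0.
  move=> T N tn L u0 f g U T0 grid L1 adm sU.
  have [dd [Nn ES]] := sparse_grid_energy_space beta d1 P1 P2 F1 F2 L1.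
  have sd : sigma * delta <= 1 by rewrite sigma00 mul0r.
  apply: le_trans (solution_stable ES T0 grid sigma0 delta0 sd adm sU) _.
  apply: ler_wpM2r; first exact: data_norm2_ge0.
  have eT := expR_ge1Dx T; set e := expR T in eT.
  have -> : expR (2 * T) = e * e by rewrite -expRD; congr expR; ring.
  have di : 0 < delta^-1 by rewrite invr_gt0.
  have e1 : 1 <= e * e by nra.
  have e2 : T <= e * e by nra.
  have e3 : T ^+ 2 <= e * e by nra.
  have h1 := ler_wpM2l (ltW di) e3; have h2 := ler_wpM2l (ltW delta0) e1.
  rewrite (_ : 4 * _ = 32 * T + 64 * (delta^-1 * T ^+ 2) + 8 * delta + 8); last first.
    by field; rewrite gt_eqF.
  rewrite (_ : _ * (e * e) = 40 * (e * e) + 64 * (delta^-1 * (e * e)) + 8 * (delta * (e * e)));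
    last by ring.
  rewrite mulr1 in h2.
  have arith (t x1 x2 y z E : R) : x1 <= x2 -> z <= y -> 1 <= E -> t <= E ->
      32 * t + 64 * x1 + 8 * z + 8 <= 40 * E + 64 * x2 + 8 * y by move=> *; lra.
  exact: arith h1 h2 e1 e2.
Qed.
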